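(* Let $\Phi$ be a stationary marked renewal process satisfying the assumptions in the context. If $\{D_{\nu_n}\}_{n\ge0}$ converges weakly under its Palm distribution to a non-degenerate random variable $D_\infty$, then the weak limit $\mathbb{P}^{s_C,\infty}_+$ of $\{\mathbb{P}^{s_C,n}_+\}_{n\ge0}$ exists. Moreover, if $\mathbb{E}^0[D_\infty]<\infty$, $\mathbb{E}^0[\nu_\infty]<\infty$, and $L_{0,1}$ has a strict $\mathbb{P}^0$-tail heavier than $D_\infty$, then the asymptotic efficiency $e$ of sequential checkpointing exists and is equal to $$e=\frac{\mathbb{E}^{s_C,\infty}_+[D^C_0]}{\mathbb{E}^{s_C,\infty}_+[T^C_0]}\qquad\mathbb{P}^0\text{-a.s.}$$ If $D_\infty$ has a $\mathbb{P}^0$-tail heavier than $L_{0,1}$, then $e=0$ $\mathbb{P}^0$-a.s.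
   Context: Let $\mathbb{R}^+=[0,\infty)$. $\Phi=\{(X_n,\mathbf{L}_n)\}_{n\in\mathbb{Z}}$ is a stationary simple marked point process on $\mathbb{R}$ with intensity in $(0,\infty)$, points labelled so that $X_n<X_{n+1}$ and $X_0\le 0\le X_1$, and marks $\mathbf{L}_n=\{L_{n,i}\}_{i\ge1}\in(\mathbb{R}^+)^{\mathbb{N}}$ (failure marks). $\mathbb{P}^0$ (expectation $\mathbb{E}^0$) is its Palm probability, i.e. its law given a point at the origin, so $X_0=0$ $\mathbb{P}^0$-a.s. Put $D_n=X_{n+1}-X_n$. Assumptions under $\mathbb{P}^0$: $\{D_n\}_{n\in\mathbb{Z}}$ is i.i.d.; for each $n$, the sequence $\{L_{n,i}\}_{i\ge1}$ is i.i.d., and for $n\ge0$ it is independent of $D_m$ for all $m\ge n$; $D_0$ and $L_{0,1}$ have right-unbounded support (i.e. each exceeds every $x\ge0$ with positive probability) and finite expectation; the restriction of the process to $\mathbb{R}^+$ is an independently marked renewal process (the marks $\mathbf{L}_n$, $n\ge0$, are i.i.d. in $n$ and independent of $\{D_n\}_{n\ge0}$). For $n\ge0$ let $\tau_n=\inf\{k\ge1:L_{n,k}>D_n\}$ and $Z_n=L_{n,\tau_n}-D_n$. Set $\nu_{-1}=0$ and, for $n\ge0$, $\nu_n=\sup\{k\ge\nu_{n-1}+1: Z_{\nu_{n-1}}>X_k-X_{\nu_{n-1}+1}\}$. Thus $D_{\nu_n}=X_{\nu_n+1}-X_{\nu_n}$. The $n$-th ideal time is $D^C_n=X_{\nu_n}-X_{\nu_{n-1}}$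 and the $n$-th actual time is $T^C_n=\sum_{i=1}^{\tau_{\nu_{n-1}}}L_{\nu_{n-1},i}$; in particular $D^C_0=X_{\nu_0}$ (for $X_0=0$) and $T^C_0=\sum_{i=1}^{\tau_0}L_{0,i}$. The asymptotic efficiency is $e=\lim_{N\to\infty}\frac{\sum_{n=0}^{N-1}D^C_n}{\sum_{n=0}^{N-1}T^C_n}$, whenever the limit exists $\mathbb{P}^0$-a.s. Let $\theta^{\nu_n}$ be the shift of the marked point process that moves $X_{\nu_n}$ to the origin, i.e. $\theta^{\nu_n}\Phi=\{(X_m-X_{\nu_n},\mathbf{L}_m)\}_{m\in\mathbb{Z}}$. Let $\mathbb{P}^{s_C,n}=\mathbb{P}^0\circ(\theta^{\nu_n})^{-1}$, and let $\mathbb{P}^{s_C,n}_+$ be its restriction to marked counting measures on $\mathbb{R}^+$ with a point at the origin; equivalently, $\mathbb{P}^{s_C,n}_+$ may be regarded as the law under $\mathbb{P}^0$ of $\{(D_{\nu_n+i},\mathbf{L}_{\nu_n+i})\}_{i\ge0}$ on $(\mathbb{R}^+\times(\mathbb{R}^+)^{\mathbb{N}})^{\mathbb{N}}$ with the cylindrical Borel $\sigma$-algebra. $\mathbb{P}^{s_C,\infty}_+$ denotes the weak limit of $\{\mathbb{P}^{s_C,n}_+\}_{n\ge0}$ when it exists, and $\mathbb{E}^{s_C,\infty}_+$ its expectation. Given the weak limit $D_\infty$, let $\hat D_\infty$ be an independent random variable distributed like $D_\infty$ under the Palm distribution, and set $\tau_\infty=\inf\{k\ge1:L_{0,k}>\hat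 D_\infty\}$ and $\nu_\infty=\sup\{k\ge1: L_{0,\tau_\infty}\ge X_k\}$. Tail comparison, for random variables $V,W$ with right-unbounded support on the same probability space: $V$ has a $\mathbb{P}^0$-tail heavier than $W$ if there is $z_0$ with $\mathbb{P}^0[V>z]\ge\mathbb{P}^0[W>z]$ for all $z\ge z_0$; $V$ has a strict $\mathbb{P}^0$-tail heavier than $W$ if there are $z_0$ and $\epsilon>0$ with $\mathbb{P}^0[V>z]\ge\mathbb{P}^0[W>z]^{\epsilon}$ for all $z\ge z_0$. *)

(* Defs.v *)
From HB Require Import structures.
From mathcomp Require Import all_boot all_order all_algebra.
From mathcomp Require Import finmap.
From mathcomp Require Import all_classical all_reals all_analysis.

Set Implicit Arguments.
Unset Strict Implicit.
Unset Printing Implicit Defensive.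

Import Order.TTheory GRing.Theory Num.Theory.
Import numFieldNormedType.Exports.

Local Open Scope classical_set_scope.
Local Open Scope ring_scope.

Definition cylinders (I : Type) d (T : measurableType d) : set (set (I -> T)) :=
  [set C | exists i A, measurable A /\ C = [set f | A (f i)]].

(* [I -> T] with the sigma-algebra generated by the coordinates *)
Notation seqspace I T := (g_sigma_algebraType (@cylinders I _ T)).

(* A mark sequence is indexed from 0: [l i] stands for the (i+1)-st failure
   mark L_{n,i+1}. *)
Notation marks R := (seqspace nat (R : realType)).

(* Points and marks of the process, [(X_n, L_n)] for n in Z *)
Notation config R := (seqspace int (R * marks R)%type).

(* Inter-point distances and marks on the half-line, [(D_n, L_n)] for n >= 0 *)
Notation hpath R := (seqspace nat (R * marks R)%type).

(* The same carrier as [hpath R], with the product topology (pointwise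
   convergence in both indices) *)
Notation hpath_top R := {ptws nat -> (R * {ptws nat -> R})%type}.

Section probability_notions.
Context d (Omega : measurableType d) (R : realType) (P : probability Omega R).

Definition mutually_independent (I : choiceType) d' (T : measurableType d')
    (X : I -> Omega -> T) : Prop :=
  forall (J : {fset I}) (A : I -> set T), (forall i, measurable (A i)) ->
    P (\bigcap_(i in [set` J]) (X i @^-1` A i)) =
    (\prod_(i <- J) P (X i @^-1` A i))%E.

Definition identically_distributed (I : Type) d' (T : measurableType d')
    (X : I -> Omega -> T) : Prop :=
  forall i j (A : set T), measurable A -> P (X i @^-1` A) = P (X j @^-1` A).

Definition iid (I : choiceType) d' (T : measurableType d')
    (X : I -> Omega -> T) : Prop :=
  mutually_independent X /\ identically_distributed X.

Definition independent_pair d1 (T1 : measurableType d1) d2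
    (T2 : measurableType d2) (X : Omega -> T1) (Y : Omega -> T2) : Prop :=
  forall (A : set T1) (B : set T2), measurable A -> measurable B ->
    P (X @^-1` A `&` Y @^-1` B) = (P (X @^-1` A) * P (Y @^-1` B))%E.

Definition right_unbounded (V : Omega -> R) : Prop :=
  forall x : R, 0 <= x -> (0 < P [set w | (x < V w)%R])%E.

End probability_notions.

(* [C] is the class of continuous functions, for a topology which need not be
   attached to the type [T] carrying the sigma-algebra. *)
Definition weakly_converges d (T : measurableType d) (R : realType)
    (C : set (T -> R)) (mu : nat -> set T -> \bar R) (nu : set T -> \bar R) :
    Prop :=
  forall f : T -> R, C f -> (exists M : R, forall x, `|f x| <= M) ->
    (\int[mu n]_x (f x)%:E)%E @[n --> \oo] --> (\int[nu]_x (f x)%:E)%E.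

Section tails.
Context d (T : measurableType d) (R : realType) (mu : set T -> \bar R).

Definition heavier_tail (V W : T -> R) : Prop :=
  exists z0 : R, forall z : R, z0 <= z ->
    (mu [set w | (W w > z)%R] <= mu [set w | (V w > z)%R])%E.

Definition strictly_heavier_tail (V W : T -> R) : Prop :=
  exists (z0 eps : R), 0 < eps /\ forall z : R, z0 <= z ->
    (poweR (mu [set w | (W w > z)%R]) eps <= mu [set w | (V w > z)%R])%E.

End tails.

(* Infimum and supremum of a set of natural numbers, when they are attained in
   nat; the value is 0 otherwise. Below this default is only met on null
   events, except for the supremum of the empty set, which is 0. *)
Definition nat_inf (A : set nat) : nat :=
  xget 0%N [set k | A k /\ forall j, A j -> (k <= j)%N].

Definition nat_sup (A : set nat) : nat :=
  xget 0%N [set k | A k /\ forall j, A j -> (j <= k)%N].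

Section point_process.
Context (R : realType).
Implicit Types (phi : config R).

Definition point phi (n : int) : R := (phi n).1.
Definition mark phi (n : int) (i : nat) : R := (phi n).2 i.
Definition gap phi (n : int) : R := point phi (n + 1) - point phi n.

Definition admissible phi : Prop :=
  [/\ forall n, point phi n < point phi (n + 1),
      point phi 0 <= 0 <= point phi 1 &
      forall n i, 0 <= mark phi n i].

Definition count_points phi (B : set (R * marks R)) : \bar R :=
  counting [set n : int | B (phi n)].

Definition translate (t : R) phi : config R :=
  fun n => ((phi n).1 - t, (phi n).2).

Definition theta (n : int) phi : config R :=
  fun m => ((phi (n + m)).1 - (phi n).1, (phi (n + m)).2).

Context d (Omega : measurableType d) (P : probability Omega R)
  (Phi : {RV P >-> config R}).

(* The finite-dimensional laws of the marked counting measure, which takes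
   values in {0, 1, ..., +oo}, are invariant under translations. *)
Definition stationary : Prop :=
  forall (t : R) (k : nat) (B : 'I_k -> set (R * marks R)) (c : 'I_k -> \bar R),
    (forall i, measurable (B i)) ->
    P [set w | forall i, count_points (translate t (Phi w)) (B i) = c i] =
    P [set w | forall i, count_points (Phi w) (B i) = c i].

Definition intensity : \bar R :=
  (\int[P]_w counting [set n : int | (0 <= point (Phi w) n < 1)%R])%E.

(* [P0] is the Palm probability of [Phi]: the mean over the points in [0, 1) of
   the process seen from these points. *)
Definition is_palm (P0 : probability (config R) R) : Prop :=
  forall A : set (config R), measurable A ->
    (intensity * P0 A =
     \int[P]_w counting [set n : int | (0 <= point (Phi w) n < 1)%R /\
                                       A (theta n (Phi w))])%E.

Definition stationary_marked_point_process : Prop :=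
  [/\ {ae P, forall w, admissible (Phi w)},
      stationary &
      (0 < intensity < +oo)%E].

End point_process.

Section assumptions.
Context (R : realType) (P0 : probability (config R) R).

Definition mark_seq (n : int) (phi : config R) : marks R := (phi n).2.

Definition gap_seq (phi : config R) : seqspace nat R :=
  fun n : nat => gap phi n%:Z.

Definition mark_seqs (phi : config R) : seqspace nat (marks R) :=
  fun n : nat => mark_seq n%:Z phi.

Definition gap0 (phi : config R) : R := gap phi 0.
Definition mark01 (phi : config R) : R := mark phi 0 0.

Record renewal_assumptions : Prop := RenewalAssumptions {
  gaps_iid : iid P0 (fun (n : int) phi => gap phi n);
  marks_iid : forall n : int, iid P0 (fun (i : nat) phi => mark phi n i);
  marks_gaps_indep : forall n m : int, 0 <= n -> n <= m ->
    independent_pair P0 (mark_seq n) (fun phi => gap phi m);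
  gap0_unbounded : right_unbounded P0 gap0;
  mark01_unbounded : right_unbounded P0 mark01;
  gap0_mean : ('E_P0[gap0] < +oo)%E;
  mark01_mean : ('E_P0[mark01] < +oo)%E;
  mark_seqs_iid : iid P0 (fun (n : nat) phi => mark_seq n%:Z phi);
  mark_seqs_indep : independent_pair P0 mark_seqs gap_seq
}.

End assumptions.

Section checkpointing.
Context (R : realType).
Implicit Types (xi : hpath R) (x : R) (l : marks R).

(* 1-based number of the first mark exceeding [x], hence [k.-1] *)
Definition first_exceed x l : nat :=
  nat_inf [set k : nat | (1 <= k)%N /\ l k.-1 > x].

Definition Dseq xi (n : nat) : R := (xi n).1.
Definition Lseq xi (n : nat) : marks R := (xi n).2.

(* The points on the half-line, the point numbered 0 being at the origin *)
Definition Xseq xi (k : nat) : R := \sum_(i < k) Dseq xi i.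

Definition tau xi (n : nat) : nat := first_exceed (Dseq xi n) (Lseq xi n).

Definition Zseq xi (n : nat) : R := Lseq xi n (tau xi n).-1 - Dseq xi n.

(* [ckpt xi n] is nu_{n-1}, so that [ckpt xi 0] is nu_{-1} = 0. *)
Fixpoint ckpt xi (n : nat) : nat :=
  if n is m.+1 then
    nat_sup [set k : nat | ((ckpt xi m).+1 <= k)%N /\
                           Zseq xi (ckpt xi m) > Xseq xi k - Xseq xi (ckpt xi m).+1]
  else 0%N.

Definition nu xi (n : nat) : nat := ckpt xi n.+1.

Definition ideal_time xi (n : nat) : R := Xseq xi (ckpt xi n.+1) - Xseq xi (ckpt xi n).

Definition actual_time xi (n : nat) : R :=
  \sum_(i < tau xi (ckpt xi n)) Lseq xi (ckpt xi n) i.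

Definition efficiency_ratio xi (N : nat) : R :=
  (\sum_(n < N) ideal_time xi n) / (\sum_(n < N) actual_time xi n).

Definition path_of (phi : config R) : hpath R :=
  fun n : nat => (gap phi n%:Z, mark_seq n%:Z phi).

(* The process on the half-line seen from X_{nu_n} *)
Definition path_from_nu (n : nat) (phi : config R) : hpath R :=
  fun i : nat => path_of phi (nu (path_of phi) n + i)%N.

Definition gap_at_nu (n : nat) (phi : config R) : R :=
  Dseq (path_of phi) (nu (path_of phi) n).

Context (P0 : probability (config R) R).

(* P^{s_C,n}_+ *)
Definition checkpoint_law (n : nat) : set (hpath R) -> \bar R :=
  pushforward P0 (path_from_nu n).

Definition gaps_converge_weakly d (Omega : measurableType d)
    (Q : probability Omega R) (Dinf : {RV Q >-> R}) : Prop :=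
  weakly_converges [set f : R -> R | continuous f]
    (fun n => pushforward P0 (gap_at_nu n)) (distribution Q Dinf).

Definition nondegenerate_rv d (Omega : measurableType d)
    (Q : probability Omega R) (Dinf : {RV Q >-> R}) : Prop :=
  forall c : R, (Q [set w | Dinf w = c] < 1)%E.

(* The underlying space of the paths is (R^+ x (R^+)^N)^N, a closed subset of
   [hpath R]. *)
Definition checkpoint_weak_limit (Pinf : probability (hpath R) R) : Prop :=
  Pinf [set xi | forall n, 0 <= Dseq xi n /\ forall i, 0 <= Lseq xi n i] = 1%E /\
  weakly_converges [set f : hpath R -> R | continuous (f : hpath_top R -> R)]
    checkpoint_law Pinf.

Definition efficiency_is (e : R) : Prop :=
  {ae P0, forall phi, efficiency_ratio (path_of phi) N @[N --> \oo] --> e}.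

(* nu_infinity, where [x] is the value of the copy of D_infinity that is
   independent of the process *)
Definition nu_inf (phi : config R) x : nat :=
  nat_sup [set k : nat | (1 <= k)%N /\
    mark phi 0 (first_exceed x (mark_seq 0 phi)).-1 >= point phi k%:Z].

Section limit_variable.
Context d (Omega : measurableType d) (Q : probability Omega R)
  (Dinf : {RV Q >-> R}).

(* The process and an independent copy of D_infinity live on the product space
   under the product probability [P0 \x Q]. *)
Definition mean_nu_inf : \bar R :=
  (\int[P0 \x Q]_w ((nu_inf w.1 (Dinf w.2))%:R)%:E)%E.

Definition mark_on_product (w : config R * Omega) : R := mark01 w.1.
Definition Dinf_on_product (w : config R * Omega) : R := Dinf w.2.

End limit_variable.

End checkpointing.

(* Main.v *)
Require Import Defs.
From HB Require Import structures.
From mathcomp Require Import all_boot all_order all_algebra.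
From mathcomp Require Import finmap.
From mathcomp Require Import all_classical all_reals all_analysis.
From mathcomp Require Import measurable_realfun lra.

Set Implicit Arguments.
Unset Strict Implicit.
Unset Printing Implicit Defensive.

Import Order.TTheory GRing.Theory Num.Theory.
Import numFieldNormedType.Exports.

Local Open Scope classical_set_scope.
Local Open Scope ring_scope.

(** * Sequence spaces *)

Section sequence_spaces.
Context d (T : measurableType d).

Lemma measurable_coord (I : Type) (i : I) :
  measurable_fun setT (fun x : seqspace I T => x i).
Proof.
move=> _ A mA; rewrite setTI; apply: sub_sigma_algebra.
by exists i, A.
Qed.

Lemma measurable_fun_seqspace d' (X : measurableType d') (I : Type)
    (f : X -> seqspace I T) :
  (forall i, measurable_fun setT (fun x => f x i)) -> measurable_fun setT f.
Proof.
move=> mf; apply: (@measurability _ _ X (seqspace I T) setT f (@cylinders I d T)) => //.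
move=> _ [_ [i [A [mA ->]]] <-].
exact: mf.
Qed.

Lemma measurable_coord_comp d' (X : measurableType d') (I : Type)
    (f : X -> seqspace I T) (i : I) :
  measurable_fun setT f -> measurable_fun setT (fun x => f x i).
Proof. exact: (measurableT_comp (measurable_coord i)). Qed.

End sequence_spaces.

Section sequence_operations.
Context (T : Type).
Implicit Types x y : nat -> T.

Definition scons (t : T) x : nat -> T := fun n => if n is m.+1 then x m else t.

Definition sshift (k : nat) x : nat -> T := fun n => x (k + n)%N.

Lemma sshiftD k l x : sshift k (sshift l x) = sshift (l + k)%N x.
Proof. by apply/funext => n; rewrite /sshift addnA. Qed.

Lemma sshift0 x : sshift 0 x = x.
Proof. by []. Qed.

Lemma sshiftS_scons k t x : sshift k.+1 (scons t x) = sshift k x.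
Proof. by []. Qed.

Lemma scons_eta x : scons (x 0%N) (sshift 1 x) = x.
Proof. by apply/funext => -[|n]. Qed.

Definition agree (k : nat) x y := forall i, (i < k)%N -> x i = y i.

(** The value of [u] is known from the first [k] terms. *)
Definition past (U : Type) (k : nat) (u : (nat -> T) -> U) :=
  forall x y, agree k x y -> u x = u y.

Lemma past_scons (U : Type) k (u : (nat -> T) -> U) t :
  past k.+1 u -> past k (fun x => u (scons t x)).
Proof. by move=> pu x y xy; apply: pu => -[|i]//= ik; exact: xy. Qed.

Lemma pastW (U : Type) k l (u : (nat -> T) -> U) :
  (k <= l)%N -> past k u -> past l u.
Proof. by move=> kl pu x y xy; apply: pu => i ik; apply: xy; exact: leq_trans kl. Qed.

End sequence_operations.

Section measurable_sequence_operations.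
Context d (T : measurableType d).

Lemma measurable_scons :
  measurable_fun setT (fun p : T * seqspace nat T => scons p.1 p.2 : seqspace nat T).
Proof.
apply: measurable_fun_seqspace => -[|i] /=; first exact: measurable_fst.
exact: (measurable_coord_comp (f := snd) i measurable_snd).
Qed.

Lemma measurable_sconsr t :
  measurable_fun setT (fun x : seqspace nat T => scons t x : seqspace nat T).
Proof.
exact: (measurable_fun_pair2 (f := fun p : T * seqspace nat T => (scons p.1 p.2 : seqspace nat T)) t measurable_scons).
Qed.

Lemma measurable_sshift k :
  measurable_fun setT (fun x : seqspace nat T => sshift k x : seqspace nat T).
Proof. by apply: measurable_fun_seqspace => i; exact: measurable_coord. Qed.

End measurable_sequence_operations.

(** * Measurability with respect to integer-valued functions *)

Definition nat_measurable d (X : measurableType d) (N : X -> nat) :=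
  forall n, measurable [set x | N x = n].

Section integer_valued.
Context d (X : measurableType d).

Lemma measurable_nat_index d' (Y : measurableType d') (N : X -> nat)
    (f : nat -> X -> Y) : nat_measurable N ->
  (forall n, measurable_fun setT (f n)) -> measurable_fun setT (fun x => f (N x) x).
Proof.
move=> mN mf _ A mA; rewrite setTI.
rewrite (_ : _ @^-1` A = \bigcup_n ([set x | N x = n] `&` f n @^-1` A)).
  apply: bigcup_measurable => n _; apply: measurableI; first exact: mN.
  by rewrite -[X in measurable X]setTI; exact: mf.
apply/seteqP; split => [x Ax|x [n _ [/= <-]]//].
by exists (N x).
Qed.

Lemma nat_measurable_fun (N : X -> nat) (M : nat -> X -> nat) : nat_measurable N ->
  (forall n, nat_measurable (M n)) -> nat_measurable (fun x => M (N x) x).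
Proof.
move=> mN mM k; rewrite (_ : mkset _ = \bigcup_n ([set x | N x = n] `&` [set x | M n x = k])).
  by apply: bigcup_measurable => n _; apply: measurableI; [exact: mN|exact: mM].
apply/seteqP; split => [x Ax|x [n _ [/= <-]]//].
by exists (N x).
Qed.

Lemma nat_measurable_comp d' (Y : measurableType d') (f : Y -> X) (N : X -> nat) :
  measurable_fun setT f -> nat_measurable N -> nat_measurable (N \o f).
Proof.
by move=> mf mN n; rewrite -[X in measurable X]setTI; exact: (mf _ _ (mN n)).
Qed.

Lemma measurable_fun_natr (R : realType) (N : X -> nat) : nat_measurable N ->
  measurable_fun setT (fun x => (N x)%:R : R).
Proof.
move=> mN; exact: (measurable_nat_index (f := fun n (_ : X) => n%:R : R)).
Qed.

Let xget_measurable (P : nat -> X -> Prop) :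
  (forall x m n, P m x -> P n x -> m = n) ->
  (forall n, measurable [set x | P n x]) ->
  nat_measurable (fun x => xget 0%N [set n | P n x]).
Proof.
move=> uP mP n.
have xgetE x : (xget 0%N [set n | P n x] = n) <->
    (P n x \/ (n = 0%N /\ forall k, ~ P k x)).
  case: xgetP => [m _ /= Pm|nP].
    split=> [<-|[Pn|[_ /(_ m)]//]]; first by left.
    exact: uP Pm Pn.
  split=> [<-|[Pn|[-> _]//]]; first by right; split => // k; exact: nP.
  by case: (nP n).
rewrite (_ : mkset _ = [set x | P n x] `|`
    (if n == 0%N then ~` \bigcup_k [set x | P k x] else set0)).
  apply: measurableU; first exact: mP.
  by case: ifP => // _; apply: measurableC; exact: bigcup_measurable.
apply/seteqP; split => x /=.
  move=> /xgetE[Pn|[n0 nP]]; [by left|right].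
  by rewrite n0 eqxx => -[k _]; exact: nP.
move=> h; apply/xgetE; case: h => [|]; first by left.
case: eqP => // n0 nP; right; split => // k Pk.
by apply: nP; exists k.
Qed.

Lemma nat_inf_measurable (E : nat -> X -> Prop) :
  (forall n, measurable [set x | E n x]) ->
  nat_measurable (fun x => nat_inf [set n | E n x]).
Proof.
move=> mE; apply: xget_measurable => [x m n [Em lem] [En len]|n].
  by apply/eqP; rewrite eqn_leq lem//= len.
rewrite (_ : mkset _ = [set x | E n x] `&`
    \bigcap_j ~` (if (n <= j)%N then set0 else [set x | E j x])).
  apply: measurableI; first exact: mE.
  apply: bigcap_measurable => // j _; apply: measurableC; case: ifP => // _.
apply/seteqP; split => x /= [En h]; split => //.
  by move=> j _; case: ifPn => nj //= Ej; move: (h j Ej); rewrite (negbTE nj).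
by move=> j Ej; have := h j Logic.I; case: ifPn => //= _ /(_ Ej).
Qed.

Lemma nat_sup_measurable (E : nat -> X -> Prop) :
  (forall n, measurable [set x | E n x]) ->
  nat_measurable (fun x => nat_sup [set n | E n x]).
Proof.
move=> mE; apply: xget_measurable => [x m n [Em lem] [En len]|n].
  by apply/eqP; rewrite eqn_leq lem//= len.
rewrite (_ : mkset _ = [set x | E n x] `&`
    \bigcap_j ~` (if (j <= n)%N then set0 else [set x | E j x])).
  apply: measurableI; first exact: mE.
  apply: bigcap_measurable => // j _; apply: measurableC; case: ifP => // _.
apply/seteqP; split => x /= [En h]; split => //.
  by move=> j _; case: ifPn => nj //= Ej; move: (h j Ej); rewrite (negbTE nj).
by move=> j Ej; have := h j Logic.I; case: ifPn => //= _ /(_ Ej).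
Qed.

Lemma measurable_ler (R : realType) (f g : X -> R) :
  measurable_fun setT f -> measurable_fun setT g ->
  measurable [set x | f x <= g x].
Proof.
move=> mf mg; rewrite (_ : mkset _ = (fun x => f x <= g x) @^-1` [set true]).
  by rewrite -[X in measurable X]setTI; exact: (measurable_fun_ler mf mg).
by apply/seteqP; split.
Qed.

Lemma measurable_ltr (R : realType) (f g : X -> R) :
  measurable_fun setT f -> measurable_fun setT g ->
  measurable [set x | f x < g x].
Proof.
move=> mf mg; rewrite (_ : mkset _ = (fun x => f x < g x) @^-1` [set true]).
  by rewrite -[X in measurable X]setTI; exact: (measurable_fun_ltr mf mg).
by apply/seteqP; split.
Qed.

End integer_valued.

Lemma nat_infP (E : set nat) k : E k ->
  E (nat_inf E) /\ forall j, E j -> (nat_inf E <= j)%N.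
Proof.
move=> Ek; rewrite /nat_inf; case: xgetP => // /(_ (ex_minn (ex_intro (fun j => `[<E j>]) k (asboolT Ek)))).
case: ex_minnP => m /asboolP Em h []; split => // j /asboolP; exact: h.
Qed.

Lemma nat_infE (E : set nat) k : E k -> (forall j, E j -> (k <= j)%N) -> nat_inf E = k.
Proof.
move=> Ek h; have [Ei hi] := nat_infP Ek.
by apply/eqP; rewrite eqn_leq hi// h.
Qed.

Lemma nat_supE (E : set nat) k : E k -> (forall j, E j -> (j <= k)%N) -> nat_sup E = k.
Proof.
move=> Ek h; rewrite /nat_sup; case: xgetP => [m -> [Em hm]|/(_ k)[]//].
by apply/eqP; rewrite eqn_leq hm// h.
Qed.

(** * Image laws and laws on sequence spaces *)

Section image_law.
Local Open Scope ereal_scope.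
Context d d' (X : measurableType d) (Y : measurableType d') (R : realType).

Definition mfun_of (f : X -> Y) (mf : measurable_fun setT f) : {mfun X >-> Y} :=
  HB.pack f (isMeasurableFun.Build _ _ _ _ f mf).

Definition image_law (P : probability X R) (f : X -> Y)
  (mf : measurable_fun setT f) : probability Y R := distribution P (mfun_of mf).

Lemma integral_image_law (P : probability X R) (f : X -> Y)
    (mf : measurable_fun setT f) (g : Y -> \bar R) :
  measurable_fun setT g -> (forall y, 0 <= g y) ->
  \int[image_law P mf]_y g y = \int[P]_x g (f x).
Proof. by move=> mg g0; exact: ge0_integral_distribution. Qed.

End image_law.

Lemma measurable_preimage d d' (X : measurableType d) (Y : measurableType d')
    (f : X -> Y) (A : set Y) :
  measurable_fun setT f -> measurable A -> measurable (f @^-1` A).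
Proof. by move=> mf mA; rewrite -[X in measurable X]setTI; exact: mf. Qed.

Lemma integral_prob_cst d (X : measurableType d) (R : realType)
    (P : probability X R) (c : \bar R) : (\int[P]_x cst c x = c)%E.
Proof. by rewrite integral_cst// [X in (_ * X)%E]probability_setT mule1. Qed.

Section seq_boxes.
Local Open Scope ereal_scope.
Context d (T : measurableType d) (R : realType).
Implicit Types (G : set (set T)) (A : nat -> set T).

Definition seq_box n A : set (seqspace nat T) := [set x | forall i, (i < n)%N -> A i (x i)].

Definition seq_boxes G : set (set (seqspace nat T)) :=
  [set B | exists n A, (forall i, G (A i)) /\ B = seq_box n A].

Lemma measurable_seq_box n A : (forall i, measurable (A i)) -> measurable (seq_box n A).
Proof.
move=> mA; rewrite (_ : seq_box n A = \bigcap_(i in [set i | (i < n)%N])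
    ((fun x : seqspace nat T => x i) @^-1` A i)).
  by apply: bigcap_measurableType => i _; apply: measurable_preimage => //; exact: measurable_coord.
by apply/seteqP; split => [x xA i /= /xA|x xA i /xA].
Qed.

Lemma measurable_seq_boxes G : @measurable _ T = <<s G >> -> G setT ->
  @measurable _ (seqspace nat T) = <<s seq_boxes G >>.
Proof.
move=> mG GT; apply/seteqP; split.
  apply: smallest_sub; first exact: smallest_sigma_algebra.
  move=> _ [i [A [mA ->]]].
  pose U := g_sigma_algebraType (seq_boxes G).
  suff mi : measurable_fun setT (fun x : U => x i).
    by have := mi measurableT A mA; rewrite setTI.
  apply: (@measurability _ _ U T setT _ G) => // _ [B GB <-].
  rewrite setTI; apply: sub_sigma_algebra.
  exists i.+1, (fun j => if j == i then B else setT); split.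
    by move=> j; case: ifP.
  apply/seteqP; split => [x Bx j _|x /(_ i (ltnSn i))]; last by rewrite eqxx.
  by case: eqP => // ->.
apply: smallest_sub; first exact: sigma_algebra_measurable.
move=> _ [n [A [GA ->]]]; apply: measurable_seq_box => i.
by rewrite mG; exact: sub_sigma_algebra.
Qed.

Lemma seq_boxes_setI G : setI_closed G -> G setT -> setI_closed (seq_boxes G).
Proof.
move=> GI GT _ _ [m [A [GA ->]]] [n [B [GB ->]]].
exists (maxn m n), (fun i => (if (i < m)%N then A i else setT) `&`
                            (if (i < n)%N then B i else setT)); split.
  by move=> i; apply: GI; case: ifP.
apply/seteqP; split => [x [Ax Bx] i _|x AB].
  by split; case: ifP => // h; [exact: Ax|exact: Bx].
split=> i ih; have := AB i; rewrite leq_max ih ?orbT => /(_ isT)[] //.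
Qed.

Lemma seq_law_unique G (m1 m2 : probability (seqspace nat T) R) :
  @measurable _ T = <<s G >> -> setI_closed G -> G setT ->
  (forall n A, (forall i, G (A i)) -> m1 (seq_box n A) = m2 (seq_box n A)) ->
  forall B, measurable B -> m1 B = m2 B.
Proof.
move=> mG GI GT m12 B mB.
apply: (measure_unique (seq_boxes G) (fun=> setT)) => //.
- exact: measurable_seq_boxes.
- exact: seq_boxes_setI.
- move=> _; exists 0%N, (fun=> setT); split => //.
  by apply/seteqP; split.
- by apply/seteqP; split => // x _; exists 0%N.
- by move=> _ [n [A [GA ->]]]; exact: m12.
- by move=> _; rewrite (le_lt_trans (probability_le1 _ measurableT))// ltry.
Qed.

End seq_boxes.

Section iid_law.
Local Open Scope ereal_scope.
Context d (T : measurableType d) (R : realType).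
Implicit Types (w : probability T R) (mu : probability (seqspace nat T) R).

(** Law of an i.i.d. sequence, characterized by its self-similarity: adding in
    front an independent term with law [w] does not change the law. This
    recursive form is what the inductions below use. *)
Definition iid_law w mu := forall f : seqspace nat T -> \bar R,
  measurable_fun setT f -> (forall x, 0 <= f x) ->
  \int[mu]_x f x = \int[w]_t \int[mu]_x f (scons t x).

Lemma iid_law_boxes (G : set (set T)) w mu :
  @measurable _ T = <<s G >> -> setI_closed G -> G setT ->
  (forall n A, (forall i, G (A i)) ->
     mu (seq_box n A) = \prod_(i < n) w (A i)) ->
  iid_law w mu.
Proof.
move=> mG GI GT muE f mf f0.
have mGA A : G A -> measurable A by move=> GA; rewrite mG; exact: sub_sigma_algebra.
pose nu := image_law (w \x mu : probability _ _)%E (@measurable_scons _ T).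
have munu B : measurable B -> mu B = nu B.
  apply: (seq_law_unique mG GI GT) => n A GA.
  have mb m A' : (forall i, G (A' i)) -> measurable (seq_box m A').
    by move=> GA'; apply: measurable_seq_box => i; exact: mGA.
  case: n => [|n].
    by rewrite (_ : seq_box 0 A = setT) ?probability_setT//; apply/seteqP; split.
  rewrite muE// big_ord_recl /nu /image_law /distribution /pushforward/=.
  rewrite (_ : _ @^-1` _ = A 0%N `*` seq_box n (fun i => A i.+1)); last first.
    apply/seteqP; split => [[t x] /= tx|[t x] /= [At Ax] [|i]//= ni].
      split; first exact: (tx 0%N).
      by move=> i ni; exact: (tx i.+1).
    exact: Ax.
  rewrite product_measure1E; [|exact: mGA|exact: mb].
  by congr (_ * _); apply/esym; exact: (muE n (fun i => A i.+1)).
rewrite (eq_measure_integral nu); last by move=> A mA _; exact: munu.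
rewrite integral_image_law//.
rewrite (fubini_tonelli1 (fun p : T * seqspace nat T => f (scons p.1 p.2)))//.
exact: (measurableT_comp mf (@measurable_scons _ T)).
Qed.

Context (w : probability T R) (mu : probability (seqspace nat T) R).
Hypothesis iidmu : iid_law w mu.

Lemma measurable_integral_scons (f : seqspace nat T -> \bar R) :
  measurable_fun setT f -> (forall x, 0 <= f x) ->
  measurable_fun setT (fun t => \int[mu]_x f (scons t x)).
Proof.
move=> mf f0.
apply: (measurable_fun_fubini_tonelli_F (m2 := mu) (fun p : T * seqspace nat T => f (scons p.1 p.2))) => //.
exact: (measurableT_comp mf (@measurable_scons _ T)).
Qed.

(** What comes after time [k] is independent of the first [k] terms, and is
    distributed like the whole sequence. *)
Lemma iid_fresh k (u f : seqspace nat T -> \bar R) :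
  measurable_fun setT u -> (forall x, 0 <= u x) -> past k u ->
  measurable_fun setT f -> (forall x, 0 <= f x) ->
  \int[mu]_x (u x * f (sshift k x)) = (\int[mu]_x u x) * \int[mu]_x f x.
Proof.
move=> + + + mf f0; elim: k u => [|k IH] u mu_ u0 pu.
  have uE x y : u x = u y by exact: pu.
  rewrite (eq_integral (fun x => u point * f x)); last by move=> x _; rewrite (uE x point).
  rewrite ge0_integralZl//; congr (_ * _); symmetry.
  rewrite (eq_integral (cst (u point))); last by move=> x _; exact: uE.
  by rewrite integral_prob_cst.
have mk : measurable_fun setT (fun x : seqspace nat T => f (sshift k.+1 x)).
  exact: (measurableT_comp mf (measurable_sshift k.+1)).
rewrite iidmu; [|exact: emeasurable_funM|by move=> x; exact: mule_ge0].
rewrite [X in _ = X * _]iidmu//.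
under eq_integral => t _.
  rewrite (IH (fun x : seqspace nat T => u (scons t x)))//.
  - over.
  - exact: (measurableT_comp mu_ (measurable_sconsr t)).
  - exact: past_scons.
rewrite ge0_integralZr//.
- exact: measurable_integral_scons.
- by move=> t _; exact: integral_ge0.
- exact: integral_ge0.
Qed.

Lemma iid_shift k (f : seqspace nat T -> \bar R) :
  measurable_fun setT f -> (forall x, 0 <= f x) ->
  \int[mu]_x f (sshift k x) = \int[mu]_x f x.
Proof.
move=> mf f0; have := @iid_fresh k (cst 1) f _ _ _ mf f0.
rewrite integral_prob_cst mul1e => <- //.
by apply: eq_integral => x _; rewrite mul1e.
Qed.

Lemma iid_marginal k (f : T -> \bar R) :
  measurable_fun setT f -> (forall x, 0 <= f x) ->
  \int[mu]_x f (x k) = \int[w]_t f t.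
Proof.
move=> mf f0.
transitivity (\int[mu]_x f (sshift k x 0%N)).
  by apply: eq_integral => x _; rewrite /sshift addn0.
have m0 := measurableT_comp mf (measurable_coord 0%N).
rewrite (iid_shift k (f := fun x : seqspace nat T => f (x 0%N)))// iidmu//=.
by apply: eq_integral => t _; rewrite integral_prob_cst.
Qed.

Lemma iid_marginal_set k (A : set T) : measurable A -> mu [set x | A (x k)] = w A.
Proof.
move=> mA; have mc := measurable_preimage (measurable_coord (I:=nat) k) mA.
have m1 : measurable_fun setT (fun t => (\1_A t)%:E : \bar R).
  by apply/measurable_EFinP; exact: measurable_indic.
transitivity (\int[w]_t (\1_A t)%:E); last by rewrite integral_indic// setIT.
rewrite -(iid_marginal k m1); last by move=> t; rewrite lee_fin.
transitivity (\int[mu]_x (\1_[set x : seqspace nat T | A (x k)] x)%:E) => //.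
by rewrite integral_indic// setIT.
Qed.

End iid_law.

(** * Almost sure properties of i.i.d. sequences *)

Section iid_almost_surely.
Local Open Scope ereal_scope.
Context d (T : measurableType d) (R : realType).
Context (w : probability T R) (mu : probability (seqspace nat T) R).
Hypothesis iidmu : iid_law w mu.

Lemma iid_ae_all (A : set T) : {ae w, forall t, A t} ->
  {ae mu, forall x : seqspace nat T, forall k, A (x k)}.
Proof.
move=> [N [mN N0 AN]]; apply/ae_foralln => k.
exists [set x | N (x k)]; split.
- exact: (measurable_preimage (measurable_coord (I := nat) k) mN).
- exact: etrans (iid_marginal_set iidmu k mN) N0.
- by move=> x /= nA; exact: AN.
Qed.

Lemma iid_ae_hit (A : set T) : measurable A -> 0 < w A ->
  {ae mu, forall x : seqspace nat T, exists k, A (x k)}.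
Proof.
move=> mA A0; pose N := [set x : seqspace nat T | forall k, ~ A (x k)].
have mN : measurable N.
  rewrite (_ : N = \bigcap_k ~` [set x | A (x k)]); last first.
    by apply/seteqP; split => [x Nx k _|x Nx k]; exact: Nx.
  apply: bigcap_measurable => [|k _]; first by exists 0%N.
  apply: measurableC.
  exact: (measurable_preimage (measurable_coord (I := nat) k) mA).
exists N; split => //; last by move=> x /= /forallNP.
have m1 : measurable_fun setT (fun x => (\1_N x)%:E : \bar R).
  by apply/measurable_EFinP; exact: measurable_indic.
have qE : mu N = mu N * w (~` A).
  transitivity (\int[mu]_x (\1_N x)%:E); first by rewrite integral_indic// setIT.
  rewrite iidmu//.
  transitivity (\int[w]_t (mu N * (\1_(~` A) t)%:E)).
    apply: eq_integral => t _.
    rewrite (eq_integral (fun x : seqspace nat T => (\1_(~` A) t)%:E * (\1_N x)%:E)).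
      rewrite ge0_integralZl//.
      by rewrite integral_indic// setIT muleC.
    move=> x _; rewrite -EFinM; congr EFin; rewrite !indicE -natrM mulnb; congr (_%:R).
    congr nat_of_bool; apply/idP/idP.
      rewrite !inE => Nx; apply/andP; split; first by rewrite inE; exact: (Nx 0%N).
      by rewrite inE => k; exact: (Nx k.+1).
    by move=> /andP[]; rewrite !inE => nAt Nx [|k]//; exact: Nx.
  rewrite ge0_integralZl//; first by rewrite integral_indic ?setIT//; exact: measurableC.
  by apply/measurable_EFinP; apply: measurable_indic; exact: measurableC.
have mufin : mu N \is a fin_num by rewrite fin_num_measure.
have wfin : w A \is a fin_num by rewrite fin_num_measure.
move: qE A0; rewrite probability_setC//.
rewrite -(fineK mufin) -(fineK wfin) -EFinB -EFinM lte_fin => -[qE] A0.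
by congr EFin; nra.
Qed.

End iid_almost_surely.

(** * The renewal path *)

Section paths.
Context (R : realType).
Implicit Types (x y : R) (l : marks R) (xi eta : hpath R).

Definition with_gap x xi : hpath R := scons (x, (xi 0%N).2) (sshift 1 xi).

Definition with_mark l xi : hpath R := scons ((xi 0%N).1, l) (sshift 1 xi).

Lemma measurable_with_gap :
  measurable_fun setT (fun p : R * hpath R => with_gap p.1 p.2).
Proof.
apply: measurable_fun_seqspace => -[|i] /=.
  have m0 := measurable_coord_comp 0%N (@measurable_snd _ _ R (hpath R)).
  exact: measurable_fun_pair measurable_fst (measurableT_comp measurable_snd m0).
exact: (measurable_coord_comp (f := snd) _ measurable_snd).
Qed.

Lemma measurable_with_mark :
  measurable_fun setT (fun p : marks R * hpath R => with_mark p.1 p.2).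
Proof.
apply: measurable_fun_seqspace => -[|i] /=.
  have m0 := measurable_coord_comp 0%N (@measurable_snd _ _ (marks R) (hpath R)).
  exact: measurable_fun_pair (measurableT_comp measurable_fst m0) measurable_fst.
exact: (measurable_coord_comp (f := snd) _ measurable_snd).
Qed.

(** The path starting with gap [x] and marks [l], followed by [eta]. *)
Definition start x l eta : hpath R := scons (x, l) eta.

Lemma measurable_start :
  measurable_fun setT (fun p : R * marks R * hpath R => start p.1.1 p.1.2 p.2).
Proof.
apply: measurable_fun_seqspace => -[|i] /=.
  exact: (measurable_fun_pair (measurableT_comp measurable_fst measurable_fst)
    (measurableT_comp measurable_snd measurable_fst)).
exact: (measurable_coord_comp (f := snd) _ measurable_snd).
Qed.

Lemma measurable_start_path x l : measurable_fun setT (start x l).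
Proof.
exact: (@measurable_sconsr _ (R * marks R)%type (x, l)).
Qed.

(** [u] is determined by the first [k] terms and the next gap. *)
Definition past_gap (U : Type) (k : nat) (u : hpath R -> U) :=
  forall xi eta, agree k xi eta -> (xi k).1 = (eta k).1 -> u xi = u eta.

Lemma past_past_gap (U : Type) k (u : hpath R -> U) : past k u -> past_gap k u.
Proof. by move=> pu xi eta h _; exact: pu. Qed.

Lemma past_gap_scons (U : Type) k (u : hpath R -> U) t :
  past_gap k.+1 u -> past_gap k (fun eta => u (scons t eta)).
Proof. by move=> pu xi eta h e; apply: pu => // -[|i]//= ik; exact: h. Qed.

Lemma Xseq0 xi : Xseq xi 0 = 0.
Proof. by rewrite /Xseq big_ord0. Qed.

Lemma XseqS xi k : Xseq xi k.+1 = Xseq xi k + Dseq xi k.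
Proof. by rewrite /Xseq big_ord_recr. Qed.

Lemma Xseq_sshift xi k n : Xseq (sshift k xi) n = Xseq xi (k + n)%N - Xseq xi k.
Proof.
elim: n => [|n IH]; first by rewrite Xseq0 addn0 subrr.
by rewrite XseqS IH addnS XseqS /Dseq /sshift addrAC.
Qed.

Lemma past_Xseq k : past k (fun xi => Xseq xi k).
Proof. by move=> xi eta h; apply: eq_bigr => i _; rewrite /Dseq h. Qed.

Lemma past_gap_XseqS k : past_gap k (fun xi => Xseq xi k.+1).
Proof.
by move=> xi eta h e; rewrite !XseqS /Dseq e (past_Xseq h).
Qed.

Lemma measurable_Dseq k : measurable_fun setT (fun xi : hpath R => Dseq xi k).
Proof. by apply: measurableT_comp => //; exact: measurable_coord. Qed.

Lemma measurable_Lseq k : measurable_fun setT (fun xi : hpath R => Lseq xi k).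
Proof.
exact: (measurableT_comp (f := snd) measurable_snd (measurable_coord k)).
Qed.

Lemma measurable_mark k i : measurable_fun setT (fun xi : hpath R => Lseq xi k i).
Proof. exact: (measurable_coord_comp i (measurable_Lseq k)). Qed.

Lemma measurable_Xseq k : measurable_fun setT (fun xi : hpath R => Xseq xi k).
Proof. by apply: measurable_sum => i; exact: measurable_Dseq. Qed.

End paths.

Record path_model (R : realType) (F rho : probability R R)
    (Lam : probability (marks R) R) (mu : probability (hpath R) R) : Prop :=
  PathModel {
  path_iid : iid_law (F \x Lam : probability _ _)%E mu;
  marks_law : iid_law rho Lam;
  gap_ge0 : F [set y | y < 0] = 0%E;
  mark_ge0 : rho [set a | a < 0] = 0%E;
  gap_tail : forall x : R, (0 < F [set y | (x < y)%R])%E;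
  mark_tail : forall x : R, (0 < rho [set a | (x < a)%R])%E;
  gap_mean : (\int[F]_y y%:E < +oo)%E;
  mark_mean : (\int[rho]_a a%:E < +oo)%E
}.

Section path_model_theory.
Local Open Scope ereal_scope.
Context (R : realType) (F rho : probability R R)
  (Lam : probability (marks R) R) (mu : probability (hpath R) R).
Hypothesis model : path_model F rho Lam mu.
Implicit Types (f u : hpath R -> \bar R).

Let iidmu := path_iid model.

(** Mean of [f] over the paths whose first gap is [x]. *)
Definition mean_from f (x : R) : \bar R := \int[mu]_xi f (with_gap x xi).

Lemma mean_from_ge0 f x : (forall xi, 0 <= f xi) -> 0 <= mean_from f x.
Proof. by move=> f0; exact: integral_ge0. Qed.

Lemma measurable_mean_from f : measurable_fun setT f -> (forall xi, 0 <= f xi) ->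
  measurable_fun setT (mean_from f).
Proof.
move=> mf f0.
exact: (measurable_fun_fubini_tonelli_F (m2 := mu)
  (fun p : R * hpath R => f (with_gap p.1 p.2))
  (measurableT_comp mf (@measurable_with_gap R)) (fun p => f0 _)).
Qed.

Lemma measurable_integral_start f : measurable_fun setT f -> (forall xi, 0 <= f xi) ->
  measurable_fun setT (fun p : R * marks R => \int[mu]_eta f (start p.1 p.2 eta)).
Proof.
move=> mf f0.
exact: (measurable_fun_fubini_tonelli_F (m2 := mu)
  (fun p : (R * marks R) * hpath R => f (start p.1.1 p.1.2 p.2))
  (measurableT_comp mf (@measurable_start R)) (fun p => f0 _)).
Qed.

Lemma measurable_integral_start_marks f x :
  measurable_fun setT f -> (forall xi, 0 <= f xi) ->
  measurable_fun setT (fun l => \int[mu]_eta f (start x l eta)).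
Proof.
move=> mf f0.
exact: (measurable_fun_pair2
  (f := fun p : R * marks R => \int[mu]_eta f (start p.1 p.2 eta)) x
  (measurable_integral_start mf f0)).
Qed.

Lemma integral_path f : measurable_fun setT f -> (forall xi, 0 <= f xi) ->
  \int[mu]_xi f xi = \int[F]_x \int[Lam]_l \int[mu]_eta f (start x l eta).
Proof.
move=> mf f0; rewrite (iidmu mf f0).
transitivity (\int[F \x Lam]_p \int[mu]_eta f (start p.1 p.2 eta)).
  by apply: eq_integral => -[x l] _.
apply: (fubini_tonelli1 (fun p : R * marks R => \int[mu]_eta f (start p.1 p.2 eta))
  (measurable_integral_start mf f0)).
by move=> p; exact: integral_ge0.
Qed.

Lemma measurable_with_gap_path x : measurable_fun setT (@with_gap R x).
Proof.
exact: (measurable_fun_pair2 (f := fun p : R * hpath R => with_gap p.1 p.2) x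
  (@measurable_with_gap R)).
Qed.

Lemma measurable_with_mark_path l : measurable_fun setT (@with_mark R l).
Proof.
exact: (measurable_fun_pair2 (f := fun p : marks R * hpath R => with_mark p.1 p.2) l
  (@measurable_with_mark R)).
Qed.

Lemma mean_fromE f x : measurable_fun setT f -> (forall xi, 0 <= f xi) ->
  mean_from f x = \int[Lam]_l \int[mu]_eta f (start x l eta).
Proof.
move=> mf f0; rewrite /mean_from.
rewrite (integral_path (f := fun xi => f (with_gap x xi)))//; last first.
  exact: (measurableT_comp mf (measurable_with_gap_path x)).
exact: (integral_prob_cst F (\int[Lam]_l \int[mu]_eta f (start x l eta))).
Qed.

Lemma integral_mean_from f : measurable_fun setT f -> (forall xi, 0 <= f xi) ->
  \int[mu]_xi f xi = \int[F]_x mean_from f x.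
Proof.
move=> mf f0; rewrite (integral_path mf f0).
by apply: eq_integral => x _; rewrite (mean_fromE x mf f0).
Qed.

Lemma integral_with_mark f : measurable_fun setT f -> (forall xi, 0 <= f xi) ->
  \int[mu]_xi f xi = \int[Lam]_l \int[mu]_xi f (with_mark l xi).
Proof.
move=> mf f0; rewrite (integral_path mf f0).
rewrite (fubini_tonelli (fun p : R * marks R => \int[mu]_eta f (start p.1 p.2 eta))).
- apply: eq_integral => l _.
  rewrite (integral_path (measurableT_comp mf (measurable_with_mark_path l)) (fun xi => f0 _)).
  by apply: eq_integral => x _; exact/esym/(integral_prob_cst Lam (\int[mu]_eta f (start x l eta))).
- exact: measurable_integral_start.
- by move=> p; exact: integral_ge0.
Qed.

(** Given the first [k] terms and the gap number [k], the path from time [k] on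
    is distributed like a path with this first gap. *)
Lemma markov_gap k u f :
  measurable_fun setT u -> (forall xi, 0 <= u xi) -> past_gap k u ->
  measurable_fun setT f -> (forall xi, 0 <= f xi) ->
  \int[mu]_xi (u xi * f (sshift k xi)) =
  \int[mu]_xi (u xi * mean_from f (Dseq xi k)).
Proof.
move=> + + + mf f0; have mmf := measurable_mean_from mf f0.
have mf0 x : 0 <= mean_from f x by exact: mean_from_ge0.
elim: k u => [|k IH] u mu_ u0 pu.
  have mD := measurableT_comp mmf (@measurable_Dseq R 0%N).
  rewrite (integral_mean_from (emeasurable_funM mu_ mf) (fun xi => mule_ge0 (u0 xi) (f0 xi))).
  rewrite (integral_mean_from (emeasurable_funM mu_ mD) (fun xi => mule_ge0 (u0 xi) (mf0 _))).
  apply: eq_integral => x _; rewrite /mean_from.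
  have uE xi : u (with_gap x xi) = u (with_gap x point) by exact: pu.
  rewrite (eq_integral (fun xi => u (with_gap x point) * f (with_gap x xi))); last first.
    by move=> xi _; rewrite uE.
  rewrite ge0_integralZl//; last exact: (measurableT_comp mf (measurable_with_gap_path x)).
  rewrite [RHS](eq_integral (cst (u (with_gap x point) * mean_from f x))).
    by rewrite integral_prob_cst.
  by move=> xi _; rewrite uE.
have mk : measurable_fun setT (fun xi : hpath R => f (sshift k.+1 xi)).
  exact: (measurableT_comp mf (measurable_sshift k.+1)).
have mD := measurableT_comp mmf (@measurable_Dseq R k.+1).
rewrite (iidmu (emeasurable_funM mu_ mk) (fun xi => mule_ge0 (u0 xi) (f0 _))).
rewrite [RHS](iidmu (emeasurable_funM mu_ mD) (fun xi => mule_ge0 (u0 xi) (mf0 _))).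
apply: eq_integral => t _.
apply: (IH (fun xi : hpath R => u (scons t xi))) => //.
- exact: (measurableT_comp mu_ (measurable_sconsr t)).
- exact: past_gap_scons.
Qed.

End path_model_theory.

Section almost_everywhere_lemmas.
Local Open Scope ereal_scope.
Context d (X : measurableType d) (R : realType) (mu : {measure set X -> \bar R}).

Lemma ae_le_measure (A B : set X) : measurable A -> measurable B ->
  {ae mu, forall x, A x -> B x} -> mu A <= mu B.
Proof.
move=> mA mB [N [mN N0 AN]].
rewrite (@le_trans _ _ (mu (B `|` N)))//.
  apply: le_measure; rewrite ?inE//; first exact: measurableU.
  move=> x Ax; have [Bx|nBx] := pselect (B x); [by left|right].
  by apply: AN => /= /(_ Ax).
by rewrite (le_trans (measureU2 _ _ _))// [X in _ + X]N0 adde0.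
Qed.

Lemma ae_measure0 (A : set X) : measurable A -> {ae mu, forall x, ~ A x} -> mu A = 0.
Proof.
move=> mA nA; apply/eqP; rewrite -measure_le0 -(measure0 mu).
exact: ae_le_measure.
Qed.

Lemma measure0_aeN (A : set X) : measurable A -> mu A = 0 -> {ae mu, forall x, ~ A x}.
Proof. by move=> mA A0; exists A; split => // x /= /contrapT. Qed.

Lemma ae_forall2 (P Q : X -> Prop) : {ae mu, forall x, P x} ->
  (forall x, P x -> Q x) -> {ae mu, forall x, Q x}.
Proof. by move=> aP PQ; apply: filterS aP. Qed.

End almost_everywhere_lemmas.

Lemma prob_ae1 d (X : measurableType d) (R : realType) (P : probability X R) (A : set X) :
  measurable A -> {ae P, forall x, A x} -> P A = 1%E.
Proof.
move=> mA aA; have mC := measurableC mA.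
have : P (~` A) = 0%E.
  by apply: ae_measure0 => //; apply: filterS aA => x Ax; exact.
rewrite probability_setC// -[in P A](fineK (fin_num_measure P A mA)) => -[].
by rewrite -(fineK (fin_num_measure P A mA)) => /eqP; rewrite subr_eq0 => /eqP <-.
Qed.

Section good_paths.
Context (R : realType).
Implicit Types (z : R) (xi eta : hpath R).

(** The paths on which every infimum and supremum in the definition of the
    checkpoints is attained. *)
Definition good xi : Prop :=
  [/\ forall i, 0 <= Dseq xi i,
      forall i j, 0 <= Lseq xi i j,
      forall z, exists k, z <= Xseq xi k &
      forall i x, exists j, x < Lseq xi i j].

Lemma good_sshift k xi : good xi -> good (sshift k xi).
Proof.
move=> [D0 L0 Xoo Loo]; split => //.
- by move=> i; exact: D0.
- by move=> i j; exact: L0.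
- move=> z; have [n zn] := Xoo (z + Xseq xi k).
  exists n; rewrite Xseq_sshift lerBrDr (le_trans zn)//.
  rewrite addnC /Xseq -!(big_mkord xpredT (Dseq xi)) (big_cat_nat (leq0n n) (leq_addr k n))//=.
  by rewrite lerDl sumr_ge0.
- by move=> i x; exact: Loo.
Qed.

Lemma Xseq_nondecreasing xi m n : good xi -> (m <= n)%N -> Xseq xi m <= Xseq xi n.
Proof.
move=> [D0 _ _ _] mn; rewrite /Xseq -!(big_mkord xpredT (Dseq xi)).
by rewrite (big_cat_nat (leq0n m) mn)//= lerDl sumr_ge0.
Qed.

(** Interval containing the level [z], as a first passage time. On good paths,
    for [0 < z], it is the last [k] with [Xseq eta k < z]; unlike this last
    time, the first passage is decided by the gaps up to the passage, on all
    paths. *)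
Definition kappa z eta : nat := nat_inf [set k | z <= Xseq eta k.+1].

Definition crosses z eta (k : nat) : Prop :=
  z <= Xseq eta k.+1 /\ forall j, (j < k)%N -> Xseq eta j.+1 < z.

Lemma crosses_kappa z eta k : crosses z eta k -> kappa z eta = k.
Proof.
move=> [zk h]; apply: nat_infE => // j zj; rewrite leqNgt; apply/negP => /h.
by rewrite ltNge zj.
Qed.

Lemma kappa_crosses z eta k : z <= Xseq eta k.+1 -> crosses z eta (kappa z eta).
Proof.
move=> zk; have [zi h] := nat_infP (E := [set k | z <= Xseq eta k.+1]) zk.
split=> // j jk; rewrite ltNge; apply/negP => zj.
by have := h j zj; rewrite leqNgt jk.
Qed.

Lemma good_crosses z eta : good eta -> crosses z eta (kappa z eta).
Proof.
move=> geta; have [_ _ /(_ z)[k zk] _] := geta.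
by apply: (@kappa_crosses _ _ k); rewrite (le_trans zk)// Xseq_nondecreasing.
Qed.

Lemma crosses_lt z eta k : 0 < z -> crosses z eta k -> Xseq eta k < z.
Proof. by move=> z0; case: k => [|k] [_ h]; [rewrite Xseq0|exact: h]. Qed.

Lemma measurable_crosses z k : measurable [set eta : hpath R | crosses z eta k].
Proof.
rewrite (_ : mkset _ = [set eta | z <= Xseq eta k.+1] `&`
   \bigcap_(j in [set j | (j < k)%N]) [set eta | Xseq eta j.+1 < z]); last first.
  by apply/seteqP; split=> x [? h]; split => // j; exact: h.
apply: measurableI; first by apply: measurable_ler => //; exact: measurable_Xseq.
by apply: bigcap_measurableType => j _; apply: measurable_ltr => //; exact: measurable_Xseq.
Qed.

Lemma past_gap_crosses z k : past_gap k (fun eta => crosses z eta k).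
Proof.
move=> xi eta h e; rewrite /crosses (past_gap_XseqS h e).
have XE j : (j < k)%N -> Xseq xi j.+1 = Xseq eta j.+1.
  by move=> jk; apply: (pastW jk (@past_Xseq R j.+1)).
apply/propext; split => -[? H]; split => // j jk; first by rewrite -XE// H.
by rewrite XE// H.
Qed.

Lemma measurable_kappa : nat_measurable (fun p : R * hpath R => kappa p.1 p.2).
Proof.
apply: (nat_inf_measurable (E := fun k (p : R * hpath R) => p.1 <= Xseq p.2 k.+1)) => n.
apply: measurable_ler; first exact: measurable_fst.
exact: (measurableT_comp (measurable_Xseq n.+1) measurable_snd).
Qed.

Lemma measurable_kappa_path z : nat_measurable (kappa z).
Proof.
apply: (nat_measurable_comp (f := pair z) _ measurable_kappa).
exact: pair1_measurable.
Qed.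

(** [u] is determined by the path up to the interval containing [z]. *)
Definition stopped (U : Type) z (u : hpath R -> U) := forall k xi eta,
  crosses z xi k -> agree k xi eta -> (xi k).1 = (eta k).1 -> u xi = u eta.

End good_paths.

Section first_passage.
Local Open Scope ereal_scope.
Context (R : realType) (F rho : probability R R)
  (Lam : probability (marks R) R) (mu : probability (hpath R) R).
Hypothesis model : path_model F rho Lam mu.
Implicit Types (f u : hpath R -> \bar R) (z : R).

Let iidmu := path_iid model.

Lemma good_marks_ae :
  {ae Lam, forall l : marks R, (forall j, 0 <= l j)%R /\ forall x, exists j, (x < l j)%R}.
Proof.
have h1 : {ae Lam, forall l : marks R, forall j, (0 <= l j)%R}.
  apply: (iid_ae_all (marks_law model) (A := [set a | (0 <= a)%R])).
  exists [set a | (a < 0)%R]; split.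
  - exact: measurable_ltr.
  - exact: (mark_ge0 model).
  - by move=> a /= /negP; rewrite -ltNge.
have h2 : {ae Lam, forall l : marks R, forall n : nat, exists j, (n%:R < l j)%R}.
  apply/ae_foralln => n; apply: (iid_ae_hit (marks_law model) (A := [set a | (n%:R < a)%R])).
    exact: measurable_ltr.
  exact: (mark_tail model).
apply: filterS2 h1 h2 => l l0 loo; split => // x.
have [j xj] := loo (Num.truncn x).+1; exists j; apply: lt_trans xj.
exact: truncnS_gt.
Qed.

Lemma good_ae : {ae mu, forall xi, good xi}.
Proof.
have hD : {ae mu, forall xi : hpath R, forall i, (0 <= (xi i).1)%R}.
  apply: (iid_ae_all iidmu (A := [set p | (0 <= p.1)%R])).
  exists ([set y | (y < 0)%R] `*` setT); split.
  - by apply: measurableX => //; exact: measurable_ltr.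
  - rewrite [LHS]product_measure1E//; last exact: measurable_ltr.
    by rewrite [X in X * _](gap_ge0 model) mul0e.
  - by move=> -[a l] /= /negP; rewrite -ltNge.
have hL : {ae mu, forall xi : hpath R, forall i,
    (forall j, 0 <= (xi i).2 j)%R /\ forall x, exists j, (x < (xi i).2 j)%R}.
  apply: (iid_ae_all iidmu (A := [set p | (forall j, 0 <= p.2 j)%R /\
    forall x, exists j, (x < p.2 j)%R])).
  have [N [mN N0 hN]] := good_marks_ae.
  exists (setT `*` N); split.
  - exact: measurableX.
  - by rewrite [LHS]product_measure1E// [X in _ * X]N0 mule0.
  - by move=> -[a l] /= nl; split => //; exact: hN.
have hX : {ae mu, forall xi : hpath R, forall n : nat, exists k, (n%:R < (xi k).1)%R}.
  apply/ae_foralln => n.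
  have pE : [set p : R * marks R | (n%:R < p.1)%R] = [set y | (n%:R < y)%R] `*` setT.
    by apply/seteqP; split => -[y l] //= [].
  apply: (iid_ae_hit iidmu (A := [set p | (n%:R < p.1)%R])).
  - by apply: measurable_ltr => //; exact: measurable_fst.
  - rewrite pE [ltRHS]product_measure1E//; last exact: measurable_ltr.
    by rewrite [X in _ * X]probability_setT mule1; exact: (gap_tail model).
have gE (xi : hpath R) : (forall i, (0 <= (xi i).1)%R) -> (forall i,
    (forall j, 0 <= (xi i).2 j)%R /\ forall x, exists j, (x < (xi i).2 j)%R) ->
    (forall n : nat, exists k, (n%:R < (xi k).1)%R) -> good xi.
  move=> D0 L0 X0; split => //; [by move=> i; case: (L0 i)| |by move=> i; case: (L0 i)].
  move=> z; have [k zk] := X0 (Num.truncn z).+1; exists k.+1.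
  rewrite XseqS (le_trans (ltW (truncnS_gt _)))// (le_trans (ltW zk))//.
  rewrite lerDr /Xseq sumr_ge0// => i _; exact: D0.
apply: filterS3 hD hL hX => xi; exact: gE.
Qed.

Lemma integral_crossing z (h : hpath R -> \bar R) :
  measurable_fun setT h -> (forall xi, 0 <= h xi) ->
  \int[mu]_xi h xi = \sum_(k <oo) \int[mu]_(xi in [set xi | crosses z xi k]) h xi.
Proof.
move=> mh h0.
have mE k : measurable [set xi : hpath R | crosses z xi k] by exact: measurable_crosses.
rewrite -ge0_integral_bigcup//; last 2 first.
- exact: measurable_funTS.
- by move=> i j _ _ [xi [/= /crosses_kappa <- /crosses_kappa]].
have mU : measurable (\bigcup_k [set xi : hpath R | crosses z xi k]).
  exact: bigcup_measurable.
rewrite (ge0_negligible_integral (N := ~` \bigcup_k [set xi | crosses z xi k]))//.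
- by rewrite setDE setTI setCK.
- exact: measurableC.
- apply: ae_measure0; first exact: measurableC.
  apply: filterS good_ae => xi gxi; apply; exists (kappa z xi) => //.
  exact: good_crosses.
Qed.

(** The gap that contains the level [z] is the only thing to remember about
    the past at a first passage. *)
Lemma markov_kappa z u f :
  measurable_fun setT u -> (forall xi, 0 <= u xi) -> stopped z u ->
  measurable_fun setT f -> (forall xi, 0 <= f xi) ->
  \int[mu]_xi (u xi * f (sshift (kappa z xi) xi)) =
  \int[mu]_xi (u xi * mean_from mu f (Dseq xi (kappa z xi))).
Proof.
move=> mu_ u0 su mf f0; have mk := @measurable_kappa_path R z.
have mmf := measurable_mean_from mu mf f0.
have mf0 x : 0 <= mean_from mu f x by exact: mean_from_ge0.
have mE k : measurable [set xi : hpath R | crosses z xi k] by exact: measurable_crosses.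
have mfk := measurable_nat_index (f := fun k (xi : hpath R) => f (sshift k xi)) mk
  (fun n => measurableT_comp mf (measurable_sshift n)).
have mmfk := measurable_nat_index (f := fun k (xi : hpath R) => mean_from mu f (Dseq xi k)) mk
  (fun n => measurableT_comp mmf (measurable_Dseq n)).
rewrite [LHS](integral_crossing z (emeasurable_funM mu_ mfk)); last first.
  by move=> xi; exact: mule_ge0.
rewrite [RHS](integral_crossing z (emeasurable_funM mu_ mmfk)); last first.
  by move=> xi; exact: mule_ge0.
apply: eq_eseriesr => k _.
pose E := [set xi : hpath R | crosses z xi k].
pose v := fun xi => u xi * (\1_E xi)%:E.
have mv : measurable_fun setT v.
  apply: emeasurable_funM => //; apply/measurable_EFinP.
  by apply: measurable_indic; exact: mE.
have v0 xi : 0 <= v xi by rewrite mule_ge0// lee_fin.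
have pv : past_gap k v.
  move=> xi eta h e; rewrite /v !indicE.
  have -> : (xi \in E) = (eta \in E).
    by apply/idP/idP; rewrite !inE /E/= (@past_gap_crosses R z k xi eta h e).
  case: (boolP (eta \in E)); last by rewrite !mule0.
  rewrite inE /E/= -(@past_gap_crosses R z k xi eta h e) => Exi.
  by rewrite !mule1; exact: su Exi h e.
transitivity (\int[mu]_xi (v xi * f (sshift k xi))).
  rewrite [LHS]integral_mkcond; apply: eq_integral => xi _.
  rewrite epatch_indic -/E /v /= muleAC.
  case: (boolP (xi \in E)) => [xiE|nE]; last by rewrite indicE (negbTE nE) !mule0 ?mul0e.
  by rewrite (crosses_kappa (set_mem xiE)).
apply: (etrans (markov_gap model mv v0 pv mf f0)).
rewrite [RHS]integral_mkcond; apply: eq_integral => xi _.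
rewrite epatch_indic -/E /v /= muleAC.
case: (boolP (xi \in E)) => [xiE|nE]; last by rewrite indicE (negbTE nE) !mule0 ?mul0e.
by rewrite (crosses_kappa (set_mem xiE)).
Qed.

End first_passage.

(** * Renewal estimates and the Doeblin minorization *)

Lemma measurable_patch d (X : measurableType d) (R : realType) (A : set X)
    (f : X -> \bar R) :
  measurable A -> measurable_fun setT f -> measurable_fun setT (f \_ A).
Proof.
by move=> mA mf; apply: (measurable_restrictT f mA).1; exact: measurable_funTS.
Qed.

Lemma tail_integral_small d (X : measurableType d) (R : realType)
    (mu : {measure set X -> \bar R}) (f : X -> \bar R) (A : nat -> set X) (eps : R) :
  mu.-integrable setT f -> (forall n, measurable (A n)) ->
  (forall x, exists n0, forall n, (n0 <= n)%N -> ~ A n x) ->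
  0 < eps -> \forall n \near \oo, (\int[mu]_(x in A n) f x < eps%:E)%E.
Proof.
move=> intf mA Aout eps0.
have mf := measurable_int _ intf.
pose g n := f \_ (A n).
have mg n : measurable_fun setT (g n).
  exact: measurable_patch.
have gf : {ae mu, forall x, setT x -> g ^~ x @ \oo --> cst 0%E x}.
  apply: aeW => x _ /=; apply: cvg_near_cst.
  have [n0 hn0] := Aout x; exists n0 => // n /= /hn0 nA.
  by rewrite /g patchE memNset.
have gb : {ae mu, forall x n, setT x -> (`|g n x| <= (abse \o f) x)%E}.
  apply: aeW => x n _ /=; rewrite /g patchE; case: ifP => // _.
  by rewrite abse0.
have [_ _ h] := dominated_convergence measurableT mg (measurable_cst 0%E) gf
  (integrable_abse intf) gb.
have eps0' : (0%:E < eps%:E)%E by rewrite lte_fin.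
rewrite [X in _ --> X]integral0 in h.
have [N _ H] : \forall n \near \oo, (\int[mu]_x g n x < eps%:E)%E.
  exact: h (open_ereal_lt' eps0').
by exists N => // n /H /=; rewrite /g -integral_mkcond.
Qed.

Section renewal.
Local Open Scope ereal_scope.
Context (R : realType) (F rho : probability R R)
  (Lam : probability (marks R) R) (mu : probability (hpath R) R).
Hypothesis model : path_model F rho Lam mu.
Implicit Types (z : R) (phi : R -> \bar R).

Let iidmu := path_iid model.

Lemma integral_gap k phi : measurable_fun setT phi -> (forall y, 0 <= phi y) ->
  \int[mu]_xi phi (Dseq xi k) = \int[F]_y phi y.
Proof.
move=> mphi phi0.
have m1 : measurable_fun setT (fun p : R * marks R => phi p.1).
  exact: (measurableT_comp mphi measurable_fst).
rewrite (iid_marginal iidmu k (f := fun p => phi p.1))//.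
rewrite fubini_tonelli1//; apply: eq_integral => y _.
exact: (integral_prob_cst Lam (phi y)).
Qed.

(** A gap is independent of the gaps and marks before it. *)
Lemma integral_past_gap k (H : set (hpath R)) phi :
  measurable H -> past k (fun xi => H xi) ->
  measurable_fun setT phi -> (forall y, 0 <= phi y) ->
  \int[mu]_(xi in H) phi (Dseq xi k) = mu H * \int[F]_y phi y.
Proof.
move=> mH pH mphi phi0; rewrite -(integral_gap 0)//.
have mD := measurableT_comp mphi (@measurable_Dseq R 0%N).
have m1 : measurable_fun setT (fun xi => (\1_H xi)%:E : \bar R).
  by apply/measurable_EFinP; exact: measurable_indic.
have -> : mu H = \int[mu]_xi (\1_H xi)%:E by rewrite integral_indic// setIT.
have i0 (xi : hpath R) : 0 <= (\1_H xi)%:E :> \bar R by rewrite lee_fin.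
have p1 : past k (fun xi : hpath R => (\1_H xi)%:E : \bar R).
  move=> xi eta h; rewrite !indicE.
  have -> // : (xi \in H) = (eta \in H).
  by apply/idP/idP; rewrite !inE (pH _ _ h).
rewrite -(iid_fresh iidmu m1 i0 p1 mD (fun xi => phi0 _)).
rewrite integral_mkcond; apply: eq_integral => xi _.
by rewrite epatch_indic /= muleC /Dseq /sshift addn0.
Qed.

Lemma measurable_Xseq_itv k a b :
  measurable [set xi : hpath R | (a <= Xseq xi k < b)%R].
Proof.
rewrite (_ : mkset _ = [set xi | (a <= Xseq xi k)%R] `&` [set xi | (Xseq xi k < b)%R]).
  apply: measurableI.
  - by apply: measurable_ler => //; exact: measurable_Xseq.
  - by apply: measurable_ltr => //; exact: measurable_Xseq.
by apply/seteqP; split => xi /= => [/andP[]//|[-> ->]].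
Qed.

(** The mean number of points in an interval of length 1 is bounded: after a
    point of the interval, the next gap is longer than 1 with a fixed positive
    probability, and then no further point falls in the interval. *)
Lemma renewal_bound : exists2 C : R, (0 <= C)%R &
  forall a : R, \sum_(k <oo) mu [set xi | (a <= Xseq xi k < a + 1)%R] <= C%:E.
Proof.
pose J := [set y : R | (1 < y)%R].
have mJ : measurable J by exact: measurable_ltr.
have Jfin : F J \is a fin_num by rewrite fin_num_measure.
have J0 : 0 < F J := gap_tail model 1.
exists (fine (F J))^-1%R; first by rewrite invr_ge0 fine_ge0.
move=> a; pose I k := [set xi : hpath R | (a <= Xseq xi k < a + 1)%R].
pose E k := I k `&` [set xi | J (Dseq xi k)].
have mI k : measurable (I k) by exact: measurable_Xseq_itv.
have mE k : measurable (E k).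
  by apply: measurableI => //; exact: (measurable_preimage (measurable_Dseq k) mJ).
have EI k : mu (E k) = F J * mu (I k).
  have m1 : measurable_fun setT (fun y => (\1_J y)%:E : \bar R).
    by apply/measurable_EFinP; exact: measurable_indic.
  have pI : past k (fun xi => I k xi).
    by move=> xi eta h; rewrite /I/= (past_Xseq h).
  have FJ : \int[F]_y (\1_J y)%:E = F J by rewrite integral_indic// setIT.
  rewrite muleC -FJ -(integral_past_gap (mI k) pI m1); last first.
    by move=> y; rewrite lee_fin.
  rewrite /E setIC -(integral_indic mu (mI k)) //.
  exact: (measurable_preimage (measurable_Dseq k) mJ).
have SE : \sum_(k <oo) mu (E k) <= 1.
  pose G := [set xi : hpath R | forall i, (0 <= Dseq xi i)%R].
  have mG : measurable G.
    rewrite (_ : G = \bigcap_i [set xi | (0 <= Dseq xi i)%R]).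
      apply: bigcap_measurable => [|i _]; first by exists 0%N.
      by apply: measurable_ler => //; exact: measurable_Dseq.
    by apply/seteqP; split => [xi h i _|xi h i]; exact: h.
  have EG k : mu (E k) = mu (E k `&` G).
    apply/eqP; rewrite eq_le; apply/andP; split; last first.
      by apply: le_measure; rewrite ?inE//; exact: measurableI.
    apply: ae_le_measure => //; first exact: measurableI.
    apply: filterS (good_ae model) => xi gxi Exi; split => //.
    by case: gxi.
  rewrite (eq_eseriesr (fun k _ => EG k)) -measure_semi_bigcup//.
  - apply: probability_le1; apply: bigcup_measurable => k _.
    exact: measurableI.
  - by move=> k; exact: measurableI.
  - apply/trivIsetP => i j _ _; rewrite neq_lt => ij.
    wlog : i j ij / (i < j)%N.
      move=> H; case/orP: ij => [|] ij; first by apply: H; rewrite // ij.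
      by rewrite setIC; apply: H; rewrite // ij.
    move=> {}ij; apply/seteqP; split => // xi [[[/= /andP[aX _] DJ] G0] [[/= /andP[_ Xa] _] _]].
    have : (Xseq xi i.+1 <= Xseq xi j)%R.
      rewrite /Xseq -!(big_mkord xpredT (Dseq xi)) (big_cat_nat (leq0n i.+1) ij)//=.
      by rewrite lerDl sumr_ge0// => k _; exact: G0.
    rewrite XseqS => h; move: DJ; rewrite /J/= ltNge => /negP; apply.
    by move: aX Xa h; clear -model; lra.
  - by apply: bigcup_measurable => k _; exact: measurableI.
rewrite -[leRHS]mule1.
rewrite -lee_pdivrMl ?invr_gt0 ?fine_gt0 ?J0 ?ltey_eq ?Jfin// invrK.
rewrite -nneseriesZl// (le_trans _ SE)//; apply: lee_nneseries => // k _.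
  by move=> _; rewrite mule_ge0// lee_fin fine_ge0.
by rewrite EI fineK.
Qed.

(** Number of integers [j] with [n + j < y]. *)
Let count_below (n : nat) (y : R) : (1 <= n)%N ->
  \sum_(j <oo) (\1_[set y : R | (n%:R + j%:R < y)%R] y)%:E <=
  (Num.max y 0 * \1_[set y : R | (n%:R < y)%R] y)%:E.
Proof.
move=> n1; apply: lime_le.
  by apply: is_cvg_nneseries => j _ _; rewrite lee_fin.
apply: nearW => m.
rewrite sumEFin lee_fin.
suff [h1 h2] : (\sum_(0 <= j < m) \1_[set y : R | (n%:R + j%:R < y)%R] y <= m%:R :> R)%R /\
   (\sum_(0 <= j < m) \1_[set y : R | (n%:R + j%:R < y)%R] y <=
     (if (n%:R < y)%R then y - n%:R + 1 else 0) :> R)%R.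
  apply: (le_trans h2); rewrite indicE; case: ifPn => ny.
    rewrite mem_set//= mulr1 le_max; apply/orP; left.
    have : (1 <= n%:R :> R)%R by rewrite (ler_nat _ 1).
    lra.
  by rewrite memNset ?mulr0//=; exact/negP.
elim: m => [|m [IH1 IH2]].
  rewrite big_nil; split => //; case: ifP => // ?; lra.
rewrite big_nat_recr//= indicE; have [nmy|nmy] := ltP (n%:R + m%:R)%R y.
  rewrite mem_set//= -natr1; have ny : (n%:R < y)%R.
    by apply: le_lt_trans nmy; rewrite lerDl.
  by rewrite ny; split; lra.
rewrite memNset ?addr0//=; last by apply/negP; rewrite -leNgt.
by split => //; rewrite (le_trans IH1)// ler_nat.
Qed.

(** The gap around a level [z] is stochastically bounded, uniformly in [z], so
    that an interval of a fixed length before [z] contains a point with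
    probability at least 1/2. *)
Lemma point_before : exists2 n : nat, (1 <= n)%N & forall z, (0 < z)%R ->
  (2^-1)%:E <= mu [set xi | exists k, (z - n%:R <= Xseq xi k < z)%R].
Proof.
have [C C0 HC] := renewal_bound.
have mid : measurable_fun setT (fun y : R => y%:E : \bar R).
  exact/measurable_EFinP.
have intF : F.-integrable setT (fun y : R => (Num.max y 0)%:E).
  apply/integrableP; split.
    by apply/measurable_EFinP; apply: measurable_maxr.
  rewrite (ae_eq_integral (fun y : R => y%:E))//.
  - exact: gap_mean model.
  - apply: measurableT_comp => //; apply/measurable_EFinP; exact: measurable_maxr.
  - exists [set y : R | (y < 0)%R]; split; [exact: measurable_ltr|exact: gap_ge0 model|].
    move=> y /= h; rewrite ltNge; apply/negP => y0; apply: h => _.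
    by rewrite max_l//= ger0_norm.
pose A n := [set y : R | (n%:R < y)%R].
have mA n : measurable (A n) by exact: measurable_ltr.
have e0 : (0 < (2 * (C + 1))^-1)%R by rewrite invr_gt0; lra.
have Aout y : exists n0, forall n, (n0 <= n)%N -> ~ A n y.
  exists (Num.truncn y).+1 => n yn; apply/negP; rewrite /A/= -leNgt.
  by rewrite (le_trans (ltW (truncnS_gt y)))// ler_nat.
have [m _ Hm] := tail_integral_small intF mA Aout e0.
exists m.+1 => // z z0; set n := m.+1.
pose B := [set xi : hpath R | exists k, (z - n%:R <= Xseq xi k < z)%R].
have mB : measurable B.
  rewrite (_ : B = \bigcup_k [set xi | (z - n%:R <= Xseq xi k < z)%R]).
    by apply: bigcup_measurable => k _; exact: measurable_Xseq_itv.
  by apply/seteqP; split => [xi [k ?]|xi [k _ ?]]; exists k.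
pose I j k := [set xi : hpath R |
  (z - n%:R - j.+1%:R <= Xseq xi k < z - n%:R - j.+1%:R + 1)%R].
pose A' j := [set y : R | (n%:R + j%:R < y)%R].
have mA' j : measurable (A' j) by exact: measurable_ltr.
pose E j k := I j k `&` [set xi | A' j (Dseq xi k)].
have mI j k : measurable (I j k) by exact: measurable_Xseq_itv.
have mE j k : measurable (E j k).
  by apply: measurableI => //; exact: (measurable_preimage (measurable_Dseq k) (mA' j)).
have FA j : F (A' j) = \int[F]_y (\1_(A' j) y)%:E by rewrite integral_indic// setIT.
have EI j k : mu (E j k) = F (A' j) * mu (I j k).
  have m1 : measurable_fun setT (fun y => (\1_(A' j) y)%:E : \bar R).
    by apply/measurable_EFinP; exact: measurable_indic.
  have pI : past k (fun xi => I j k xi).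
    by move=> xi eta h; rewrite /I/= (past_Xseq h).
  rewrite muleC FA -(integral_past_gap (mI j k) pI m1); last first.
    by move=> y; rewrite lee_fin.
  rewrite /E setIC -(integral_indic mu (mI j k)) //.
  exact: (measurable_preimage (measurable_Dseq k) (mA' j)).
have mUE j : measurable (\bigcup_k E j k) by exact: bigcup_measurable.
have UE j : mu (\bigcup_k E j k) <= C%:E * F (A' j).
  apply: (@le_trans _ _ (\sum_(k <oo) mu (E j k))).
    exact: measure_sigma_subadditive.
  have Fin : F (A' j) \is a fin_num by rewrite fin_num_measure.
  rewrite (eq_eseriesr (fun k _ => EI j k)) -(fineK Fin) nneseriesZl//.
  rewrite muleC; apply: lee_wpmul2r; first by rewrite lee_fin fine_ge0.
  exact: HC.
have NB : mu (~` B) <= C%:E * \int[F]_(y in A n) (Num.max y 0)%:E.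
  apply: (@le_trans _ _ (\sum_(j <oo) mu (\bigcup_k E j k))).
    apply: (@le_trans _ _ (mu (\bigcup_j \bigcup_k E j k))).
      apply: ae_le_measure; [exact: measurableC|exact: bigcup_measurable|].
      apply: filterS (good_ae model) => xi gxi nB.
      have zk := good_crosses z gxi; set k := kappa z xi in zk.
      have Xz := crosses_lt z0 zk.
      have Xzn : (Xseq xi k < z - n%:R)%R.
        by rewrite ltNge; apply/negP => h; apply: nB; exists k; rewrite h.
      have tex : exists j, (z - n%:R - Xseq xi k <= j.+1%:R)%R.
        by exists (Num.truncn (z - n%:R - Xseq xi k)); exact/ltW/truncnS_gt.
      exists (ex_minn tex) => //; exists k => //.
      case: ex_minnP => j tj minj.
      have jt : (j%:R < z - n%:R - Xseq xi k)%R.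
        case: j tj minj => [|j] tj minj; first by rewrite subr_gt0.
        by rewrite ltNge; apply/negP => /minj; rewrite ltnn.
      have zD := zk.1; rewrite XseqS in zD.
      rewrite -natr1 in tj; split; rewrite /I /A' /=; last by move: zD tj jt; clear -model; lra.
      by apply/andP; move: tj jt; clear -model => tj jt; split; lra.
    by apply: measure_sigma_subadditive => //; exact: bigcup_measurable.
  apply: (@le_trans _ _ (\sum_(j <oo) (C%:E * F (A' j)))).
    exact: lee_nneseries.
  rewrite nneseriesZl//; apply: lee_wpmul2l; first by rewrite lee_fin.
  rewrite (eq_eseriesr (fun j _ => FA j)) -integral_nneseries//; last first.
    by move=> j; apply/measurable_EFinP; apply: measurable_indic; exact: mA'.
  rewrite [leRHS]integral_mkcond; apply: ge0_le_integral => //.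
  - by move=> y _; apply: nneseries_ge0 => j _ _; rewrite lee_fin.
  - apply: ge0_emeasurable_sum => [j y _ _|j _]; first by rewrite lee_fin.
    by apply/measurable_EFinP; apply: measurable_indic; exact: mA'.
  - apply: measurable_patch => //.
    by apply/measurable_EFinP; exact: measurable_maxr.
  - by move=> y _; rewrite epatch_indic /= -EFinM; exact: count_below.
have Nfin : mu (~` B) \is a fin_num by rewrite fin_num_measure//; exact: measurableC.
have : mu (~` B) <= (2^-1)%:E.
  apply: (le_trans NB); have := Hm n (leqnSn m).
  have : 0 <= \int[F]_(y in A n) (Num.max y 0)%:E.
    by apply: integral_ge0 => y _; rewrite lee_fin le_max lexx orbT.
  case: (\int[F]_(y in A n) _) => [r||]//; rewrite lee_fin lte_fin -EFinM lee_fin => r0 hr.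
  have : (r * (2 * (C + 1)) < 1)%R by rewrite -ltr_pdivlMr ?mul1r//; move: hr C0; clear -model; lra.
  by move: r0 C0; clear -model; nra.
have BE := probability_setC mu (measurableC mB); rewrite setCK in BE.
move=> NB2; rewrite [leRHS]BE; move: NB2.
by rewrite -(fineK Nfin) -EFinB !lee_fin; clear -model; lra.
Qed.

(** Doeblin's condition: whatever the level [z], the law of the gap around [z]
    dominates half of the law of a gap restricted to large values. *)
Lemma doeblin : exists2 n : nat, (1 <= n)%N & forall z phi, (0 < z)%R ->
  measurable_fun setT phi -> (forall y, 0 <= phi y <= 1) ->
  (2^-1)%:E * \int[F]_(y in [set y | (n%:R <= y)%R]) phi y <=
  \int[mu]_xi phi (Dseq xi (kappa z xi)).
Proof.
have [n n1 Hn] := point_before; exists n => // z phi z0 mphi phi01.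
have phi0 y : 0 <= phi y by case/andP: (phi01 y).
pose J := [set y : R | (n%:R <= y)%R].
have mJ : measurable J by apply: measurable_ler; [exact: measurable_cst|exact: measurable_id].
have mk := @measurable_kappa_path R z.
have mphik : measurable_fun setT (fun xi : hpath R => phi (Dseq xi (kappa z xi))).
  apply: (measurable_nat_index (f := fun k (xi : hpath R) => phi (Dseq xi k)) mk) => k.
  exact: (measurableT_comp mphi (measurable_Dseq k)).
rewrite (integral_crossing model z)//.
pose H k := [set xi : hpath R | (z - n%:R <= Xseq xi k < z)%R] `&`
  \bigcap_(j in [set j | (j < k)%N]) [set xi | (Xseq xi j.+1 < z)%R].
have mH k : measurable (H k).
  apply: measurableI; first exact: measurable_Xseq_itv.
  by apply: bigcap_measurableType => j _; apply: measurable_ltr => //; exact: measurable_Xseq.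
have pH k : past k (fun xi => H k xi).
  have sub (xi eta : hpath R) : agree k xi eta -> H k xi -> H k eta.
    move=> h [h1 h2]; split; first by rewrite /= -(past_Xseq h).
    move=> j jk; rewrite /= -(@pastW _ _ _ _ _ jk (@past_Xseq R j.+1) _ _ h).
    exact: h2.
  move=> xi eta h; apply/propext; split; first exact: sub.
  by apply: sub => i ik; rewrite h.
apply: (@le_trans _ _ (\sum_(k <oo) (mu (H k) * \int[F]_(y in J) phi y))).
  have I0 : 0 <= \int[F]_(y in J) phi y by exact: integral_ge0.
  have Ifin : \int[F]_(y in J) phi y \is a fin_num.
    rewrite ge0_fin_numE//; apply: (@le_lt_trans _ _ (\int[F]_(y in J) 1)).
      apply: ge0_le_integral => //; first exact: measurable_funTS.
      by move=> y _; case/andP: (phi01 y).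
    by rewrite integral_cst// mul1e (le_lt_trans (probability_le1 _ _))// ltry.
  apply: (@le_trans _ _ (mu (\bigcup_k H k) * \int[F]_(y in J) phi y)).
    apply: lee_wpmul2r => //; apply: (le_trans (Hn z z0)).
    apply: ae_le_measure; [|exact: bigcup_measurable|].
      rewrite (_ : mkset _ = \bigcup_k [set xi | (z - n%:R <= Xseq xi k < z)%R]).
        by apply: bigcup_measurable => k _; exact: measurable_Xseq_itv.
      by apply/seteqP; split => [xi [k ?]|xi [k _ ?]]; exists k.
    apply: filterS (good_ae model) => xi gxi [k zk]; exists k => //; split => //.
    move=> j jk /=; apply: le_lt_trans (andP zk).2.
    exact: Xseq_nondecreasing.
  rewrite -(fineK Ifin); under eq_eseriesr do rewrite muleC.
  rewrite nneseriesZl// muleC; apply: lee_wpmul2l; first by rewrite fineK.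
  by apply: measure_sigma_subadditive => //; exact: bigcup_measurable.
apply: lee_nneseries => [k _ _|k _].
  by apply: mule_ge0 => //; exact: integral_ge0.
have mphiJ : measurable_fun setT (phi \_ J) by exact: measurable_patch.
have phiJ0 y : 0 <= (phi \_ J) y by rewrite patchE; case: ifP.
rewrite [X in _ * X]integral_mkcond -(integral_past_gap (mH k) (pH k) mphiJ phiJ0).
rewrite integral_mkcond [leRHS]integral_mkcond.
apply: ge0_le_integral => //.
- by move=> xi _; rewrite patchE; case: ifP.
- apply: measurable_patch => //.
  exact: (measurableT_comp mphiJ (measurable_Dseq k)).
- by apply: measurable_patch => //; exact: measurable_crosses.
move=> xi _; rewrite patchE; case: ifPn => [/set_mem Hxi|_]; last first.
  by rewrite patchE; case: ifP.
rewrite patchE; case: ifPn => [/set_mem JD|_]; last by rewrite patchE; case: ifP.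
have cr : crosses z xi k.
  case: Hxi => /andP[zX Xz] h; split => //.
  by rewrite XseqS; move: JD zX; rewrite /J/=; clear -model; lra.
by rewrite patchE mem_set//= (crosses_kappa cr).
Qed.

End renewal.

(** * The chain of checkpoints *)

Section step.
Context (R : realType).
Implicit Types (x : R) (l : marks R) (xi eta : hpath R).

(** The residual life, at the first mark exceeding [x], of the marks [l]. *)
Definition residual x l : R := l (first_exceed x l).-1 - x.

(** The path seen from the next checkpoint. *)
Definition step xi : hpath R :=
  sshift (kappa (Zseq xi 0) (sshift 1 xi)) (sshift 1 xi).

Lemma Zseq_start x l eta : Zseq (start x l eta) 0 = residual x l.
Proof. by []. Qed.

Lemma step_start x l eta : step (start x l eta) = sshift (kappa (residual x l) eta) eta.
Proof. by []. Qed.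

Lemma first_exceedP x l : (exists j, x < l j) ->
  [/\ (0 < first_exceed x l)%N, x < l (first_exceed x l).-1 &
      forall j, (j < (first_exceed x l).-1)%N -> l j <= x].
Proof.
move=> [j xj].
have [[h1 h2] h3] := nat_infP (E := [set k : nat | (1 <= k)%N /\ l k.-1 > x]) (k := j.+1)
  (conj (ltn0Sn j) xj).
split => // i il; rewrite leNgt; apply/negP => xi.
have := h3 i.+1 (conj (ltn0Sn i) xi).
rewrite -/(first_exceed x l) leqNgt => /negP; apply.
by move: il; rewrite -ltnS prednK.
Qed.

Lemma residual_gt0 x l : (exists j, x < l j) -> 0 < residual x l.
Proof. by move=> /first_exceedP[_ h _]; rewrite subr_gt0. Qed.

Lemma measurable_first_exceed :
  nat_measurable (fun p : R * marks R => first_exceed p.1 p.2).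
Proof.
apply: (nat_inf_measurable
  (E := fun k (p : R * marks R) => (1 <= k)%N /\ p.1 < p.2 k.-1)) => n.
case: n => [|n]; first by rewrite (_ : mkset _ = set0)//; apply/seteqP; split => p [].
rewrite (_ : mkset _ = [set p : R * marks R | p.1 < p.2 n]); last first.
  by apply/seteqP; split => p //= [].
apply: measurable_ltr; first exact: measurable_fst.
exact: (measurable_coord_comp (f := snd) n measurable_snd).
Qed.

Lemma measurable_mark_index d (X : measurableType d) (N : X -> nat) (l : X -> marks R) :
  nat_measurable N -> measurable_fun setT l -> measurable_fun setT (fun t => l t (N t)).
Proof.
move=> mN ml; apply: (measurable_nat_index (f := fun n t => l t n) mN) => n.
exact: (measurable_coord_comp n ml).
Qed.

Lemma nat_measurable_pred d (X : measurableType d) (N : X -> nat) (g : nat -> nat) :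
  nat_measurable N -> nat_measurable (fun t => g (N t)).
Proof.
move=> mN; apply: (nat_measurable_fun (M := fun n _ => g n) mN) => n k.
case: (eqVneq (g n) k) => [->|nk].
  by rewrite (_ : mkset _ = setT)//; apply/seteqP; split.
by rewrite (_ : mkset _ = set0)//; apply/seteqP; split => // t /= gk; rewrite gk eqxx in nk.
Qed.

Lemma measurable_tau n : nat_measurable (fun xi : hpath R => tau xi n).
Proof.
apply: (nat_measurable_comp (f := fun xi : hpath R => (Dseq xi n, Lseq xi n)) _
  measurable_first_exceed).
apply: measurable_fun_pair; [exact: measurable_Dseq|exact: measurable_Lseq].
Qed.

Lemma measurable_Zseq n : measurable_fun setT (fun xi : hpath R => Zseq xi n).
Proof.
rewrite /Zseq; apply: measurable_funB; last exact: measurable_Dseq.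
exact: (measurable_mark_index (nat_measurable_pred predn (measurable_tau n)) (measurable_Lseq n)).
Qed.

Lemma measurable_sshift_index d (X : measurableType d) (N : X -> nat) (f : X -> hpath R) :
  nat_measurable N -> measurable_fun setT f ->
  measurable_fun setT (fun t => sshift (N t) (f t) : hpath R).
Proof.
move=> mN mf.
apply: (measurable_nat_index (f := fun n t => sshift n (f t) : hpath R) mN) => n.
exact: (measurableT_comp (measurable_sshift n) mf).
Qed.

Lemma measurable_step : measurable_fun setT step.
Proof.
apply: measurable_sshift_index; last exact: measurable_sshift.
apply: (nat_measurable_comp (f := fun xi : hpath R => (Zseq xi 0, sshift 1 xi : hpath R)) _
  (@measurable_kappa R)).
apply: measurable_fun_pair; [exact: measurable_Zseq|exact: measurable_sshift].
Qed.

Lemma good_step xi : good xi -> good (step xi).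
Proof. by move=> g; do 2 apply: good_sshift. Qed.

Lemma good_iter_step n xi : good xi -> good (iter n step xi).
Proof. by move=> g; elim: n => //= n IH; exact: good_step. Qed.

Lemma Zseq_sshift c xi : Zseq (sshift c xi) 0 = Zseq xi c.
Proof. by rewrite /Zseq /tau /Lseq /Dseq /sshift addn0. Qed.

Lemma next_checkpoint c xi : good xi ->
  nat_sup [set k : nat | (c.+1 <= k)%N /\ Zseq xi c > Xseq xi k - Xseq xi c.+1] =
  (c + (kappa (Zseq xi c) (sshift 1 (sshift c xi))).+1)%N.
Proof.
move=> g; rewrite -Zseq_sshift; have geta := good_sshift c g.
set eta := sshift c xi in geta *; have g1 := good_sshift 1 geta.
have z0 : 0 < Zseq eta 0.
  by apply: residual_gt0; case: geta => _ _ _; exact.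
have cr := good_crosses (Zseq eta 0) g1.
have Xk := crosses_lt z0 cr; case: cr => kz _.
set k := kappa _ _ in kz Xk *.
have XE i : Xseq xi (c + i.+1)%N - Xseq xi c.+1 = Xseq (sshift 1 eta) i.
  by rewrite sshiftD Xseq_sshift addn1 addSnnS.
apply: nat_supE => /= [|j [cj Zj]].
  by rewrite XE; split => //; rewrite addnS ltnS leq_addr.
rewrite leqNgt; apply/negP => kj.
have jE : j = (c + (j - c.+1).+1)%N by rewrite -addSnnS subnKC.
have : Xseq (sshift 1 eta) k.+1 <= Xseq (sshift 1 eta) (j - c.+1)%N.
  by apply: Xseq_nondecreasing => //; move: kj; rewrite {1}jE ltn_add2l ltnS.
by rewrite -[leRHS]XE -jE leNgt (lt_le_trans Zj kz).
Qed.

Lemma iter_step xi n : good xi -> iter n step xi = sshift (ckpt xi n) xi.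
Proof.
move=> g; elim: n => [|n IH] //.
have -> : ckpt xi n.+1 = _ := next_checkpoint (ckpt xi n) g.
rewrite iterS IH /step Zseq_sshift.
by rewrite !sshiftD addn1 addSnnS.
Qed.

Lemma ckpt1 xi : good xi -> ckpt xi 1 = (kappa (Zseq xi 0) (sshift 1 xi)).+1.
Proof. by move=> g; rewrite /= (next_checkpoint 0 g). Qed.

Lemma ckptS xi n : good xi ->
  ckpt xi n.+1 = (ckpt xi n + ckpt (iter n step xi) 1)%N.
Proof.
move=> g; rewrite ckpt1; last exact: good_iter_step.
rewrite iter_step// Zseq_sshift; exact: next_checkpoint.
Qed.

(** Closed forms, measurable with respect to the path up to the first
    checkpoint, of the first ideal time and of the first actual time. *)
Definition first_ideal xi : R :=
  Dseq xi 0 + Xseq (sshift 1 xi) (kappa (Zseq xi 0) (sshift 1 xi)).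

Definition first_actual xi : R := \sum_(i < tau xi 0) Lseq xi 0 i.

Lemma ideal_timeE xi n : good xi -> ideal_time xi n = first_ideal (iter n step xi).
Proof.
move=> g; rewrite /ideal_time (ckptS n g) ckpt1; last exact: good_iter_step.
rewrite iter_step// /first_ideal; set k := kappa _ _.
rewrite sshiftD Xseq_sshift addn1 addnS addSn [Xseq xi (ckpt xi n).+1]XseqS.
by rewrite /Dseq /sshift addn0; lra.
Qed.

Lemma actual_timeE xi n : good xi -> actual_time xi n = first_actual (iter n step xi).
Proof.
move=> g; rewrite /actual_time /first_actual iter_step// /tau /Dseq /Lseq /sshift.
by rewrite addn0.
Qed.

Lemma measurable_first_ideal : measurable_fun setT first_ideal.
Proof.
apply: measurable_funD; first exact: measurable_Dseq.
have mN : nat_measurable (fun xi : hpath R => kappa (Zseq xi 0) (sshift 1 xi)).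
  apply: (nat_measurable_comp (f := fun xi : hpath R => (Zseq xi 0, sshift 1 xi : hpath R)) _
    (@measurable_kappa R)).
  apply: measurable_fun_pair; [exact: measurable_Zseq|exact: measurable_sshift].
apply: (measurable_nat_index (f := fun n xi => Xseq (sshift 1 xi) n) mN) => n.
exact: (measurableT_comp (measurable_Xseq n) (measurable_sshift 1)).
Qed.

Lemma measurable_first_actual : measurable_fun setT first_actual.
Proof.
apply: (measurable_nat_index (f := fun n xi => \sum_(i < n) Lseq xi 0 i) (measurable_tau 0)) => n.
by apply: measurable_sum => i; exact: measurable_mark.
Qed.

Lemma first_ideal_ge0 xi : good xi -> 0 <= first_ideal xi.
Proof.
move=> g; have [D0 _ _ _] := good_sshift 1 g; have [D0' _ _ _] := g.
by rewrite addr_ge0// /Xseq sumr_ge0.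
Qed.

Lemma first_actual_ge0 xi : good xi -> 0 <= first_actual xi.
Proof. by move=> [_ L0 _ _]; rewrite sumr_ge0. Qed.

(** [u] is determined by the path up to the next checkpoint, included. *)
Definition adapted (U : Type) (u : hpath R -> U) :=
  forall x l, stopped (residual x l) (fun eta => u (start x l eta)).

Lemma adapted_first_ideal : adapted first_ideal.
Proof.
move=> x l k xi eta cr h e; rewrite /first_ideal /Dseq /=.
rewrite -[sshift 1 (start x l xi)]/xi -[sshift 1 (start x l eta)]/eta !Zseq_start.
rewrite (crosses_kappa cr) (@crosses_kappa _ _ eta k).
  by rewrite (past_Xseq h).
by rewrite -(@past_gap_crosses R _ _ _ _ h e).
Qed.

Lemma adapted_first_actual : adapted first_actual.
Proof. by []. Qed.

Lemma adapted_comp (U V : Type) (g : U -> V) (u : hpath R -> U) :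
  adapted u -> adapted (g \o u).
Proof. by move=> au x l k xi eta cr h e /=; rewrite (au x l k xi eta cr h e). Qed.

End step.

Arguments step {R} _.
Arguments first_ideal {R} _.
Arguments first_actual {R} _.

Section checkpoint_chain.
Local Open Scope ereal_scope.
Context (R : realType) (F rho : probability R R)
  (Lam : probability (marks R) R) (mu : probability (hpath R) R).
Hypothesis model : path_model F rho Lam mu.
Implicit Types (u f : hpath R -> \bar R) (phi : R -> \bar R) (C : set (hpath R)).

Local Notation mean := (mean_from mu).

(** Markov property of the gaps at the checkpoints. *)
Lemma markov_step u f x :
  measurable_fun setT u -> (forall xi, 0 <= u xi) -> adapted u ->
  measurable_fun setT f -> (forall xi, 0 <= f xi) ->
  mean (fun xi => u xi * f (step xi)) x =
  mean (fun xi => u xi * mean f (Dseq (step xi) 0)) x.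
Proof.
move=> mu_ u0 au mf f0; have ms := @measurable_step R.
have mmf := measurable_mean_from mu mf f0.
have mD := measurableT_comp (measurable_Dseq 0) ms.
have mf0 xi : 0 <= mean f (Dseq (step xi) 0) by exact: mean_from_ge0.
rewrite (mean_fromE model x (emeasurable_funM mu_ (measurableT_comp mf ms))
  (fun xi => mule_ge0 (u0 xi) (f0 _))).
rewrite (mean_fromE model x (emeasurable_funM mu_ (measurableT_comp mmf mD))
  (fun xi => mule_ge0 (u0 xi) (mf0 xi))).
apply: eq_integral => l _.
have mul : measurable_fun setT (fun eta => u (start x l eta)).
  exact: (measurableT_comp mu_ (measurable_start_path x l)).
apply: (etrans (markov_kappa model mul (fun eta => u0 _) (au x l) mf f0)).
apply: eq_integral => eta _; congr (_ * mean f _).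
by rewrite /= step_start /Dseq /sshift addn0.
Qed.

End checkpoint_chain.

(** * Uniform ergodicity *)

Section mixing.
Local Open Scope ereal_scope.
Context (R : realType) (F rho : probability R R)
  (Lam : probability (marks R) R) (mu : probability (hpath R) R).
Hypothesis model : path_model F rho Lam mu.
Implicit Types (u f : hpath R -> \bar R) (phi : R -> \bar R) (C : set (hpath R)).

Local Notation mean := (mean_from mu).

Definition prob_from C (x : R) : \bar R := mean (fun xi => (\1_C xi)%:E) x.

Lemma measurable_indicE d (X : measurableType d) (A : set X) : measurable A ->
  measurable_fun setT (fun t => (\1_A t)%:E : \bar R).
Proof. by move=> mA; apply/measurable_EFinP; exact: measurable_indic. Qed.

Lemma measurable_prob_from C : measurable C -> measurable_fun setT (prob_from C).
Proof.
by move=> mC; apply: measurable_mean_from => [|xi]; [exact: measurable_indicE|rewrite lee_fin].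
Qed.

Lemma prob_from01 C x : measurable C -> 0 <= prob_from C x <= 1.
Proof.
move=> mC; apply/andP; split; first by apply: mean_from_ge0 => xi; rewrite lee_fin.
rewrite -[leRHS](integral_prob_cst mu 1); apply: ge0_le_integral => //.
- exact: (measurableT_comp (measurable_indicE mC) (measurable_with_gap_path x)).
- by move=> xi _; rewrite lee_fin indicE; case: (_ \in _).
Qed.

Lemma prob_from_fin C x : measurable C -> prob_from C x \is a fin_num.
Proof.
move=> mC; case/andP: (prob_from01 x mC) => p0 p1.
by rewrite ge0_fin_numE// (le_lt_trans p1)// ltry.
Qed.

Lemma mean_step f x : measurable_fun setT f -> (forall xi, 0 <= f xi) ->
  mean (fun xi => f (step xi)) x = mean (fun xi => mean f (Dseq (step xi) 0)) x.
Proof.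
move=> mf f0.
have m1 : measurable_fun setT (cst 1 : hpath R -> \bar R) by exact: measurable_cst.
have o0 (xi : hpath R) : 0 <= (cst 1 : hpath R -> \bar R) xi by [].
have oa : adapted (cst 1 : hpath R -> \bar R) by [].
have h := markov_step model x m1 o0 oa mf f0.
have e g : mean g x = mean (fun xi => cst 1 xi * g xi) x.
  by apply: eq_integral => xi _; rewrite mul1e.
by rewrite e [RHS]e -h.
Qed.

Lemma prob_from_step C x : measurable C ->
  prob_from (step @^-1` C) x = mean (fun xi => prob_from C (Dseq (step xi) 0)) x.
Proof.
move=> mC; apply: (mean_step x (measurable_indicE mC)) => xi.
by rewrite lee_fin.
Qed.

Lemma measurable_gap_step phi : measurable_fun setT phi ->
  measurable_fun setT (fun xi : hpath R => phi (Dseq (step xi) 0)).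
Proof.
move=> mphi.
exact: (measurableT_comp mphi (measurableT_comp (measurable_Dseq 0) (@measurable_step R))).
Qed.

Lemma minorization : exists2 n : nat, (1 <= n)%N & forall x phi,
  measurable_fun setT phi -> (forall y, 0 <= phi y <= 1) ->
  (2^-1)%:E * \int[F]_(y in [set y | (n%:R <= y)%R]) phi y <=
  mean (fun xi => phi (Dseq (step xi) 0)) x.
Proof.
have [n n1 Hn] := doeblin model; exists n => // x phi mphi phi01.
have phi0 y : 0 <= phi y by case/andP: (phi01 y).
have mD := measurable_gap_step mphi.
rewrite (mean_fromE model)//.
set c := _ * _.
have c0 : 0 <= c by apply: mule_ge0; rewrite ?lee_fin//; exact: integral_ge0.
have mDx := measurable_integral_start_marks mu x mD (fun xi => phi0 _).
rewrite -[leLHS](integral_prob_cst Lam c).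
apply: (ae_ge0_le_integral measurableT (fun _ _ => c0) (measurable_cst c) _ mDx).
  by move=> l _; exact: integral_ge0.
apply: filterS (good_marks_ae model) => l [l0 loo] _ /=.
apply: (le_trans (Hn (residual x l) phi (residual_gt0 (loo x)) mphi phi01)).
apply: ge0_le_integral => //.
- apply: (measurable_nat_index (f := fun k (xi : hpath R) => phi (Dseq xi k))).
    exact: measurable_kappa_path.
  by move=> k; exact: (measurableT_comp mphi (measurable_Dseq k)).
- exact: (measurableT_comp mD (measurable_start_path x l)).
- by move=> eta _; rewrite step_start /Dseq /sshift addn0.
Qed.

Lemma mean_cst (c : R) x : mean (fun _ => c%:E) x = c%:E.
Proof. exact: (integral_prob_cst mu c%:E). Qed.

Lemma meanD u f x : measurable_fun setT u -> (forall xi, 0 <= u xi) ->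
  measurable_fun setT f -> (forall xi, 0 <= f xi) ->
  mean (fun xi => u xi + f xi) x = mean u x + mean f x.
Proof.
move=> mu_ u0 mf f0; rewrite /mean_from ge0_integralD//.
- exact: (measurableT_comp mu_ (measurable_with_gap_path x)).
- exact: (measurableT_comp mf (measurable_with_gap_path x)).
Qed.

Lemma le_mean u f x : measurable_fun setT u -> (forall xi, 0 <= u xi) ->
  measurable_fun setT f -> (forall xi, u xi <= f xi) ->
  mean u x <= mean f x.
Proof.
move=> mu_ u0 mf uf; apply: ge0_le_integral => //.
- exact: (measurableT_comp mu_ (measurable_with_gap_path x)).
- exact: (measurableT_comp mf (measurable_with_gap_path x)).
Qed.

(** By the minorization, two copies of the chain can be coupled at each step
    with a fixed positive probability; hence the oscillation of the
    probabilities with respect to the first gap decreases geometrically. *)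
Lemma contraction : exists2 q : R, (0 <= q < 1)%R & forall C (a w : R),
  measurable C -> (0 <= a)%R -> (0 <= w)%R -> (a + w <= 1)%R ->
  (forall x, a%:E <= prob_from C x <= (a + w)%:E) ->
  exists a' : R, [/\ (a <= a')%R, (a' + q * w <= a + w)%R &
    forall x, a'%:E <= prob_from (step @^-1` C) x <= (a' + q * w)%:E].
Proof.
have [n n1 Hn] := minorization.
pose J := [set y : R | (n%:R <= y)%R].
have mJ : measurable J by apply: measurable_ler; [exact: measurable_cst|exact: measurable_id].
pose p := fine (F J).
have Jfin : F J \is a fin_num by rewrite fin_num_measure.
have p1 : (p <= 1)%R by rewrite -lee_fin fineK// probability_le1.
have p0 : (0 < p)%R.
  rewrite -lte_fin fineK//; apply: (lt_le_trans (gap_tail model n%:R)).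
  by apply: le_measure; rewrite ?inE//; [exact: measurable_ltr|move=> y /= /ltW].
exists (1 - 2^-1 * p)%R; first by apply/andP; split; lra.
move=> C a w mC a0 w0 aw1 Hh.
pose h x := fine (prob_from C x).
have hE x : prob_from C x = (h x)%:E by rewrite fineK// prob_from_fin.
have mh : measurable_fun setT h.
  apply: (measurableT_comp (f := fine)); first exact: fine_measurable.
  exact: measurable_prob_from.
have ha x : (a <= h x)%R by have /andP[] := Hh x; rewrite hE lee_fin.
have hb x : (h x <= a + w)%R by have /andP[] := Hh x; rewrite hE !lee_fin.
pose phi1 y := (h y - a)%:E; pose phi2 y := (a + w - h y)%:E.
have mphi1 : measurable_fun setT phi1.
  by apply/measurable_EFinP; exact: measurable_funB.
have mphi2 : measurable_fun setT phi2.
  by apply/measurable_EFinP; exact: measurable_funB.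
have b1 y : 0 <= phi1 y <= 1.
  by rewrite !lee_fin; move: (ha y) (hb y) a0 aw1; clear -model => *; apply/andP; split; lra.
have b2 y : 0 <= phi2 y <= 1.
  by rewrite !lee_fin; move: (ha y) (hb y) a0 aw1; clear -model => *; apply/andP; split; lra.
have pos1 y : 0 <= phi1 y by case/andP: (b1 y).
have pos2 y : 0 <= phi2 y by case/andP: (b2 y).
pose I1 := \int[F]_(y in J) phi1 y; pose I2 := \int[F]_(y in J) phi2 y.
have I12 : I1 + I2 = (w * p)%:E.
  rewrite /I1 /I2 -ge0_integralD//; [|exact: measurable_funTS|exact: measurable_funTS].
  rewrite (eq_integral (cst w%:E)).
    by rewrite integral_cst// EFinM; congr (_ * _); exact/esym/fineK.
  by move=> y _; rewrite -EFinD; congr EFin; clear -model; lra.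
have I10 : 0 <= I1 by exact: integral_ge0.
have I20 : 0 <= I2 by exact: integral_ge0.
have [r1 I1E] : exists r, I1 = r%:E.
  by move: I12 I20 I10; case: (I1) => [r||]//; [exists r|case: (I2)].
have [r2 I2E] : exists r, I2 = r%:E.
  by move: I12; rewrite I1E; case: (I2) => [r||]//; exists r.
move: I12 I10 I20; rewrite I1E I2E -EFinD => -[r12]; rewrite !lee_fin => r10 r20.
exists (a + 2^-1 * r1)%R; split; [by move: r10; clear -model; lra|by move: r12 r20; clear -model; nra|move=> x].
rewrite prob_from_step//.
set E := mean _ x.
have mhs := measurable_gap_step (measurable_prob_from mC).
have m1s := measurable_gap_step mphi1; have m2s := measurable_gap_step mphi2.
have E1 : mean (fun xi => phi1 (Dseq (step xi) 0)) x + a%:E = E.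
  rewrite -(mean_cst a x) -meanD// /E; congr (mean _ x); apply/funext => xi.
  by rewrite hE -EFinD; congr EFin; clear -model; lra.
have E2 : mean (fun xi => phi2 (Dseq (step xi) 0)) x + E = (a + w)%:E.
  rewrite -(mean_cst (a + w) x) /E -meanD//.
    congr (mean _ x); apply/funext => xi.
    by rewrite hE -EFinD; congr EFin; clear -model; lra.
  by move=> xi; case/andP: (prob_from01 (Dseq (step xi) 0) mC).
have := Hn x phi1 mphi1 b1; have := Hn x phi2 mphi2 b2.
rewrite -/I1 -/I2 I1E I2E.
move: E1 E2; set M1 := mean _ x; set M2 := mean _ x.
move=> E1 E2 h2 h1.
have /andP[M2f Ef] : (M2 \is a fin_num) && (E \is a fin_num) by rewrite -fin_numD E2.
have /andP[M1f _] : (M1 \is a fin_num) && (a%:E \is a fin_num) by rewrite -fin_numD E1.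
move: E1 E2 h1 h2; rewrite -(fineK M1f) -(fineK M2f) -(fineK Ef).
rewrite -!EFinD -!EFinM !lee_fin => -[E1] [E2] h1 h2.
by apply/andP; move: E1 E2 h1 h2 r12; clear -model => E1 E2 h1 h2 r12; split; nra.
Qed.

Lemma measurable_iter_step n : measurable_fun setT (iter n (@step R)).
Proof.
elim: n => [|n IH]; first exact: measurable_id.
by have := measurableT_comp (@measurable_step R) IH.
Qed.

Lemma measurable_iter_preimage n C : measurable C -> measurable (iter n (@step R) @^-1` C).
Proof. by move=> mC; apply: measurable_preimage => //; exact: measurable_iter_step. Qed.

(** The probability of an event that concerns the path seen from the [n]-th
    checkpoint depends little on the first gap. *)
Lemma uniform_mixing : exists2 q : R, (0 <= q < 1)%R & forall n C, measurable C ->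
  exists a : R, forall x,
    a%:E <= prob_from (iter n (@step R) @^-1` C) x <= (a + q ^+ n)%:E.
Proof.
have [q q01 Hq] := contraction; exists q => //.
move=> n C mC.
suff [a [a0 a1 ha]] : exists a : R, [/\ (0 <= a)%R, (a + q ^+ n <= 1)%R & forall x,
    a%:E <= prob_from (iter n (@step R) @^-1` C) x <= (a + q ^+ n)%:E] by exists a.
have {q01}[q0 q1] := andP q01.
elim: n => [|n [a [a0 a1 ha]]].
  exists 0%R; rewrite expr0 add0r; split => // x; exact: prob_from01.
have [] := Hq _ a (q ^+ n)%R (measurable_iter_preimage n mC) a0 _ a1 ha.
  exact: exprn_ge0.
move=> a' [aa' a'a ha']; exists a'; rewrite exprS; split.
- exact: le_trans aa'.
- exact: le_trans a1.
- move=> x; have := ha' x.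
  rewrite (_ : step @^-1` _ = iter n.+1 (@step R) @^-1` C)//.
  by apply/seteqP; split => xi; rewrite /preimage/= -iterSr.
Qed.

End mixing.

(** * Setwise convergence *)

Section setwise_convergence.
Local Open Scope ereal_scope.
Context d (X : measurableType d) (R : realType).
Context (m_ : nat -> probability X R) (m : probability X R).

Definition uniformly_cauchy := forall e : R, (0 < e)%R -> exists N, forall n A,
  (N <= n)%N -> measurable A -> m_ n A <= m_ N A + e%:E.

Hypothesis m_cauchy : uniformly_cauchy.

Let mfin n A : measurable A -> m_ n A \is a fin_num.
Proof. by move=> mA; rewrite fin_num_measure. Qed.

Lemma small_remainder (P : probability X R) (U : nat -> set X) (e : R) :
  (forall k, measurable (U k)) ->
  (forall x, exists k0, forall k, (k0 <= k)%N -> ~ U k x) -> (0 < e)%R ->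
  \forall k \near \oo, P (U k) < e%:E.
Proof.
move=> mU Uout e0.
have i1 : P.-integrable setT (cst 1) by exact: finite_measure_integrable_cst.
have [N _ H] := tail_integral_small i1 mU Uout e0.
by exists N => // k /H /=; rewrite integral_cst// mul1e.
Qed.

(** The uniform Cauchy property controls, for all large [n] at once, the mass
    that [m_ n] gives to the part of [A] that is not yet approximated. *)
Lemma cvg_from_below (A : set X) (U : nat -> set X) (s : nat -> nat -> R) (t : nat -> R) :
  measurable A -> (forall k, measurable (U k)) ->
  (forall x, exists k0, forall k, (k0 <= k)%N -> ~ U k x) ->
  (forall k n, (s k n)%:E <= m_ n A <= (s k n)%:E + m_ n (U k)) ->
  (forall k, (t k)%:E <= m A <= (t k)%:E + m (U k)) ->
  (forall k, s k n @[n --> \oo] --> t k) ->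
  fine (m_ n A) @[n --> \oo] --> fine (m A).
Proof.
move=> mA mU Uout sA tA st; apply/cvgrPdist_lt => e e0.
have e4 : (0 < e / 4)%R by rewrite divr_gt0.
have [N HN] := m_cauchy e4.
have [k [Uk Uk']] : exists k, m_ N (U k) < (e / 4)%:E /\ m (U k) < (e / 4)%:E.
  have [K1 _ H1] := small_remainder (m_ N) mU Uout e4.
  have [K2 _ H2] := small_remainder m mU Uout e4.
  exists (maxn K1 K2); split; first by apply: H1; rewrite /= leq_maxl.
  by apply: H2; rewrite /= leq_maxr.
have /cvgrPdist_lt/(_ _ e4)[N' _ HN'] := st k.
exists (maxn N N') => // n /=; rewrite geq_max => /andP[Nn N'n].
have := HN' n N'n; have := HN n _ Nn (mU k).
have /andP[] := sA k n; have /andP[] := tA k; move: Uk Uk'.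
have mAf : m A \is a fin_num by rewrite fin_num_measure.
have mUf : m (U k) \is a fin_num by rewrite fin_num_measure.
rewrite -(fineK (mfin n mA)) -(fineK (mfin n (mU k))) -(fineK (mfin N (mU k))).
rewrite -(fineK mAf) -(fineK mUf) -!EFinD !lte_fin !lee_fin /=.
rewrite !ltr_norml => *; apply/andP; split; lra.
Qed.

Lemma setwise_cvg (G : set (set X)) : @measurable _ X = <<s G >> -> setI_closed G ->
  (forall A, G A -> fine (m_ n A) @[n --> \oo] --> fine (m A)) ->
  forall A, measurable A -> fine (m_ n A) @[n --> \oo] --> fine (m A).
Proof.
move=> mG GI Gm A mA.
have GA : <<s G >> A by rewrite -mG.
have fT (P : probability X R) : fine (P setT) = 1%R by rewrite probability_setT.
have fC (P : probability X R) B : measurable B -> fine (P (~` B)) = (1 - fine (P B))%R.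
  by move=> mB; rewrite probability_setC// fineB// fin_num_measure.
apply: (dynkin_induction (P := fun A => fine (m_ n A) @[n --> \oo] --> fine (m A))
  mG GI) GA => //.
- by under eq_fun do rewrite fT; rewrite fT; exact: cvg_cst.
- move=> B mB cB; under eq_fun do rewrite fC//; rewrite fC//.
  by apply: cvgB => //; exact: cvg_cst.
- move=> B mB tB cB.
  pose V k := \big[setU/set0]_(i < k) B i.
  have mV k : measurable (V k) by exact: bigsetU_measurable.
  have mB' : measurable (\bigcup_k B k) by exact: bigcup_measurable.
  have VB k : V k `<=` \bigcup_k B k by move=> x; rewrite /V -bigcup_mkord => -[i _ Bi]; exists i.
  pose U k := (\bigcup_k B k) `\` V k.
  have mU k : measurable (U k) by exact: measurableD.
  have PV (P : probability X R) k : fine (P (V k)) = (\sum_(i < k) fine (P (B i)))%R.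
    by rewrite /V measure_bigsetU// -sum_fine// => i _; rewrite fin_num_measure.
  have PA (P : probability X R) k :
      (fine (P (V k)))%:E <= P (\bigcup_k B k) <= (fine (P (V k)))%:E + P (U k).
    rewrite fineK ?fin_num_measure//; apply/andP; split.
      by apply: le_measure; rewrite ?inE.
    rewrite -measureU//; last by rewrite /U setDE setICA setICr setI0.
    apply: le_measure; rewrite ?inE//; first exact: measurableU.
    by move=> x Bx; have [Vx|nVx] := pselect (V k x); [left|right].
  apply: (@cvg_from_below _ U (fun k n => fine (m_ n (V k))) (fun k => fine (m (V k)))) => //.
    move=> x; have [[i _ Bi]|nB] := pselect ((\bigcup_k B k) x).
      exists i.+1 => k ik [_]; apply; rewrite /V -bigcup_mkord.
      by exists i.
    by exists 0%N => k _ [].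
  move=> k; rewrite PV (_ : (fun n => fine (m_ n (V k))) =
      (fun n => \sum_(i < k) fine (m_ n (B i)))%R); last by apply/funext => n; exact: PV.
  elim: k => [|k IH].
    rewrite big_ord0 (_ : (fun _ => _) = (fun=> 0%R)); first exact: cvg_cst.
    by apply/funext => n; rewrite big_ord0.
  rewrite big_ord_recr/= (_ : (fun _ => _) =
    (fun n => \sum_(i < k) fine (m_ n (B i)) + fine (m_ n (B k)))%R); first exact: cvgD.
  by apply/funext => n; rewrite big_ord_recr.
Qed.

End setwise_convergence.

(** * The stationary law *)

Lemma integral_bounds d (X : measurableType d) (R : realType) (P : probability X R)
    (f : X -> \bar R) (a b : R) :
  measurable_fun setT f -> (forall x, 0 <= f x)%E ->
  (forall x, a%:E <= f x <= b%:E)%E -> (a%:E <= \int[P]_x f x <= b%:E)%E.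
Proof.
move=> mf f0 fab; apply/andP; split.
  have [a0|a0] := leP 0 a; last first.
    by apply: (@le_trans _ _ 0%E); [rewrite lee_fin ltW|exact: integral_ge0].
  rewrite -[leLHS](integral_prob_cst P); apply: ge0_le_integral => // x _.
  by case/andP: (fab x).
rewrite -[leRHS](integral_prob_cst P); apply: ge0_le_integral => // x _.
by case/andP: (fab x).
Qed.

Lemma measurable_good (R : realType) : measurable [set xi : hpath R | good xi].
Proof.
rewrite (_ : mkset _ =
  (\bigcap_i [set xi | (0 <= Dseq xi i)%R]) `&`
  (\bigcap_i \bigcap_j [set xi | (0 <= Lseq xi i j)%R]) `&`
  (\bigcap_n \bigcup_k [set xi | (n%:R <= Xseq xi k)%R]) `&`
  (\bigcap_i \bigcap_n \bigcup_j [set xi | (n%:R < Lseq xi i j)%R])).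
  repeat apply: measurableI.
  - apply: bigcap_measurable => [|i _]; first by exists 0%N.
    by apply: measurable_ler => //; exact: measurable_Dseq.
  - do 2 (apply: bigcap_measurable => [|? _]; first by exists 0%N).
    by apply: measurable_ler => //; exact: measurable_mark.
  - apply: bigcap_measurable => [|n _]; first by exists 0%N.
    apply: bigcup_measurable => k _.
    by apply: measurable_ler => //; exact: measurable_Xseq.
  - do 2 (apply: bigcap_measurable => [|? _]; first by exists 0%N).
    apply: bigcup_measurable => k _.
    by apply: measurable_ltr => //; exact: measurable_mark.
apply/seteqP; split => [xi [h1 h2 h3 h4]|xi [[[h1 h2] h3] h4]].
  split; [split; [split|]|].
  - by move=> i _; exact: h1.
  - by move=> i _ j _; exact: h2.
  - by move=> n _; have [k ?] := h3 n%:R; exists k.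
  - by move=> i _ n _; have [k ?] := h4 i n%:R; exists k.
split.
- by move=> i; exact: h1.
- by move=> i j; exact: h2.
- move=> z; have [k _ zk] := h3 (Num.truncn z).+1 Logic.I; exists k.
  by rewrite (le_trans _ zk)// ltW// truncnS_gt.
- move=> i x; have [k _ xk] := h4 i Logic.I (Num.truncn x).+1 Logic.I; exists k.
  by rewrite (lt_trans _ xk)// truncnS_gt.
Qed.

Section fresh_start.
Local Open Scope ereal_scope.
Context (R : realType) (F rho : probability R R)
  (Lam : probability (marks R) R) (mu : probability (hpath R) R).
Hypothesis model : path_model F rho Lam mu.
Implicit Types (f : hpath R -> \bar R) (nu : probability (hpath R) R).

Local Notation mean := (mean_from mu).
Local Notation prob_from := (prob_from mu).

(** Laws of paths for which everything but the first gap is as in the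
    original process. *)
Definition fresh_start nu := forall f, measurable_fun setT f ->
  (forall xi, 0 <= f xi) -> \int[nu]_xi f xi = \int[nu]_xi mean f (Dseq xi 0).

Lemma measurable_mean_gap f : measurable_fun setT f -> (forall xi, 0 <= f xi) ->
  measurable_fun setT (fun xi : hpath R => mean f (Dseq xi 0)).
Proof.
by move=> mf f0; exact: (measurableT_comp (measurable_mean_from mu mf f0) (measurable_Dseq 0)).
Qed.

Lemma fresh_start_path : fresh_start mu.
Proof.
move=> f mf f0; rewrite (integral_gap model) ?(integral_mean_from model)//.
- exact: measurable_mean_from.
- by move=> y; exact: mean_from_ge0.
Qed.

Lemma fresh_start_step nu : fresh_start nu ->
  fresh_start (image_law nu (@measurable_step R)).
Proof.
move=> hnu f mf f0; have ms := @measurable_step R.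
have mg := measurable_mean_gap mf f0.
have g0 xi : 0 <= mean f (Dseq xi 0) by exact: mean_from_ge0.
rewrite (integral_image_law nu ms mf f0) (integral_image_law nu ms mg g0).
have mfs := measurableT_comp mf ms; have mgs := measurableT_comp mg ms.
rewrite (hnu _ mfs (fun xi => f0 _)) (hnu _ mgs (fun xi => g0 _)).
by apply: eq_integral => xi _; exact: (mean_step model).
Qed.

(** Law of the path seen from the [n]-th checkpoint. *)
Definition seen n : probability (hpath R) R := image_law mu (@measurable_iter_step R n).

Lemma integral_seen n f : measurable_fun setT f -> (forall xi, 0 <= f xi) ->
  \int[seen n]_xi f xi = \int[mu]_xi f (iter n step xi).
Proof. by move=> mf f0; exact: integral_image_law. Qed.

Lemma fresh_start_seen n : fresh_start (seen n).
Proof.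
elim: n => [|n IH] f mf f0; have mg := measurable_mean_gap mf f0;
  have g0 xi : 0 <= mean f (Dseq xi 0) by [exact: mean_from_ge0];
  rewrite (integral_seen _ mf f0) (integral_seen _ mg g0).
  exact: (fresh_start_path mf f0).
have ms := @measurable_step R.
have mfs := measurableT_comp mf ms; have mgs := measurableT_comp mg ms.
have := fresh_start_step IH mf f0.
rewrite (integral_image_law (seen n) ms mf f0) (integral_image_law (seen n) ms mg g0).
by rewrite (integral_seen n mfs (fun xi => f0 _)) (integral_seen n mgs (fun xi => g0 _)).
Qed.

Lemma prob_fresh_start nu C : fresh_start nu -> measurable C ->
  nu C = \int[nu]_xi prob_from C (Dseq xi 0).
Proof.
move=> hnu mC; rewrite -(hnu (fun xi => (\1_C xi)%:E)).
- by rewrite integral_indic// setIT.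
- exact: measurable_indicE.
- by move=> xi; rewrite lee_fin.
Qed.

Lemma seenD n m C : seen (n + m) C = seen m (iter n step @^-1` C).
Proof.
rewrite /seen /image_law /distribution /pushforward/=; congr (mu _).
by apply/seteqP; split => xi; rewrite /preimage/= iterD.
Qed.

Lemma seen_close (e : R) : (0 < e)%R -> exists N, forall n m A,
  (N <= n)%N -> (N <= m)%N -> measurable A -> seen n A <= seen m A + e%:E.
Proof.
have [q /andP[q0 q1] Hq] := uniform_mixing model.
move=> e0.
have [N _ HN] : \forall n \near \oo, (q ^+ n < e)%R.
  have q1' : (`|q| < 1)%R by rewrite ger0_norm.
  have /cvgrPdist_lt/(_ _ e0) := cvg_expr q1'.
  by apply: filterS => n; rewrite sub0r normrN ger0_norm// exprn_ge0.
exists N => n m A Nn Nm mA.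
have [a ha] := Hq N A mA.
have mC := measurable_iter_preimage N mA.
have mP := measurableT_comp (measurable_prob_from mu mC) (measurable_Dseq 0).
have p0 y : 0 <= prob_from (iter N step @^-1` A) y.
  by case/andP: (prob_from01 mu y mC).
have ps k : a%:E <= seen (N + k) A <= (a + q ^+ N)%:E.
  rewrite seenD (prob_fresh_start (@fresh_start_seen k) mC).
  exact: (integral_bounds (seen k) mP (fun xi => p0 _) (fun xi => ha _)).
rewrite -(subnKC Nn) -(subnKC Nm).
have /andP[_ h1] := ps (n - N)%N; have /andP[h2 _] := ps (m - N)%N.
apply: (le_trans h1); rewrite EFinD; apply: leeD => //.
by rewrite lee_fin; apply/ltW/HN => /=.
Qed.

Section weak_limit.
Variable gap_limit : probability R R.

(** The checkpoint numbered [n.+1] is the one of the [n]-th ideal time. *)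
Hypothesis gap_cvg : forall f : R -> R, continuous f -> (exists M : R, forall x, (`|f x| <= M)%R) ->
  \int[mu]_xi (f (Dseq (iter n.+1 (@step R) xi) 0))%:E @[n --> \oo] -->
  \int[gap_limit]_x (f x)%:E.

Definition gap_law n : probability R R := image_law (seen n.+1) (@measurable_Dseq R 0).

Lemma seenS_cauchy : uniformly_cauchy (fun n => seen n.+1).
Proof.
move=> e e0; have [N HN] := seen_close e0.
by exists N => n A Nn mA; apply: HN => //; exact: ltnW.
Qed.

Lemma gap_law_cauchy : uniformly_cauchy gap_law.
Proof.
move=> e e0; have [N HN] := seenS_cauchy e0.
exists N => n A Nn mA; apply: HN => //.
exact: (measurable_preimage (measurable_Dseq 0) mA).
Qed.

Lemma integral_gap_law n (f : R -> \bar R) : measurable_fun setT f ->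
  (forall y, 0 <= f y) ->
  \int[gap_law n]_y f y = \int[mu]_xi f (Dseq (iter n.+1 (@step R) xi) 0).
Proof.
move=> mf f0; rewrite (integral_image_law (seen n.+1) _ mf f0).
exact: (integral_seen n.+1 (measurableT_comp mf (measurable_Dseq 0)) (fun xi => f0 _)).
Qed.

(** Continuous approximation from below of the indicator function of a ray. *)
Let ramp (x : R) (k : nat) (y : R) : R :=
  (Num.max 0 (Num.min 1 (k.+1%:R * (x - y))))%R.

Let ramp01 x k y : (0 <= ramp x k y <= 1)%R.
Proof. by rewrite /ramp le_max lexx/= ge_max ler01/= ge_min lexx. Qed.

Let ramp_continuous x k : continuous (ramp x k).
Proof.
move=> y.
apply: (@continuous_max _ _ (cst 0%R) (fun y => Num.min 1 (k.+1%:R * (x - y)))%R y).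
  exact: cvg_cst.
apply: (@continuous_min _ _ (cst 1%R) (fun y => k.+1%:R * (x - y))%R y).
  exact: cvg_cst.
by apply: cvgM; [exact: cvg_cst|apply: cvgB; [exact: cvg_cst|exact: cvg_id]].
Qed.

Let ray x : set R := [set y | (y < x)%R].

Let shell x k : set R := [set y | (y < x)%R /\ (k.+1%:R * (x - y) < 1)%R].

Let measurable_ray x : measurable (ray x).
Proof. exact: measurable_ltr. Qed.

Let measurable_shell x k : measurable (shell x k).
Proof.
apply: measurableI; apply: measurable_ltr => //.
by apply: measurable_funM => //; exact: measurable_funB.
Qed.

Let measurable_ramp x k : measurable_fun setT (fun y => (ramp x k y)%:E).
Proof.
by apply/measurable_EFinP; apply: continuous_measurable_fun; exact: ramp_continuous.
Qed.

Let ramp_fin (P : probability R R) x k : \int[P]_y (ramp x k y)%:E \is a fin_num.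
Proof.
have /andP[h0 h1] : 0%:E <= \int[P]_y (ramp x k y)%:E <= 1%:E.
  apply: integral_bounds => [|y|y]; first exact: measurable_ramp.
    by rewrite lee_fin; case/andP: (ramp01 x k y).
  by rewrite !lee_fin.
by rewrite ge0_fin_numE// (le_lt_trans h1)// ltry.
Qed.

Let ramp_bounds (P : probability R R) x k :
  (fine (\int[P]_y (ramp x k y)%:E))%:E <= P (ray x) <=
  (fine (\int[P]_y (ramp x k y)%:E))%:E + P (shell x k).
Proof.
have r0 y : 0 <= (ramp x k y)%:E by rewrite lee_fin; case/andP: (ramp01 x k y).
have mr := @measurable_ramp x k; have mA := @measurable_ray x.
have mS := @measurable_shell x k.
have fin := ramp_fin P x k.
have IE (A : set R) : measurable A -> P A = \int[P]_y (\1_A y)%:E.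
  by move=> mB; rewrite integral_indic// setIT.
rewrite fineK// (IE _ mA) (IE _ mS).
have mAi := measurable_indicE mA; have mSi := measurable_indicE mS.
apply/andP; split.
  apply: ge0_le_integral => // y _; rewrite lee_fin indicE.
  have [yA|nA] := boolP (y \in ray x); first by case/andP: (ramp01 x k y).
  rewrite /ramp ge_max lexx/= ge_min; apply/orP; right.
  rewrite mulr_ge0_le0// subr_le0 leNgt; apply/negP => xy.
  by move: nA; rewrite mem_set.
rewrite -ge0_integralD//; apply: ge0_le_integral => //; first exact: emeasurable_funD.
move=> y _; rewrite -EFinD lee_fin !indicE.
have /andP[h0 h1] := ramp01 x k y.
have [/set_mem yA|nA] := boolP (y \in ray x); last by rewrite addr_ge0.
have [h|h] := ltP (k.+1%:R * (x - y))%R 1%R.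
  by rewrite [y \in shell x k]mem_set// lerDr.
by rewrite /ramp (min_l h) (max_r ler01) lerDl.
Qed.

Lemma gap_law_cvg A : measurable A ->
  fine (gap_law n A) @[n --> \oo] --> fine (gap_limit A).
Proof.
apply: (setwise_cvg gap_law_cauchy (RGenInftyO.measurableE R)).
  move=> _ _ [x ->] [y ->]; exists (Num.min x y).
  apply/seteqP; split => z /=; rewrite !in_itv/=.
    by case=> zx zy; rewrite lt_min zx zy.
  by rewrite lt_min => /andP[].
move=> _ [x ->]; rewrite (_ : `]-oo, x[%classic = ray x); last first.
  by apply/seteqP; split => z /=; rewrite in_itv.
apply: (cvg_from_below gap_law_cauchy (U := shell x)
  (s := fun k n => fine (\int[gap_law n]_y (ramp x k y)%:E))
  (t := fun k => fine (\int[gap_limit]_y (ramp x k y)%:E))) => //.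
  move=> y; have [yx|xy] := ltP y x; last first.
    by exists 0%N => k _ [+ _]; rewrite ltNge xy.
  have xy0 : (0 < x - y)%R by rewrite subr_gt0.
  exists (Num.truncn (x - y)^-1) => k nk [_]; apply/negP; rewrite -leNgt.
  rewrite -ler_pdivrMr// div1r (le_trans (ltW (truncnS_gt _)))// ler_nat ltnS//.
move=> k; apply: fine_cvg.
rewrite (fineK (ramp_fin _ x k)).
rewrite (_ : (fun n => _) = fun n =>
  \int[mu]_xi (ramp x k (Dseq (iter n.+1 (@step R) xi) 0))%:E).
  apply: gap_cvg; first exact: ramp_continuous.
  exists 1%R => y; have /andP[h0 h1] := ramp01 x k y.
  by rewrite ger0_norm.
apply/funext => n; apply: integral_gap_law => // y.
by rewrite lee_fin; case/andP: (ramp01 x k y).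
Qed.

(** Law of the path seen from a checkpoint in the stationary regime. *)
Definition stationary_law : probability (hpath R) R :=
  image_law (gap_limit \x mu : probability _ _)%E (@measurable_with_gap R).

Lemma integral_stationary f : measurable_fun setT f -> (forall xi, 0 <= f xi) ->
  \int[stationary_law]_xi f xi = \int[gap_limit]_x mean f x.
Proof.
move=> mf f0; rewrite (integral_image_law _ _ mf f0).
rewrite (fubini_tonelli1 (fun p : R * hpath R => f (with_gap p.1 p.2)))//.
exact: (measurableT_comp mf (@measurable_with_gap R)).
Qed.

Lemma integral_stationary_gap (f : R -> \bar R) : measurable_fun setT f ->
  (forall y, 0 <= f y) ->
  \int[stationary_law]_xi f (Dseq xi 0) = \int[gap_limit]_x f x.
Proof.
move=> mf f0; have mfD := measurableT_comp mf (@measurable_Dseq R 0).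
rewrite (integral_stationary mfD (fun xi => f0 _)).
by apply: eq_integral => x _; exact: (integral_prob_cst mu (f x)).
Qed.

Lemma fresh_start_stationary : fresh_start stationary_law.
Proof.
move=> f mf f0; rewrite (integral_stationary mf f0).
rewrite (integral_stationary_gap (measurable_mean_from mu mf f0))// => y.
exact: mean_from_ge0.
Qed.

Let rect : set (set (R * marks R)) := [set A `*` B | A in measurable & B in measurable].

Lemma prob_from_box n (A : nat -> set R) (B : nat -> set (marks R)) :
  (forall i, measurable (A i)) -> (forall i, measurable (B i)) ->
  exists2 c : R, (0 <= c)%R & forall x,
    prob_from (seq_box n.+1 (fun i => A i `*` B i)) x = (c * \1_(A 0%N) x)%:E.
Proof.
move=> mA mB.
pose A' i := if i is 0%N then setT else A i.
have mA' i : measurable (A' i) by case: i => [|i]; [exact: measurableT|exact: mA].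
pose C' : set (hpath R) := seq_box n.+1 (fun i => A' i `*` B i).
have mC' : measurable C' by apply: measurable_seq_box => i; exact: measurableX.
exists (fine (mu C')); first exact: fine_ge0.
move=> x.
have boxE xi : seq_box n.+1 (fun i => A i `*` B i) (with_gap x xi) <->
    A 0%N x /\ C' xi.
  split=> [h|[Ax h] [|i] ni].
  - split; first by case: (h 0%N (ltn0Sn n)).
    by move=> [|i] ni; [split => //; case: (h 0%N (ltn0Sn n))|exact: (h i.+1 ni)].
  - by split => //; case: (h 0%N ni).
  - exact: (h i.+1 ni).
transitivity (\int[mu]_xi ((\1_(A 0%N) x)%:E * (\1_C' xi)%:E)).
  apply: eq_integral => xi _; rewrite -EFinM; congr EFin.
  rewrite !indicE -natrM mulnb; congr (_%:R); congr nat_of_bool.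
  apply/idP/idP => [/set_mem/boxE[Ax Cxi]|/andP[/set_mem Ax /set_mem Cxi]].
    by apply/andP; split; exact/mem_set.
  by apply/mem_set/boxE.
rewrite ge0_integralZl//; last exact: measurable_indicE.
by rewrite integral_indic// setIT [RHS]EFinM fineK ?fin_num_measure// muleC.
Qed.

Lemma rect_setI : setI_closed rect.
Proof.
move=> _ _ [A mA [B mB <-]] [A' mA' [B' mB' <-]].
exists (A `&` A'); first exact: measurableI.
by exists (B `&` B'); [exact: measurableI|rewrite setXI].
Qed.

Lemma measurable_rect : @measurable _ (R * marks R)%type = <<s rect >>.
Proof. exact: measurable_prod_measurableType. Qed.

Lemma seen_cvg C : measurable C ->
  fine (seen n.+1 C) @[n --> \oo] --> fine (stationary_law C).
Proof.
have rT : rect setT by exists setT => //; exists setT => //; rewrite setXTT.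
apply: (setwise_cvg seenS_cauchy (measurable_seq_boxes measurable_rect rT)
  (seq_boxes_setI rect_setI rT)).
move=> _ [[|n] [A [rA ->]]].
  have bT : seq_box 0 A = setT by apply/seteqP; split.
  have e (P : probability (hpath R) R) : fine (P (seq_box 0 A)) = 1%R.
    by rewrite bT probability_setT.
  by rewrite e (_ : (fun n => _) = cst 1%R); [exact: cvg_cst|apply/funext => n; exact: e].
have /choice[A1 hA1] i : exists A1, measurable A1 /\
    exists2 B, measurable B & A1 `*` B = A i.
  by have [A1 mA1 h] := rA i; exists A1.
have /choice[B hB] i : exists B, measurable B /\ A1 i `*` B = A i.
  by have [_ [B mB h]] := hA1 i; exists B.
have mA1 i : measurable (A1 i) by case: (hA1 i).
have mB i : measurable (B i) by case: (hB i).
have -> : A = fun i => A1 i `*` B i by apply/funext => i; case: (hB i).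
set D := seq_box _ _.
have mD : measurable D by apply: measurable_seq_box => i; exact: measurableX.
have [c c0 hc] := prob_from_box n mA1 mB.
have mAi : measurable_fun setT (fun y => (\1_(A1 0%N) y)%:E : \bar R).
  exact: measurable_indicE.
have ai0 y : 0 <= (\1_(A1 0%N) y)%:E :> \bar R by rewrite lee_fin.
have int_box (P : probability R R) :
    \int[P]_y prob_from D y = c%:E * P (A1 0%N).
  rewrite (eq_integral (fun y => c%:E * (\1_(A1 0%N) y)%:E)).
    by rewrite ge0_integralZl// integral_indic// setIT.
  by move=> y _; rewrite hc EFinM.
have mP := measurable_prob_from mu mD.
have P0 y : 0 <= prob_from D y by case/andP: (prob_from01 mu y mD).
have seenE k : seen k.+1 D = c%:E * gap_law k (A1 0%N).
  rewrite (prob_fresh_start (@fresh_start_seen k.+1) mD) -int_box.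
  by rewrite (integral_image_law (seen k.+1) _ mP P0).
have limE : stationary_law D = c%:E * gap_limit (A1 0%N).
  rewrite (prob_fresh_start fresh_start_stationary mD) -int_box.
  by rewrite (integral_stationary_gap mP P0).
rewrite limE (_ : (fun n => _) = fun n => (c * fine (gap_law n (A1 0%N)))%R).
  rewrite fineM ?fin_num_measure//; apply: cvgM; first exact: cvg_cst.
  exact: gap_law_cvg.
by apply/funext => k; rewrite seenE fineM ?fin_num_measure.
Qed.

Lemma stationary_step C : measurable C ->
  stationary_law (step @^-1` C) = stationary_law C.
Proof.
move=> mC; have mC' := measurable_preimage (@measurable_step R) mC.
have h1 := seen_cvg mC'.
have h2 : fine (seen n.+1 (step @^-1` C)) @[n --> \oo] --> fine (stationary_law C).
  rewrite (_ : (fun n => _) = (fun n => fine (seen (n + 1).+1 C))).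
    by rewrite (cvg_shiftn 1 (fun n => fine (seen n.+1 C))); exact: seen_cvg.
  by apply/funext => n; rewrite -addSn addnC (seenD 1 n.+1).
have e := cvg_unique (@Rhausdorff R) h1 h2.
by rewrite -[LHS]fineK ?fin_num_measure// e fineK ?fin_num_measure.
Qed.

Lemma stationary_good : {ae stationary_law, forall xi, good xi}.
Proof.
have mN := measurableC (@measurable_good R).
have h1 := seen_cvg mN.
have s0 n : seen n.+1 (~` @good R) = 0.
  apply: (ae_measure0 (mu := mu)); first exact: measurable_iter_preimage.
  by apply: filterS (good_ae model) => xi gxi; apply; exact: good_iter_step.
have h2 : fine (seen n.+1 (~` @good R)) @[n --> \oo] --> 0%R.
  by rewrite (_ : (fun n => _) = cst 0%R); [exact: cvg_cst|apply/funext => n; rewrite s0].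
have s1 := cvg_unique (@Rhausdorff R) h1 h2.
apply: filterS (measure0_aeN (mu := stationary_law) mN _) => [xi /contrapT//|].
by rewrite -[LHS]fineK ?fin_num_measure// s1.
Qed.

End weak_limit.

End fresh_start.

(** * Averages along the checkpoints *)

Section maximal_ergodic.
Local Open Scope ereal_scope.
Context d (X : measurableType d) (R : realType) (P : probability X R).
Context (T : X -> X) (g : X -> R).
Hypothesis mT : measurable_fun setT T.
Hypothesis PT : forall A, measurable A -> P (T @^-1` A) = P A.
Hypothesis ig : P.-integrable setT (EFin \o g).

(** [max_sum n] is the maximum of the first [n] partial sums along [T] and 0. *)
Fixpoint max_sum n (x : X) : R :=
  if n is m.+1 then (Num.max 0 (g x + max_sum m (T x)))%R else 0%R.

Definition sums_unbounded : set X := [set x | forall K, exists n, (K < max_sum n x)%R].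

Lemma max_sum_ge0 n x : (0 <= max_sum n x)%R.
Proof. by case: n => //= n; rewrite le_max lexx. Qed.

Lemma le_max_sum n x : (\sum_(i < n) g (iter i T x) <= max_sum n x)%R.
Proof.
elim: n x => [|n IH] x; first by rewrite big_ord0.
rewrite big_ord_recl /= le_max; apply/orP; right; rewrite lerD2l.
rewrite (le_trans _ (IH (T x)))//; apply: ler_sum => i _.
by rewrite -iterSr.
Qed.

Lemma max_sumS n x : (max_sum n x <= max_sum n.+1 x)%R.
Proof.
elim: n x => [|n IH] x; first exact: max_sum_ge0.
rewrite [leRHS]/= [leLHS]/= ge_max !le_max lexx/= lerD2l.
by apply/orP; right; exact: IH.
Qed.

Lemma max_sum_nd m n x : (m <= n)%N -> (max_sum m x <= max_sum n x)%R.
Proof.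
move=> mn; rewrite -(subnKC mn); elim: (n - m)%N => [|k IH]; first by rewrite addn0.
by rewrite addnS (le_trans IH)// max_sumS.
Qed.

Lemma sums_unbounded_invariant : T @^-1` sums_unbounded = sums_unbounded.
Proof.
apply/seteqP; split => x h K.
  have [n hn] := h (K - g x)%R; exists n.+1.
  by rewrite /= lt_max; apply/orP; right; rewrite -ltrBlDl.
have [[|n]] := h (Num.max 0 (g x + K))%R.
  by rewrite ltNge le_max lexx.
move=> /= hn; exists n; rewrite ltNge; apply/negP => MK.
by move: hn; rewrite ltNge => /negP; apply; rewrite ge_max !le_max lexx/= lerD2l MK orbT.
Qed.

Lemma measurable_max_sum n : measurable_fun setT (max_sum n).
Proof.
have mg : measurable_fun setT g by apply/measurable_EFinP; exact: measurable_int ig.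
elim: n => [|n IH]; first exact: measurable_cst.
by apply: measurable_maxr => //; apply: measurable_funD => //; exact: (measurableT_comp IH mT).
Qed.

Lemma measurable_sums_unbounded : measurable sums_unbounded.
Proof.
rewrite (_ : sums_unbounded = \bigcap_m \bigcup_n [set x | (m%:R < max_sum n x)%R]).
  apply: bigcap_measurable => [|m _]; first by exists 0%N.
  apply: bigcup_measurable => n _.
  by apply: measurable_ltr => //; exact: measurable_max_sum.
apply/seteqP; split => [x h m _|x h K]; first by have [n hn] := h m%:R; exists n.
have [n _ hn] := h (Num.truncn K).+1 Logic.I; exists n.
by rewrite (lt_trans _ hn)// truncnS_gt.
Qed.

Lemma integral_preserved (f : X -> \bar R) : measurable_fun setT f ->
  (forall x, 0 <= f x) -> \int[P]_x f (T x) = \int[P]_x f x.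
Proof.
move=> mf f0; rewrite -(integral_image_law P mT mf f0).
by apply: eq_measure_integral => A mA _; exact: PT.
Qed.

Lemma integrable_preserved (f : X -> R) : P.-integrable setT (EFin \o f) ->
  P.-integrable setT (EFin \o (f \o T)).
Proof.
move=> /integrableP[mf fi]; apply/integrableP; split.
  exact: (measurableT_comp mf mT).
rewrite (integral_preserved (f := fun x => `|(f x)%:E|))//.
exact: measurableT_comp.
Qed.

Lemma integrable_max_sum n : P.-integrable setT (EFin \o max_sum n).
Proof.
elim: n => [|n IH]; first exact: (finite_measure_integrable_cst P 0%R).
have iT := integrable_preserved IH.
have is_ := integrableD measurableT ig iT.
apply: le_integrable is_ => //.
  by apply/measurable_EFinP; exact: measurable_max_sum.
move=> x _ /=; rewrite lee_fin [leLHS]ger0_norm ?le_max ?lexx//.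
by rewrite ge_max normr_ge0 ler_norm.
Qed.

Lemma maximal_ergodic : 0 <= \int[P]_(x in sums_unbounded) (g x)%:E.
Proof.
have mB := measurable_sums_unbounded.
set B := sums_unbounded in mB *.
have mg : measurable_fun setT g by apply/measurable_EFinP; exact: measurable_int ig.
have TB x : B (T x) = B x by rewrite /B -[in RHS]sums_unbounded_invariant.
pose dif n x : R := Num.max (- max_sum n (T x))%R (g x).
have difE n x : dif n x = (max_sum n.+1 x - max_sum n (T x))%R.
  by rewrite /dif /= addr_maxl sub0r addrK.
have iM n : P.-integrable B (EFin \o max_sum n).
  exact: (integrableS measurableT mB (@subsetT _ _) (integrable_max_sum n)).
have iMT n : P.-integrable B (EFin \o (max_sum n \o T)).
  exact: (integrableS measurableT mB (@subsetT _ _)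
    (integrable_preserved (integrable_max_sum n))).
have invB n : \int[P]_(x in B) (max_sum n (T x))%:E = \int[P]_(x in B) (max_sum n x)%:E.
  rewrite [LHS]integral_mkcond [RHS]integral_mkcond.
  pose f := (fun x => (max_sum n x)%:E) \_ B.
  have mf : measurable_fun setT f.
    by apply: measurable_patch => //; apply/measurable_EFinP; exact: measurable_max_sum.
  have f0 x : 0 <= f x.
    by rewrite /f patchE; case: ifP => // _; rewrite lee_fin max_sum_ge0.
  rewrite -(integral_preserved mf f0); apply: eq_integral => x _.
  rewrite /f !patchE; congr (if _ then _ else _).
  by apply/idP/idP; rewrite !inE TB.
have dif_ge0 n : 0 <= \int[P]_(x in B) (dif n x)%:E.
  rewrite (eq_integral (fun x => (max_sum n.+1 x)%:E - (max_sum n (T x))%:E)); last first.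
    by move=> x _; rewrite difE.
  rewrite (integralB_EFin mB (iM n.+1) (iMT n)) invB sube_ge0; last first.
    by rewrite (integrable_fin_num mB (iM n)).
  apply: ge0_le_integral => //.
  - by move=> x _; rewrite lee_fin max_sum_ge0.
  - exact: measurable_int (iM n).
  - exact: measurable_int (iM n.+1).
  - by move=> x _; rewrite lee_fin max_sumS.
have mdif n : measurable_fun B (fun x => (dif n x)%:E).
  apply: measurable_funTS; apply/measurable_EFinP; apply: measurable_maxr => //.
  apply: measurable_funN; exact: (measurableT_comp (measurable_max_sum n) mT).
have cv : {ae P, forall x, B x -> (fun n => (dif n x)%:E) @ \oo --> (g x)%:E}.
  apply: aeW => x Bx; apply: cvg_near_cst.
  have BTx : B (T x) by rewrite TB.
  have [n hn] := BTx (- g x)%R; exists n => // m /= nm; congr EFin.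
  apply: max_r; rewrite lerNl ltW// (lt_le_trans hn)//.
  exact: max_sum_nd.
have dom : {ae P, forall x n, B x -> `|(dif n x)%:E| <= (abse \o (EFin \o g)) x}.
  apply: aeW => x n Bx /=; rewrite lee_fin /dif.
  have := max_sum_ge0 n (T x); set m := max_sum n _ => m0.
  rewrite ler_norml; apply/andP; split.
    by rewrite le_max [X in _ || X]lerNl -normrN ler_norm orbT.
  by rewrite ge_max ler_norm andbT (le_trans _ (normr_ge0 _))// oppr_le0.
have ig' := integrable_abse (integrableS measurableT mB (@subsetT _ _) ig).
have [_ _ h] := dominated_convergence mB mdif
  (measurable_funTS (measurable_int _ ig)) cv ig' dom.
apply: (cvge_ge _ h); exact: nearW.
Qed.

(** If moreover [g] is uncorrelated with the event that the partial sums are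
    unbounded and has a negative mean, then this event is null. *)
Lemma sums_unbounded_null :
  \int[P]_(x in sums_unbounded) (g x)%:E = P sums_unbounded * \int[P]_x (g x)%:E ->
  \int[P]_x (g x)%:E < 0 -> P sums_unbounded = 0.
Proof.
move=> h gneg; apply/eqP; rewrite -measure_le0 leNgt; apply/negP => B0.
have := maximal_ergodic; rewrite h leNgt => /negP; apply.
by rewrite pmule_rlt0.
Qed.

End maximal_ergodic.

Section chain_averages.
Local Open Scope ereal_scope.
Context (R : realType) (F rho : probability R R)
  (Lam : probability (marks R) R) (mu : probability (hpath R) R).
Hypothesis model : path_model F rho Lam mu.
Variable nu : probability (hpath R) R.
Hypothesis nu_fresh : fresh_start mu nu.
Hypothesis nu_step : forall A, measurable A -> nu (step @^-1` A) = nu A.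
Implicit Types (u f : hpath R -> \bar R) (B : set (hpath R)).

Local Notation mean := (mean_from mu).
Local Notation prob_from := (prob_from mu).

Lemma invariant_prob_from B : measurable B -> step @^-1` B = B ->
  exists2 c : R, (0 <= c)%R & forall x, prob_from B x = c%:E.
Proof.
move=> mB BB; have [q /andP[q0 q1] Hq] := uniform_mixing model.
have BBn n : iter n step @^-1` B = B.
  elim: n => [|n IH] //; rewrite -[RHS]BB -[in RHS]IH.
  by apply/seteqP; split => xi; rewrite /preimage/= -iterSr.
have pE x : prob_from B x = (fine (prob_from B x))%:E by rewrite fineK// prob_from_fin.
exists (fine (prob_from B 0)).
  by rewrite fine_ge0//; case/andP: (prob_from01 mu 0 mB).
move=> x; rewrite pE; congr EFin; apply/eqP; rewrite -subr_eq0 -normr_eq0.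
rewrite eq_le normr_ge0 andbT; apply/ler_addgt0Pl => e e0; rewrite addr0.
have [n _ Hn] : \forall n \near \oo, (q ^+ n < e)%R.
  have q1' : (`|q| < 1)%R by rewrite ger0_norm.
  have /cvgrPdist_lt/(_ _ e0) := cvg_expr q1'.
  by apply: filterS => n; rewrite sub0r normrN ger0_norm// exprn_ge0.
have [a ha] := Hq n B mB.
have := ha x; have := ha 0%R; rewrite !BBn (pE x) (pE 0%R) !lee_fin => /andP[h1 h2] /andP[h3 h4].
have qe := Hn n (leqnn n); rewrite ler_norml.
by apply/andP; move: qe h1 h2 h3 h4; clear -model => /= *; split; lra.
Qed.

Lemma integral_adapted_invariant u B c :
  measurable_fun setT u -> (forall xi, 0 <= u xi) -> adapted u ->
  measurable B -> step @^-1` B = B -> (0 <= c)%R -> (forall x, prob_from B x = c%:E) ->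
  \int[nu]_(xi in B) u xi = c%:E * \int[nu]_xi u xi.
Proof.
move=> mu_ u0 au mB BB c0 hc.
have mBi : measurable_fun setT (fun xi => (\1_B xi)%:E : \bar R) := measurable_indicE mB.
have ms := @measurable_step R.
have i0 (xi : hpath R) : 0 <= (\1_B xi)%:E :> \bar R by rewrite lee_fin.
have mBs := measurableT_comp mBi ms.
have muB : measurable_fun setT (fun xi => u xi * (\1_B (step xi))%:E).
  exact: emeasurable_funM.
have mcu : measurable_fun setT (fun xi => u xi * c%:E) by exact: emeasurable_funM.
transitivity (\int[nu]_xi (u xi * (\1_B (step xi))%:E)).
  rewrite integral_mkcond; apply: eq_integral => xi _.
  rewrite epatch_indic /=; congr (_ * (_)%:E); rewrite !indicE; congr (_%:R).
  have sB : B (step xi) = B xi by rewrite -[in RHS]BB.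
  by congr nat_of_bool; apply/idP/idP; rewrite !inE sB.
transitivity (\int[nu]_xi (u xi * c%:E)); last first.
  by rewrite ge0_integralZr// muleC.
have p1 xi : 0 <= u xi * (\1_B (step xi))%:E by exact: mule_ge0.
have p2 xi : 0 <= u xi * c%:E by rewrite mule_ge0// lee_fin.
rewrite (nu_fresh muB p1) (nu_fresh mcu p2).
apply: eq_integral => xi _; apply: (etrans (markov_step model _ mu_ u0 au mBi i0)).
by apply: eq_integral => eta _; congr (_ * _); exact: hc.
Qed.

(** A functional of negative mean has partial sums bounded above: the event
    that they are unbounded is invariant, hence independent of the path up to
    the next checkpoint, and the maximal ergodic lemma applies. *)
Lemma bounded_partial_sums (g : hpath R -> R) : adapted g ->
  nu.-integrable setT (EFin \o g) -> \int[nu]_xi (g xi)%:E < 0 ->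
  {ae mu, forall xi, exists K, forall n, (\sum_(i < n) g (iter i step xi) <= K)%R}.
Proof.
move=> ag ig gneg; have ms := @measurable_step R.
pose B := sums_unbounded step g.
have mB : measurable B by exact: measurable_sums_unbounded ms ig.
have BB : step @^-1` B = B by exact: sums_unbounded_invariant.
have [c c0 hc] := invariant_prob_from mB BB.
have nuB : nu B = c%:E.
  rewrite (prob_fresh_start nu_fresh mB) (eq_integral (cst c%:E)).
    exact: (integral_prob_cst nu).
  by move=> xi _; exact: hc.
have mg : measurable_fun setT (EFin \o g) := measurable_int _ ig.
have agp : adapted ((EFin \o g)^\+).
  by move=> x l k xi eta cr h e; rewrite !funeposE /= (ag x l k xi eta cr h e).
have agn : adapted ((EFin \o g)^\-).
  by move=> x l k xi eta cr h e; rewrite !funenegE /= (ag x l k xi eta cr h e).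
have Bg : \int[nu]_(xi in B) (g xi)%:E = nu B * \int[nu]_xi (g xi)%:E.
  rewrite integralE [in RHS]integralE nuB.
  have ip := integral_adapted_invariant (measurable_funepos mg) (funepos_ge0 _) agp mB BB c0 hc.
  have in_ := integral_adapted_invariant (measurable_funeneg mg) (funeneg_ge0 _) agn mB BB c0 hc.
  have fn : - (\int[nu]_xi (EFin \o g)^\- xi) \is a fin_num.
    by rewrite fin_numN; exact: integrable_neg_fin_num.
  by rewrite ip in_ [RHS](muleBr _ (fin_num_adde_defl _ fn)).
have nuB0 := sums_unbounded_null ms nu_step ig Bg gneg.
have c00 : c = 0%R by move: nuB0; rewrite nuB => -[].
have muB : mu B = 0.
  rewrite (prob_fresh_start (fresh_start_path model) mB) (eq_integral (cst 0)) ?integral0//.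
  by move=> xi _; rewrite hc c00.
apply: filterS (measure0_aeN mB muB) => xi /existsNP[K hK].
exists K => n; rewrite (le_trans (le_max_sum step g n xi))// leNgt; apply/negP => h.
by apply: hK; exists n.
Qed.

(** Averages of a nonnegative functional of the chain, from above when its
    mean is finite, and from below in all cases. *)
Lemma averages_le (f : hpath R -> R) (c : R) : adapted f -> measurable_fun setT f ->
  (forall xi, 0 <= f xi)%R -> \int[nu]_xi (f xi)%:E < c%:E ->
  {ae mu, forall xi, exists K, forall n,
    (\sum_(i < n) f (iter i step xi) <= c * n%:R + K)%R}.
Proof.
move=> af mf f0 fc.
have if_ : nu.-integrable setT (EFin \o f).
  apply/integrableP; split; first exact/measurable_EFinP.
  rewrite (eq_integral (EFin \o f)); last by move=> xi _ /=; rewrite ger0_norm.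
  by rewrite (lt_trans fc)// ltry.
have ic : nu.-integrable setT (EFin \o cst c) :=
  finite_measure_integrable_cst nu c measurableT.
pose g xi : R := (f xi - c)%R.
have ig : nu.-integrable setT (EFin \o g).
  by have := integrableB measurableT if_ ic.
have gneg : \int[nu]_xi (g xi)%:E < 0.
  rewrite /g (integralB_EFin measurableT if_ ic) [X in _ - X](integral_prob_cst nu c%:E).
  by rewrite lteBlDr// add0e.
have ag : adapted g by exact: (adapted_comp (fun r : R => r - c)%R af).
apply: filterS (bounded_partial_sums ag ig gneg) => xi [K hK].
exists K => n; have := hK n; rewrite /g sumrB sumr_const card_ord mulr_natr.
by rewrite lerBlDl.
Qed.

Lemma averages_ge (f : hpath R -> R) (c : R) : adapted f -> measurable_fun setT f ->
  (forall xi, 0 <= f xi)%R -> c%:E < \int[nu]_xi (f xi)%:E ->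
  {ae mu, forall xi, exists K, forall n,
    (c * n%:R - K <= \sum_(i < n) f (iter i step xi))%R}.
Proof.
move=> af mf f0 fc.
pose h k xi : R := Num.min (f xi) k%:R.
have mh k : measurable_fun setT (h k) by apply: measurable_minr.
have h0 k xi : (0 <= h k xi)%R by rewrite le_min f0 ler0n.
have [k hk] : exists k, c%:E < \int[nu]_xi (h k xi)%:E.
  have nd xi : {homo (fun k => (h k xi)%:E) : m n / (m <= n)%N >-> m <= n}.
    move=> m n mn; rewrite lee_fin /h le_min !ge_min lexx/=.
    by apply/orP; right; rewrite ler_nat.
  have hcv xi : (fun k => (h k xi)%:E) @ \oo --> (f xi)%:E.
    apply: cvg_near_cst; exists (Num.truncn (f xi)).+1 => // n /= fn.
    by congr EFin; apply: min_l; rewrite (le_trans (ltW (truncnS_gt _)))// ler_nat.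
  have cv : \int[nu]_xi (h k xi)%:E @[k --> \oo] --> \int[nu]_xi (f xi)%:E.
    have mh' k : measurable_fun setT (fun xi => (h k xi)%:E).
      by apply/measurable_EFinP; exact: mh.
    have h0' k eta : [set: hpath R] eta -> 0 <= (h k eta)%:E by rewrite lee_fin.
    rewrite (_ : \int[nu]_xi (f xi)%:E = \int[nu]_xi limn (fun k => (h k xi)%:E)).
      exact: (cvg_monotone_convergence measurableT mh' h0' (fun eta _ => nd eta)).
    by apply: eq_integral => eta _; apply/esym/cvg_lim => //; exact: hcv.
  have [N _ HN] := cv _ (open_ereal_gt' fc).
  by exists N; exact: (HN N (leqnn N)).
have ih : nu.-integrable setT (EFin \o h k).
  apply: (le_integrable measurableT _ _ (finite_measure_integrable_cst nu k%:R measurableT)).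
    by apply/measurable_EFinP; exact: mh.
  by move=> xi _ /=; rewrite lee_fin !ger0_norm// ge_min lexx orbT.
have ic : nu.-integrable setT (EFin \o cst c) :=
  finite_measure_integrable_cst nu c measurableT.
pose g xi : R := (c - h k xi)%R.
have ig : nu.-integrable setT (EFin \o g).
  by have := integrableB measurableT ic ih.
have gneg : \int[nu]_xi (g xi)%:E < 0.
  rewrite /g (integralB_EFin measurableT ic ih) [X in X - _](integral_prob_cst nu c%:E).
  by rewrite lteBlDr ?add0e// (integrable_fin_num measurableT ih).
have ag : adapted g by exact: (adapted_comp (fun r : R => c - Num.min r k%:R)%R af).
apply: filterS (bounded_partial_sums ag ig gneg) => xi [K hK].
exists K => n; have := hK n; rewrite /g sumrB sumr_const card_ord mulr_natr.
rewrite lerBlDr -lerBlDl => /le_trans; apply.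
by apply: ler_sum => i _; rewrite ge_min lexx.
Qed.

End chain_averages.

(** * Means of the ideal and actual times *)

Section means.
Local Open Scope ereal_scope.
Context (R : realType) (F rho : probability R R)
  (Lam : probability (marks R) R) (mu : probability (hpath R) R).
Hypothesis model : path_model F rho Lam mu.
Implicit Types (x z : R) (l : marks R) (xi eta : hpath R).

Local Notation mean := (mean_from mu).

(** Nonnegative versions of the first ideal and actual times: the values are
    only changed on paths that are not good. *)
Definition ideal xi : R := Num.max (first_ideal xi) 0%R.
Definition actual xi : R := Num.max (first_actual xi) 0%R.

Lemma measurable_ideal : measurable_fun setT ideal.
Proof. by apply: measurable_maxr => //; exact: measurable_first_ideal. Qed.

Lemma measurable_actual : measurable_fun setT actual.
Proof. by apply: measurable_maxr => //; exact: measurable_first_actual. Qed.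

Lemma ideal_ge0 xi : (0 <= ideal xi)%R.
Proof. by rewrite le_max lexx orbT. Qed.

Lemma actual_ge0 xi : (0 <= actual xi)%R.
Proof. by rewrite le_max lexx orbT. Qed.

Lemma adapted_ideal : adapted ideal.
Proof. exact: (adapted_comp (fun r => Num.max r 0%R) (@adapted_first_ideal R)). Qed.

Lemma adapted_actual : adapted actual.
Proof. exact: (adapted_comp (fun r => Num.max r 0%R) (@adapted_first_actual R)). Qed.

Lemma idealE xi : good xi -> ideal xi = first_ideal xi.
Proof. by move=> g; rewrite /ideal max_l// first_ideal_ge0. Qed.

Lemma actualE xi : good xi -> actual xi = first_actual xi.
Proof. by move=> g; rewrite /actual max_l// first_actual_ge0. Qed.

Lemma gap_mean_max : \int[F]_y (Num.max y 0)%:E < +oo.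
Proof.
have mid : measurable_fun setT (fun y : R => y%:E : \bar R) by exact/measurable_EFinP.
rewrite (ae_eq_integral (fun y : R => y%:E))//.
- exact: (gap_mean model).
- by apply/measurable_EFinP; exact: measurable_maxr.
- exists [set y : R | (y < 0)%R]; split; [exact: measurable_ltr|exact: (gap_ge0 model)|].
  move=> y /= h; rewrite ltNge; apply/negP => y0; apply: h => _.
  by rewrite max_l.
Qed.

(** Wald's inequality: the event that the level [z] has not been reached by
    the first [k] gaps is independent of the gap number [k]. *)
Lemma wald z :
  \int[mu]_eta (Num.max (Xseq eta (kappa z eta)) 0)%:E <=
  (\int[F]_y (Num.max y 0)%:E) * \int[mu]_eta ((kappa z eta).+1)%:R%:E.
Proof.
pose N k := [set eta : hpath R | forall j, (j < k)%N -> (Xseq eta j.+1 < z)%R].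
have mN k : measurable (N k).
  rewrite (_ : N k = \bigcap_(j in [set j | (j < k)%N]) [set eta | (Xseq eta j.+1 < z)%R]).
    by apply: bigcap_measurableType => j _; apply: measurable_ltr => //; exact: measurable_Xseq.
  by apply/seteqP; split.
have pN k : past k (fun eta => N k eta).
  have sub (xi eta : hpath R) : agree k xi eta -> N k xi -> N k eta.
    move=> h Nk j jk; rewrite -(@pastW _ _ _ _ _ jk (@past_Xseq R j.+1) _ _ h).
    exact: Nk.
  move=> xi eta h; apply/propext; split; first exact: sub.
  by apply: sub => i ik; rewrite h.
have NE eta k : good eta -> N k eta <-> (k <= kappa z eta)%N.
  move=> g; have [zk hk] := good_crosses z g; split => [Nk|kk j jk].
    by rewrite leqNgt; apply/negP => /Nk; rewrite ltNge zk.
  by apply: hk; exact: leq_trans kk.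
pose m := \int[F]_y (Num.max y 0)%:E.
have m0 : 0 <= m by apply: integral_ge0 => y _; rewrite lee_fin le_max lexx orbT.
have mfin : m \is a fin_num by rewrite ge0_fin_numE// gap_mean_max.
have mmax : measurable_fun setT (fun y : R => (Num.max y 0)%:E : \bar R).
  by apply/measurable_EFinP; exact: measurable_maxr.
have max0 (y : R) : 0 <= (Num.max y 0)%:E :> \bar R by rewrite lee_fin le_max lexx orbT.
have mk := @measurable_kappa_path R z.
pose D k eta : \bar R := (Num.max (Dseq eta k) 0)%:E * (\1_(N k) eta)%:E.
have mD k : measurable_fun setT (D k).
  apply: emeasurable_funM; first exact: (measurableT_comp mmax (measurable_Dseq k)).
  exact: measurable_indicE.
have D0 k eta : 0 <= D k eta by apply: mule_ge0; rewrite // lee_fin.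
apply: (@le_trans _ _ (\int[mu]_eta \sum_(k <oo) D k eta)).
  apply: ae_ge0_le_integral => //.
  - apply/measurable_EFinP; apply: measurable_maxr => //.
    apply: (measurable_nat_index (f := fun k (eta : hpath R) => Xseq eta k) mk) => k.
    exact: measurable_Xseq.
  - by move=> eta _; apply: nneseries_ge0.
  - by apply: ge0_emeasurable_sum => //.
  apply: filterS (good_ae model) => eta g _.
  rewrite (_ : Num.max _ _ = Xseq eta (kappa z eta)); last first.
    by apply: max_l; rewrite -[leLHS](Xseq0 eta); exact: Xseq_nondecreasing.
  apply: (@le_trans _ _ (\sum_(0 <= k < kappa z eta) D k eta)); last first.
    exact: nneseries_lim_ge.
  rewrite /Xseq -sumEFin big_mkord; apply: lee_sum => k _.
  rewrite /D indicE mem_set; last by apply/NE => //; exact: ltnW.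
  by rewrite mule1 lee_fin le_max lexx.
rewrite integral_nneseries//.
rewrite (eq_eseriesr (g := fun k => m * mu (N k))); last first.
  move=> k _; rewrite muleC -(integral_past_gap model (mN k) (pN k) mmax max0).
  by rewrite [RHS]integral_mkcond epatch_indic.
rewrite -/m -(fineK mfin) nneseriesZl//; apply: lee_wpmul2l; first by rewrite fineK.
have NI k : mu (N k) = \int[mu]_eta (\1_(N k) eta)%:E by rewrite integral_indic// setIT.
rewrite (eq_eseriesr (fun k _ => NI k)) -integral_nneseries//; last first.
  by move=> k; exact: measurable_indicE.
apply: ae_ge0_le_integral => //.
- by move=> eta _; apply: nneseries_ge0 => k _ _; rewrite lee_fin.
- by apply: ge0_emeasurable_sum => [k eta _ _|k _]; [rewrite lee_fin|exact: measurable_indicE].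
- apply/measurable_EFinP; apply: (measurable_nat_index (f := fun k (_ : hpath R) => k.+1%:R : R) mk).
  by move=> k; exact: measurable_cst.
apply: filterS (good_ae model) => eta g _.
rewrite (nneseries_split 0 (kappa z eta).+1); last by move=> k _; rewrite lee_fin.
rewrite add0n [X in _ + X]eseries0 ?adde0.
  rewrite sumEFin lee_fin big_mkord.
  apply: (@le_trans _ _ (\sum_(i < (kappa z eta).+1) 1)%R).
    by apply: ler_sum => i _; rewrite indicE; case: (_ \in _).
  by rewrite sumr_const card_ord.
move=> k kk _; rewrite indicE memNset// => /(NE _ _ g).
by rewrite leqNgt kk.
Qed.

(** Number of gaps between the gap after the origin and the one around the
    first failure, counted along the path. *)
Definition passage xi : nat := kappa (Zseq xi 0) (sshift 1 xi).

Lemma nat_measurable_passage : nat_measurable passage.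
Proof.
apply: (nat_measurable_comp (f := fun xi : hpath R => (Zseq xi 0, sshift 1 xi : hpath R)) _
  (@measurable_kappa R)).
apply: measurable_fun_pair; [exact: measurable_Zseq|exact: measurable_sshift].
Qed.

Lemma measurable_passage : measurable_fun setT (fun xi => (passage xi)%:R%:E : \bar R).
Proof.
by apply/measurable_EFinP; exact: (measurable_fun_natr nat_measurable_passage).
Qed.

Lemma mean_ideal_le x : mean (EFin \o ideal) x <=
  (Num.max x 0)%:E + (\int[F]_y (Num.max y 0)%:E) * (mean (fun xi => (passage xi)%:R%:E) x + 1).
Proof.
have mi : measurable_fun setT (EFin \o ideal) by apply/measurable_EFinP; exact: measurable_ideal.
have mp := measurable_passage.
have p0 xi : 0 <= (passage xi)%:R%:E :> \bar R by rewrite lee_fin.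
set m := \int[F]_y _.
have m0 : 0 <= m by apply: integral_ge0 => y _; rewrite lee_fin le_max lexx orbT.
have mfin : m \is a fin_num by rewrite ge0_fin_numE// gap_mean_max.
rewrite (mean_fromE model); [|exact: mi|by move=> xi; rewrite lee_fin ideal_ge0].
have mS : measurable_fun setT (fun xi : hpath R => (passage xi).+1%:R%:E : \bar R).
  apply/measurable_EFinP.
  exact: (measurable_nat_index (f := fun k (_ : hpath R) => k.+1%:R : R) nat_measurable_passage).
have S0 (xi : hpath R) : 0 <= (passage xi).+1%:R%:E :> \bar R by rewrite lee_fin.
have mSl := measurable_integral_start_marks mu x mS S0.
have x0 : 0 <= (Num.max x 0)%:E :> \bar R by rewrite lee_fin le_max lexx orbT.
apply: (@le_trans _ _ (\int[Lam]_l ((Num.max x 0)%:E +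
    m * \int[mu]_eta (passage (start x l eta)).+1%:R%:E))); last first.
  have mS0 l : 0 <= m * \int[mu]_eta (passage (start x l eta)).+1%:R%:E.
    by apply: mule_ge0 => //; exact: integral_ge0.
  rewrite (ge0_integralD Lam measurableT (fun _ _ => x0) (measurable_cst _) (fun l _ => mS0 l)
    (emeasurable_funM (measurable_cst m) mSl)).
  rewrite (integral_prob_cst Lam (Num.max x 0)%:E); apply: leeD => //.
  have S0l (l : marks R) : 0 <= \int[mu]_eta (passage (start x l eta)).+1%:R%:E by exact: integral_ge0.
  rewrite (ge0_integralZl Lam measurableT mSl (fun l _ => S0l l) m0).
  apply: lee_wpmul2l => //.
  rewrite -(mean_fromE model x mS S0) -[X in _ <= _ + X](integral_prob_cst mu 1).
  have mpx := measurableT_comp mp (measurable_with_gap_path x).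
  rewrite -(ge0_integralD mu measurableT (fun _ _ => p0 _) mpx (fun _ _ => lee01) (measurable_cst 1)).
  apply: (ge0_le_integral mu measurableT (fun _ _ => S0 _)
    (measurableT_comp mS (measurable_with_gap_path x)) (emeasurable_funD mpx (measurable_cst 1))).
  by move=> xi _; rewrite -EFinD lee_fin -natr1.
have i0 xi : 0 <= (EFin \o ideal) xi by rewrite lee_fin ideal_ge0.
have i0l (l : marks R) : 0 <= \int[mu]_eta (EFin \o ideal) (start x l eta) by exact: integral_ge0.
apply: (ge0_le_integral Lam measurableT (fun l _ => i0l l)
  (measurable_integral_start_marks mu x mi i0)
  (emeasurable_funD (measurable_cst _) (emeasurable_funM (measurable_cst m) mSl))).
move=> l _.
apply: (@le_trans _ _ ((Num.max x 0)%:E +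
  \int[mu]_eta (Num.max (Xseq eta (kappa (residual x l) eta)) 0)%:E)); last first.
  by apply: leeD => //; exact: wald.
have mX : measurable_fun setT (fun eta =>
    (Num.max (Xseq eta (kappa (residual x l) eta)) 0)%:E : \bar R).
  apply/measurable_EFinP; apply: measurable_maxr => //.
  apply: (measurable_nat_index (f := fun k (eta : hpath R) => Xseq eta k)
    (@measurable_kappa_path R _)) => k; exact: measurable_Xseq.
have X0 eta : 0 <= (Num.max (Xseq eta (kappa (residual x l) eta)) 0)%:E :> \bar R.
  by rewrite lee_fin le_max lexx orbT.
rewrite -(integral_prob_cst mu (Num.max x 0)%:E).
rewrite -(ge0_integralD mu measurableT (fun _ _ => x0) (measurable_cst _) (fun eta _ => X0 eta) mX).
apply: (ge0_le_integral mu measurableT (fun eta _ => i0 _)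
  (measurableT_comp mi (measurable_start_path x l)) (emeasurable_funD (measurable_cst _) mX)).
move=> eta _; rewrite -EFinD lee_fin /ideal /first_ideal.
rewrite -[sshift 1 _]/eta Zseq_start -[Dseq _ 0]/x.
rewrite ge_max addr_ge0 ?andbT ?le_max ?lexx ?orbT//.
by apply: lerD; rewrite le_max lexx.
Qed.

Lemma ideal_mean_fin (pi : probability R R) :
  \int[pi]_x (Num.max x 0)%:E < +oo ->
  \int[pi]_x mean (fun xi => (passage xi)%:R%:E) x < +oo ->
  \int[pi]_x mean (EFin \o ideal) x < +oo.
Proof.
move=> pix pik.
have mi : measurable_fun setT (EFin \o ideal) by apply/measurable_EFinP; exact: measurable_ideal.
have i0 xi : 0 <= (EFin \o ideal) xi by rewrite lee_fin ideal_ge0.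
have mp := measurable_passage.
have p0 xi : 0 <= (passage xi)%:R%:E :> \bar R by rewrite lee_fin.
have mmp := measurable_mean_from mu mp p0.
have mp0 x : 0 <= mean (fun xi => (passage xi)%:R%:E) x by exact: mean_from_ge0.
have mx : measurable_fun setT (fun x : R => (Num.max x 0)%:E : \bar R).
  by apply/measurable_EFinP; exact: measurable_maxr.
have x0 (x : R) : 0 <= (Num.max x 0)%:E :> \bar R by rewrite lee_fin le_max lexx orbT.
have m0 : 0 <= \int[F]_y (Num.max y 0)%:E by apply: integral_ge0 => y _; exact: x0.
have mfin : \int[F]_y (Num.max y 0)%:E \is a fin_num by rewrite ge0_fin_numE// gap_mean_max.
have mp1 : measurable_fun setT (fun x => mean (fun xi => (passage xi)%:R%:E) x + 1).
  by apply: emeasurable_funD => //; exact: measurable_cst.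
have mp10 x : 0 <= mean (fun xi => (passage xi)%:R%:E) x + 1 by exact: adde_ge0.
apply: (@le_lt_trans _ _ (\int[pi]_x ((Num.max x 0)%:E +
   (\int[F]_y (Num.max y 0)%:E) * (mean (fun xi => (passage xi)%:R%:E) x + 1)))).
  apply: (ge0_le_integral pi measurableT (fun _ _ => mean_from_ge0 mu _ i0)
    (measurable_mean_from mu mi i0)
    (emeasurable_funD mx (emeasurable_funM (measurable_cst _) mp1))).
  by move=> x _; exact: mean_ideal_le.
rewrite (ge0_integralD pi measurableT (fun x _ => x0 x) mx (fun x _ => mule_ge0 m0 (mp10 x))
  (emeasurable_funM (measurable_cst _) mp1)).
rewrite lte_add_pinfty// (ge0_integralZl pi measurableT mp1 (fun x _ => mp10 x) m0).
rewrite (ge0_integralD pi measurableT (fun x _ => mp0 x) mmp (fun _ _ => lee01) (measurable_cst 1)).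
rewrite (integral_prob_cst pi 1) -(fineK mfin) lte_mul_pinfty//; first by rewrite lee_fin fine_ge0.
by rewrite lte_add_pinfty// ltry.
Qed.

(** The number of attempts is geometric with success probability
    [rho [set a | x < a]], and each attempt costs at least 1 with a fixed
    probability. *)
Lemma mean_actual_ge : exists2 p : R, (0 < p)%R & forall x,
  p%:E <= mean (EFin \o actual) x * rho [set a | (x < a)%R].
Proof.
pose J := [set a : R | (1 < a)%R].
have mJ : measurable J by exact: measurable_ltr.
have Jfin : rho J \is a fin_num by rewrite fin_num_measure.
exists (fine (rho J)).
  by rewrite -lte_fin fineK//; exact: (mark_tail model).
move=> x; rewrite fineK//.
have ma : measurable_fun setT (EFin \o actual) by apply/measurable_EFinP; exact: measurable_actual.
have a0 xi : 0 <= (EFin \o actual) xi by rewrite lee_fin actual_ge0.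
pose G := [set a : R | (x < a)%R].
have mG : measurable G by exact: measurable_ltr.
pose H i := [set l : marks R | forall j, (j < i)%N -> (l j <= x)%R].
have mH i : measurable (H i).
  rewrite (_ : H i = \bigcap_(j in [set j | (j < i)%N]) [set l : marks R | (l j <= x)%R]).
    apply: bigcap_measurableType => j _; apply: measurable_ler => //.
    exact: (measurable_coord (I := nat) j).
  by apply/seteqP; split.
have subH i (l l' : marks R) : agree i l l' -> H i l -> H i l'.
  by move=> h Hl j ji; rewrite -h//; exact: Hl.
have pH i : past i (fun l => (\1_(H i) l)%:E : \bar R).
  move=> l l' h; rewrite !indicE; congr (_%:R%:E); congr nat_of_bool.
  by apply/idP/idP; rewrite !inE; apply: subH => // j ji; rewrite h.
have HA i (A : set R) : measurable A ->
    Lam (H i `&` [set l | A (l i)]) = rho A * Lam (H i).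
  move=> mA; have mAi : measurable [set l : marks R | A (l i)].
    exact: (measurable_preimage (measurable_coord (I := nat) i) mA).
  have m1 : measurable_fun setT (fun l : marks R => (\1_A (l 0%N))%:E : \bar R).
    exact: (measurableT_comp (measurable_indicE mA) (measurable_coord 0%N)).
  have i1 (l : marks R) : 0 <= (\1_A (l 0%N))%:E :> \bar R by rewrite lee_fin.
  have i2 (l : marks R) : 0 <= (\1_(H i) l)%:E :> \bar R by rewrite lee_fin.
  have mHi : measurable_fun setT (fun l => (\1_(H i) l)%:E : \bar R) := measurable_indicE (mH i).
  have := iid_fresh (marks_law model) mHi i2 (pH i) m1 i1.
  rewrite integral_indic// setIT (iid_marginal (marks_law model) 0 (measurable_indicE mA)); last first.
    by move=> a; rewrite lee_fin.
  rewrite integral_indic// setIT muleC => <-.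
  transitivity (\int[Lam]_l (\1_(H i `&` [set l | A (l i)]) l)%:E).
    by rewrite integral_indic ?setIT//; exact: measurableI.
  apply: eq_integral => l _; rewrite indicI /= EFinM; congr (_ * _).
  by rewrite (_ : sshift i l 0%N = l i)//; rewrite /sshift addn0.
pose v := \sum_(i <oo) Lam (H i).
have v0 : 0 <= v by exact: nneseries_ge0.
have mHA i (A : set R) : measurable A -> measurable (H i `&` [set l | A (l i)]).
  move=> mA; apply: measurableI => //.
  exact: (measurable_preimage (measurable_coord (I := nat) i) mA).
have sumE (A : set R) : measurable A ->
    \sum_(i <oo) Lam (H i `&` [set l | A (l i)]) = rho A * v.
  move=> mA; have Af : rho A \is a fin_num by rewrite fin_num_measure.
  by rewrite (eq_eseriesr (fun i _ => HA i A mA)) -(fineK Af) nneseriesZl.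
have feP l : (exists j, (x < l j)%R) -> forall i, H i l <-> (i < first_exceed x l)%N.
  move=> /first_exceedP[h0 h1 h2] i; split=> [Hi|il j ji].
    rewrite ltnNge; apply/negP => il; have := Hi (first_exceed x l).-1.
    by rewrite prednK// => /(_ il); rewrite leNgt h1.
  by apply: h2; rewrite (leq_trans ji)// -ltnS prednK.
have v1 : 1 <= v * rho G.
  rewrite muleC -sumE// -(probability_setT Lam).
  apply: (@le_trans _ _ (Lam (\bigcup_i (H i `&` [set l | G (l i)])))).
    apply: ae_le_measure => //; first by apply: bigcup_measurable => i _; exact: mHA.
    apply: filterS (good_marks_ae model) => l [_ /(_ x) loo] _.
    have [h0 h1 h2] := first_exceedP loo.
    by exists (first_exceed x l).-1.
  apply: measure_sigma_subadditive => //; first by move=> i; exact: mHA.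
  by apply: bigcup_measurable => i _; exact: mHA.
have vJ : rho J * v <= mean (EFin \o actual) x.
  rewrite -sumE// (mean_fromE model x ma a0).
  have HI i : Lam (H i `&` [set l | J (l i)]) =
      \int[Lam]_l (\1_(H i `&` [set l | J (l i)]) l)%:E.
    by rewrite integral_indic ?setIT//; exact: mHA.
  rewrite (eq_eseriesr (fun i _ => HI i)) -integral_nneseries//; last first.
    by move=> i; apply: measurable_indicE; exact: mHA.
  have mse : measurable_fun setT (fun l : marks R =>
      \sum_(i <oo) (\1_(H i `&` [set l | J (l i)]) l)%:E : \bar R).
    apply: ge0_emeasurable_sum => [i l _ _|i _]; first by rewrite lee_fin.
    by apply: measurable_indicE; exact: mHA.
  have a0l (l : marks R) : 0 <= \int[mu]_eta (EFin \o actual) (start x l eta) by exact: integral_ge0.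
  apply: (ae_ge0_le_integral measurableT _ mse (fun l _ => a0l l)
    (measurable_integral_start_marks mu x ma a0)).
    by move=> l _; apply: nneseries_ge0 => i _ _; rewrite lee_fin.
  apply: filterS (good_marks_ae model) => l [l0 /(_ x) loo] _.
  rewrite [leRHS](integral_prob_cst mu (Num.max (\sum_(i < first_exceed x l) l i) 0)%:E).
  rewrite (nneseries_split 0 (first_exceed x l)); last by move=> i _; rewrite lee_fin.
  rewrite add0n [X in _ + X]eseries0 ?adde0; last first.
    move=> i il _; rewrite indicE memNset// => -[/(feP _ loo)].
    by rewrite ltnNge il.
  rewrite sumEFin lee_fin le_max; apply/orP; left; rewrite big_mkord.
  apply: ler_sum => i _; rewrite indicE; case: (boolP (_ \in _)) => [|_]; last exact: l0.
  by rewrite inE => -[_ /=] /ltW.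
apply: (@le_trans _ _ (rho J * v * rho G)).
  rewrite -muleA -[leLHS]mule1; apply: lee_wpmul2l => //.
exact: lee_wpmul2r.
Qed.

Lemma mean_actual_gt0 (pi : probability R R) : 0 < \int[pi]_x mean (EFin \o actual) x.
Proof.
have [p p0 hp] := mean_actual_ge.
have ma : measurable_fun setT (EFin \o actual) by apply/measurable_EFinP; exact: measurable_actual.
have a0 xi : 0 <= (EFin \o actual) xi by rewrite lee_fin actual_ge0.
have m0 x : 0 <= mean (EFin \o actual) x by exact: mean_from_ge0.
apply: (@lt_le_trans _ _ p%:E) => //.
rewrite -[leLHS](integral_prob_cst pi); apply: ge0_le_integral => //.
- by move=> x _; rewrite lee_fin ltW.
- exact: measurable_mean_from.
move=> x _; apply: (le_trans (hp x)); rewrite -[leRHS]mule1.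
by apply: lee_wpmul2l => //; apply: probability_le1; exact: measurable_ltr.
Qed.

(** If the gap at the checkpoints has the heavier tail, the mean number of
    attempts is infinite: the gaps above any level contribute at least a fixed
    amount to the mean actual time. *)
Lemma mean_actual_infinite (pi : probability R R) (z0 : R) :
  (forall z, (z0 <= z)%R -> rho [set a | (z < a)%R] <= pi [set y | (z < y)%R]) ->
  \int[pi]_x mean (EFin \o actual) x = +oo.
Proof.
move=> tail; have [p p0 hp] := mean_actual_ge.
have ma : measurable_fun setT (EFin \o actual) by apply/measurable_EFinP; exact: measurable_actual.
have a0 xi : 0 <= (EFin \o actual) xi by rewrite lee_fin actual_ge0.
have m0 x : 0 <= mean (EFin \o actual) x by exact: mean_from_ge0.
have mm := measurable_mean_from mu ma a0.
apply/eqP; rewrite -leye_eq leNgt; apply/negP => fin.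
have im : pi.-integrable setT (mean (EFin \o actual)).
  apply/integrableP; split => //.
  by rewrite (eq_integral (mean (EFin \o actual)))// => x _; rewrite gee0_abs.
pose A n := [set y : R | (n%:R < y)%R].
have mA n : measurable (A n) by exact: measurable_ltr.
have Aout y : exists n0, forall n, (n0 <= n)%N -> ~ A n y.
  exists (Num.truncn y).+1 => n yn; apply/negP; rewrite /A/= -leNgt.
  by rewrite (le_trans (ltW (truncnS_gt y)))// ler_nat.
have [N _ HN] := tail_integral_small im mA Aout p0.
pose n := maxn N (Num.truncn z0).+1.
have := HN n (leq_maxl _ _); rewrite ltNge => /negP; apply.
have nz : (z0 <= n%:R)%R.
  by rewrite (le_trans (ltW (truncnS_gt _)))// ler_nat leq_maxr.
pose g := rho [set a | (n%:R < a)%R].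
have g0 : 0 < g := mark_tail model n%:R.
have gfin : g \is a fin_num by rewrite fin_num_measure//; exact: measurable_ltr.
rewrite -(lee_pmul2r gfin g0).
apply: (@le_trans _ _ (p%:E * pi (A n))).
  by apply: lee_wpmul2l; [rewrite lee_fin ltW|exact: tail].
rewrite -ge0_integralZr//; [|exact: (measurable_funTS mm)|exact: ltW].
rewrite -(integral_cst pi (mA n)).
apply: (ge0_le_integral pi (mA n) _ (measurable_cst _)
  (emeasurable_funM (measurable_funTS mm) (measurable_cst _))).
  by move=> x _; rewrite lee_fin ltW.
move=> x nx; apply: (le_trans (hp x)); apply: lee_wpmul2l => //.
apply: le_measure; rewrite ?inE; [exact: measurable_ltr|exact: measurable_ltr|].
by move=> a /=; exact: lt_trans.
Qed.

End means.

Lemma iid_seq_box d (T : measurableType d) (R : realType) (w : probability T R)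
    (mu : probability (seqspace nat T) R) n (A : nat -> set T) :
  iid_law w mu -> (forall i, measurable (A i)) ->
  (mu (seq_box n.+1 A) = w (A 0%N) * mu (seq_box n (fun i => A i.+1)))%E.
Proof.
move=> iidmu mA; set B := seq_box n _; set C := seq_box n.+1 _.
have mC : measurable C by exact: measurable_seq_box.
have mB : measurable B by exact: measurable_seq_box.
have mCi : measurable_fun setT (fun x : seqspace nat T => (\1_C x)%:E : \bar R).
  exact: measurable_indicE.
have mAi : measurable_fun setT (fun t : T => (\1_(A 0%N) t)%:E : \bar R).
  exact: measurable_indicE.
have -> : mu C = (\int[mu]_x (\1_C x)%:E)%E by rewrite integral_indic// setIT.
rewrite (iidmu _ mCi); last by move=> x; rewrite lee_fin.
have -> : w (A 0%N) = (\int[w]_t (\1_(A 0%N) t)%:E)%E by rewrite integral_indic// setIT.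
rewrite -ge0_integralZr//.
apply: eq_integral => t _.
have -> : mu B = (\int[mu]_x (\1_B x)%:E)%E by rewrite integral_indic// setIT.
rewrite -ge0_integralZl//; last exact: measurable_indicE.
apply: eq_integral => x _; rewrite -EFinM !indicE -natrM mulnb.
congr (_%:R%:E); congr nat_of_bool.
apply/idP/andP => [/set_mem h|[/set_mem h0 /set_mem h]].
  split; apply: mem_set; first exact: (h 0%N isT).
  by move=> i ni; exact: (h i.+1 ni).
by apply: mem_set => -[|i] ni //; exact: h.
Qed.

(** * The sequence of all attempts *)

Section attempts.
Context (R : realType).
Implicit Types (x : R) (l : marks R) (xi eta : hpath R).

(** One attempt: a failure before the end of the gap consumes one mark; a mark
    longer than the gap leads to the next checkpoint. *)
Definition attempt xi : hpath R :=
  let eta := sshift 1 xi in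
  if Dseq xi 0 < Lseq xi 0 0 then sshift (kappa (Lseq xi 0 0 - Dseq xi 0) eta) eta
  else with_mark (sshift 1 (Lseq xi 0)) xi.

(** The durations of the successive attempts, at all checkpoints. *)
Definition attempt_marks xi : marks R := fun j => Lseq (iter j attempt xi) 0 0.

Lemma measurable_attempt : measurable_fun setT attempt.
Proof.
apply: measurable_fun_ifT.
- by apply: measurable_fun_ltr; [exact: measurable_Dseq|exact: measurable_mark].
- apply: measurable_sshift_index; last exact: measurable_sshift.
  apply: (nat_measurable_comp
    (f := fun xi : hpath R => (Lseq xi 0 0 - Dseq xi 0, sshift 1 xi : hpath R)) _
    (@measurable_kappa R)).
  apply: measurable_fun_pair; last exact: measurable_sshift.
  by apply: measurable_funB; [exact: measurable_mark|exact: measurable_Dseq].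
- apply: (measurableT_comp (@measurable_with_mark R)
    (g := fun xi : hpath R => (sshift 1 (Lseq xi 0) : marks R, xi))).
  apply: measurable_fun_pair => //.
  exact: (measurableT_comp (measurable_sshift 1) (measurable_Lseq 0)).
Qed.

Lemma measurable_attempt_marks : measurable_fun setT attempt_marks.
Proof.
apply: measurable_fun_seqspace => j.
apply: (measurableT_comp (measurable_mark 0 0)).
elim: j => [|j IH]; first exact: measurable_id.
by have := measurableT_comp measurable_attempt IH.
Qed.

Lemma attempt_marks_scons xi :
  attempt_marks xi = scons (Lseq xi 0 0) (attempt_marks (attempt xi)).
Proof. by apply/funext => -[|j] //; rewrite /attempt_marks iterSr. Qed.

Lemma iter_attempt i xi : (i < tau xi 0)%N -> (exists j, Dseq xi 0 < Lseq xi 0 j) ->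
  iter i attempt xi = with_mark (sshift i (Lseq xi 0)) xi.
Proof.
move=> + h; have [t0 tx tl] := first_exceedP h.
elim: i => [|i IH] it.
  by apply/funext => -[|j] //=; rewrite /Lseq; case: (xi 0%N).
rewrite iterS IH ?(ltnW it)// /attempt.
rewrite -[Dseq (with_mark _ _) 0]/(Dseq xi 0) -[Lseq (with_mark _ _) 0]/(sshift i (Lseq xi 0)).
rewrite ifF; last first.
  apply/negbTE; rewrite -leNgt /sshift addn0; apply: tl.
  by rewrite -ltnS prednK.
by rewrite sshiftD addn1.
Qed.

Lemma attempt_marksE i xi : (i < tau xi 0)%N -> (exists j, Dseq xi 0 < Lseq xi 0 j) ->
  attempt_marks xi i = Lseq xi 0 i.
Proof. by move=> it h; rewrite /attempt_marks iter_attempt// /with_mark /Lseq /= /sshift addn0. Qed.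

Lemma iter_attempt_tau xi : (exists j, Dseq xi 0 < Lseq xi 0 j) ->
  iter (tau xi 0) attempt xi = step xi.
Proof.
move=> h; have [t0 tx tl] := first_exceedP h.
have tE : tau xi 0 = (tau xi 0).-1.+1 by rewrite prednK.
rewrite tE iterS iter_attempt//; last by rewrite [X in (_ < X)%N]tE.
rewrite /attempt.
rewrite -[Dseq (with_mark _ _) 0]/(Dseq xi 0).
rewrite -[Lseq (with_mark _ _) 0]/(sshift (tau xi 0).-1 (Lseq xi 0)).
by rewrite /sshift addn0 ifT.
Qed.

Lemma attempts_concat N xi : good xi -> exists J, iter J attempt xi = iter N step xi /\
  forall g : R -> R, \sum_(j < J) g (attempt_marks xi j) =
    \sum_(n < N) \sum_(i < tau (iter n step xi) 0) g (Lseq (iter n step xi) 0 i).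
Proof.
move=> gxi; elim: N => [|N [J [JE JS]]]; first by exists 0%N; split=> // g; rewrite !big_ord0.
set eta := iter N step xi in JE.
have geta : good eta by exact: good_iter_step.
have h : exists j, Dseq eta 0 < Lseq eta 0 j by case: geta => _ _ _; exact.
exists (tau eta 0 + J)%N; split; first by rewrite iterD JE iter_attempt_tau.
move=> g; rewrite big_ord_recr /= -JS addnC big_split_ord /=; congr (_ + _).
apply: eq_bigr => i _; congr g.
rewrite -[RHS](attempt_marksE (ltn_ord i) h).
by rewrite /attempt_marks addnC iterD JE.
Qed.

End attempts.

Arguments attempt {R} _.
Arguments attempt_marks {R} _.

Section attempts_law.
Local Open Scope ereal_scope.
Context (R : realType) (F rho : probability R R)
  (Lam : probability (marks R) R) (mu : probability (hpath R) R).
Hypothesis model : path_model F rho Lam mu.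
Implicit Types (x : R) (l : marks R) (xi eta : hpath R) (D : set (hpath R)).

Local Notation mean := (mean_from mu).
Local Notation prob_from := (prob_from mu).

Lemma prob_from_attempt D (A : set R) (c : \bar R) x : measurable D -> measurable A ->
  0 <= c -> (forall y, prob_from D y = c) ->
  prob_from ([set xi : hpath R | A (Lseq xi 0%N 0%N)] `&` attempt @^-1` D) x = rho A * c.
Proof.
move=> mD mA c0 hc; set E := _ `&` _.
have mE : measurable E.
  apply: measurableI; first exact: (measurable_preimage (measurable_mark 0%N 0%N) mA).
  exact: (measurable_preimage (@measurable_attempt R) mD).
have mEi : measurable_fun setT (fun xi => (\1_E xi)%:E : \bar R) := measurable_indicE mE.
have E0 xi : 0 <= (\1_E xi)%:E :> \bar R by rewrite lee_fin.
have mDi : measurable_fun setT (fun xi => (\1_D xi)%:E : \bar R) := measurable_indicE mD.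
have D0 xi : 0 <= (\1_D xi)%:E :> \bar R by rewrite lee_fin.
rewrite /prob_from (mean_fromE model x mEi E0) (marks_law model); last 2 first.
- exact: (measurable_integral_start_marks mu x mEi E0).
- by move=> l; exact: integral_ge0.
rewrite (eq_integral (fun a => (\1_A a)%:E * c)).
  rewrite ge0_integralZr//; last exact: measurable_indicE.
  by rewrite integral_indic// setIT.
move=> a _.
have EE l eta : (\1_E (start x (scons a l) eta))%:E = (\1_A a)%:E *
   (\1_D (if (x < a)%R then sshift (kappa (a - x) eta) eta else start x l eta))%:E :> \bar R.
  rewrite -EFinM !indicE -natrM mulnb; congr (_%:R%:E); congr nat_of_bool.
  by apply/idP/andP => [/set_mem[Aa Da]|[/set_mem Aa /set_mem Da]];
    [split; exact: mem_set|apply: mem_set; split].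
transitivity (\int[Lam]_l ((\1_A a)%:E * \int[mu]_eta
   (\1_D (if (x < a)%R then sshift (kappa (a - x) eta) eta else start x l eta))%:E)).
  apply: eq_integral => l _; pose h (eta : hpath R) : \bar R :=
    (\1_D (if (x < a)%R then sshift (kappa (a - x) eta) eta else start x l eta))%:E.
  have mh : measurable_fun setT h.
    rewrite /h; case: (x < a)%R; last exact: (measurableT_comp mDi (measurable_start_path x l)).
    have mk := @measurable_kappa_path R (a - x)%R.
    exact: (measurableT_comp mDi (measurable_sshift_index mk (@measurable_id _ _ setT))).
  have h0 eta : setT eta -> 0 <= h eta by rewrite lee_fin.
  have a0 : 0 <= (\1_A a)%:E :> \bar R by rewrite lee_fin.
  transitivity (\int[mu]_eta ((\1_A a)%:E * h eta)).
    by apply: eq_integral => eta _; exact: EE.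
  exact: (ge0_integralZl mu measurableT mh h0 a0).
case: (ltP x a) => xa.
  have K : \int[mu]_eta (\1_D (sshift (kappa (a - x) eta) eta))%:E = c.
    have m1 : measurable_fun setT (cst 1 : hpath R -> \bar R) by exact: measurable_cst.
    have o0 (xi : hpath R) : 0 <= (cst 1 : hpath R -> \bar R) xi by [].
    have s1 : stopped (a - x) (cst 1 : hpath R -> \bar R) by [].
    have := markov_kappa model m1 o0 s1 mDi D0.
    rewrite (eq_integral (fun eta => (\1_D (sshift (kappa (a - x) eta) eta))%:E)); last first.
      by move=> eta _; rewrite mul1e.
    move=> ->; rewrite (eq_integral (cst c)); first exact: (integral_prob_cst mu).
    by move=> eta _; rewrite mul1e; exact: hc.
  by rewrite K; exact: (integral_prob_cst Lam).
rewrite ge0_integralZl//; last 2 first.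
- exact: (measurable_integral_start_marks mu x mDi D0).
- by move=> l _; exact: integral_ge0.
by congr (_ * _); rewrite -(mean_fromE model x mDi D0); exact: hc.
Qed.

(** Whatever the first gap, the attempts form an i.i.d. sequence: each of them
    uses a fresh mark. *)
Lemma attempt_marks_law (C : set (marks R)) x : measurable C ->
  prob_from (attempt_marks @^-1` C) x = Lam C.
Proof.
move=> mC; have mpsi := @measurable_attempt_marks R.
pose nu := image_law (image_law mu (measurable_with_gap_path x)) mpsi.
have nuE B : measurable B -> nu B = prob_from (attempt_marks @^-1` B) x.
  move=> mB; have mpB := measurable_preimage mpsi mB.
  have mpi : measurable_fun setT (fun xi => (\1_(attempt_marks @^-1` B) xi)%:E : \bar R).
    exact: measurable_indicE.
  have p0 xi : 0 <= (\1_(attempt_marks @^-1` B) xi)%:E :> \bar R by rewrite lee_fin.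
  rewrite /prob_from /mean_from -(integral_image_law mu (measurable_with_gap_path x) mpi p0).
  by rewrite integral_indic// setIT.
have GE : @measurable _ R = <<s measurable>> by exact/esym/sigma_algebra_id/sigma_algebra_measurable.
rewrite -nuE//; apply: (seq_law_unique GE) => //.
  by move=> A B; exact: measurableI.
move=> n A mA; rewrite nuE; last exact: measurable_seq_box.
move: {C mC nu nuE} x; elim: n A mA => [|n IH] A mA x.
  rewrite (_ : seq_box 0 A = setT); last by apply/seteqP; split.
  rewrite preimage_setT probability_setT.
  rewrite /prob_from /mean_from (eq_integral (cst 1)); last by move=> xi _; rewrite indicT.
  exact: (integral_prob_cst mu 1).
have mB : measurable (seq_box n (fun i => A i.+1)) by exact: measurable_seq_box.
rewrite (_ : _ @^-1` _ = [set xi : hpath R | A 0%N (Lseq xi 0%N 0%N)] `&`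
    attempt @^-1` (attempt_marks @^-1` seq_box n (fun i => A i.+1))); last first.
  apply/seteqP; split => xi.
    move=> h; split; first exact: (h 0%N isT).
    by move=> i ni; have := h i.+1 ni; rewrite attempt_marks_scons.
  by move=> [h0 h] [|i]//= ni; rewrite attempt_marks_scons; exact: h.
rewrite (prob_from_attempt x (measurable_preimage mpsi mB) (mA 0%N) _ (IH _ _)) => //.
by rewrite (iid_seq_box n (marks_law model) mA).
Qed.

(** A function of one mark with a negative mean has bounded sums over the
    attempts. *)
Lemma attempts_bounded_sums (g : R -> R) : rho.-integrable setT (EFin \o g) ->
  \int[rho]_a (g a)%:E < 0 ->
  {ae mu, forall xi, exists K, forall n, (\sum_(i < n) g (attempt_marks xi i) <= K)%R}.
Proof.
move=> ig gneg; have iidL := marks_law model.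
pose g0 (l : marks R) := g (l 0%N).
have mS : measurable_fun setT (sshift 1 : marks R -> marks R) by exact: measurable_sshift.
have mg : measurable_fun setT (EFin \o g) := measurable_int _ ig.
have mc : measurable_fun setT (fun l : marks R => l 0%N) by exact: measurable_coord.
have PS (A : set (marks R)) : measurable A -> Lam (sshift 1 @^-1` A) = Lam A.
  move=> mA; have mAi : measurable_fun setT (fun l : marks R => (\1_A l)%:E : \bar R).
    exact: measurable_indicE.
  have i0 (l : marks R) : 0 <= (\1_A l)%:E :> \bar R by rewrite lee_fin.
  have := iid_shift iidL 1 mAi i0.
  rewrite [X in _ = X]integral_indic// setIT => <-.
  have mSA := measurable_preimage mS mA.
  by rewrite [RHS](_ : _ = \int[Lam]_l (\1_(sshift 1 @^-1` A) l)%:E)// integral_indic// setIT.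
have ig0 : Lam.-integrable setT (EFin \o g0).
  apply/integrableP; split; first exact: (measurableT_comp mg mc).
  have mag : measurable_fun setT (fun a => `|(g a)%:E|) by exact: measurableT_comp.
  rewrite (iid_marginal iidL 0 mag)//; by case/integrableP: ig.
have g0p : (EFin \o g0)^\+ = (fun l => (EFin \o g)^\+ (l 0%N)).
  by apply/funext => l; rewrite !funeposE.
have g0n : (EFin \o g0)^\- = (fun l => (EFin \o g)^\- (l 0%N)).
  by apply/funext => l; rewrite !funenegE.
have intg0 : \int[Lam]_l (g0 l)%:E = \int[rho]_a (g a)%:E.
  rewrite integralE [RHS]integralE -[X in X^\+]/(EFin \o g0) -[X in X^\-]/(EFin \o g0) g0p g0n.
  rewrite (iid_marginal iidL 0%N (measurable_funepos mg) (funepos_ge0 _)).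
  by rewrite (iid_marginal iidL 0%N (measurable_funeneg mg) (funeneg_ge0 _)).
pose B := sums_unbounded (sshift 1 : marks R -> marks R) g0.
have mB : measurable B by exact: measurable_sums_unbounded mS ig0.
have BB : (sshift 1 : marks R -> marks R) @^-1` B = B by exact: sums_unbounded_invariant.
have sep (h : R -> \bar R) : measurable_fun setT h -> (forall a, 0 <= h a) ->
    \int[Lam]_(l in B) h (l 0%N) = Lam B * \int[Lam]_l h (l 0%N).
  move=> mh h0; have mhB : measurable_fun setT (fun l : marks R => h (l 0%N) * (\1_B l)%:E).
    by apply: emeasurable_funM; [exact: (measurableT_comp mh mc)|exact: measurable_indicE].
  rewrite integral_mkcond (eq_integral (fun l => h (l 0%N) * (\1_B l)%:E)); last first.
    by move=> l _; rewrite epatch_indic.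
  have hB0 (l : marks R) : 0 <= h (l 0%N) * (\1_B l)%:E by rewrite mule_ge0// lee_fin.
  rewrite (iidL _ mhB hB0).
  rewrite (iid_marginal iidL 0 mh h0) muleC -ge0_integralZr//.
  apply: eq_integral => a _.
  rewrite (eq_integral (fun l => h a * (\1_B l)%:E)); last first.
    move=> l _; congr (_ * (_)%:E); rewrite !indicE; congr (_%:R).
    have sB : B (scons a l) = B l by rewrite -[in LHS]BB.
    by congr nat_of_bool; apply/idP/idP; rewrite !inE sB.
  rewrite ge0_integralZl//; last exact: measurable_indicE.
  by rewrite integral_indic// setIT.
have Bg : \int[Lam]_(l in B) (g0 l)%:E = Lam B * \int[Lam]_l (g0 l)%:E.
  rewrite integralE [in RHS]integralE.
  have fn : - (\int[Lam]_l (EFin \o g0)^\- l) \is a fin_num.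
    by rewrite fin_numN; exact: integrable_neg_fin_num.
  have ip := sep _ (measurable_funepos mg) (funepos_ge0 _).
  have in_ := sep _ (measurable_funeneg mg) (funeneg_ge0 _).
  rewrite -[X in X^\+]/(EFin \o g0) -[X in X^\-]/(EFin \o g0) in fn *.
  rewrite g0p g0n in fn *; rewrite [X in X - _]ip [X in _ - X]in_.
  by rewrite [RHS](muleBr _ (fin_num_adde_defl _ fn))// fin_num_measure.
have LB0 : Lam B = 0 by apply: (sums_unbounded_null mS PS ig0 Bg); rewrite intg0.
have mpsi := @measurable_attempt_marks R.
have muB : mu (attempt_marks @^-1` B) = 0.
  rewrite (prob_fresh_start (fresh_start_path model) (measurable_preimage mpsi mB)).
  rewrite (eq_integral (cst 0)) ?integral0//.
  by move=> xi _; rewrite attempt_marks_law.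
apply: filterS (measure0_aeN (measurable_preimage mpsi mB) muB) => xi /existsNP[K hK].
exists K => n.
have := le_max_sum (sshift 1 : marks R -> marks R) g0 n (attempt_marks xi).
rewrite (eq_bigr (fun i : 'I_n => g (attempt_marks xi i))); last first.
  move=> i _; rewrite /g0; congr g.
  have iE k (l : marks R) : iter k (sshift 1 : marks R -> marks R) l = sshift k l.
    by elim: k => [|k IH] //; rewrite iterS IH sshiftD addn1.
  by rewrite iE /sshift addn0.
move=> /le_trans; apply; rewrite leNgt; apply/negP => h.
by apply: hK; exists n.
Qed.

(** Only attempts longer than a constant [M] can produce large ideal times, and
    for large [M] they use a small part of the actual time. *)
Lemma ideal_le_actual (eps : R) : (0 < eps)%R ->
  {ae mu, forall xi, exists M K : R, forall N,
    (\sum_(n < N) ideal (iter n step xi) <=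
     eps * (\sum_(n < N) actual (iter n step xi)) + M * N%:R + K)%R}.
Proof.
move=> eps0; pose f (a : R) := Num.max a 0%R.
have mf : measurable_fun setT f by exact: measurable_maxr.
have f0 a : (0 <= f a)%R by rewrite le_max lexx orbT.
have ff a : (0 <= a)%R -> f a = a by move=> a0; rewrite /f max_l.
have intf : rho.-integrable setT (EFin \o f).
  apply/integrableP; split; first exact/measurable_EFinP.
  rewrite (eq_integral (EFin \o f)); last by move=> a _; rewrite /= ger0_norm.
  rewrite (ae_eq_integral (fun a : R => a%:E))//.
  - exact: (mark_mean model).
  - exact/measurable_EFinP.
  - exact/measurable_EFinP.
  - exists [set a : R | (a < 0)%R]; split; [exact: measurable_ltr|exact: (mark_ge0 model)|].
    move=> a /= h; rewrite ltNge; apply/negP => a0; apply: h => _.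
    by rewrite ff.
pose m := \int[rho]_a (f a)%:E.
have m0 : 0 < m.
  apply: (lt_le_trans (mark_tail model 1%R)).
  have m1 : measurable [set a : R | (1 < a)%R] by exact: measurable_ltr.
  rewrite -[X in rho X]setIT -integral_indic//; apply: ge0_le_integral => //.
  - exact: measurable_indicE.
  - exact/measurable_EFinP.
  - move=> a _; rewrite lee_fin indicE; case: (boolP (a \in _)) => [/set_mem/= a1|_] //.
    by rewrite le_max (ltW a1).
have mfin : m \is a fin_num by exact: (integrable_fin_num measurableT intf).
have e1 : (0 < eps * fine m)%R by rewrite mulr_gt0// fine_gt0// m0 ltey_eq mfin.
pose A n := [set a : R | (n%:R < a)%R].
have mA n : measurable (A n) by exact: measurable_ltr.
have Aout a : exists n0, forall n, (n0 <= n)%N -> ~ A n a.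
  exists (Num.truncn a).+1 => n an; rewrite /A/=; apply/negP; rewrite -leNgt.
  by rewrite (le_trans (ltW (truncnS_gt a)))// ler_nat.
have [n _ /(_ n (leqnn n)) hn] := tail_integral_small intf mA Aout e1.
pose g (a : R) := (f a * \1_(A n) a - eps * f a)%R.
have intA : rho.-integrable setT (EFin \o (fun a => f a * \1_(A n) a)%R).
  rewrite (_ : EFin \o _ = ((EFin \o f) \_ (A n))).
    by apply/(integrable_mkcond _ (mA n)); exact: (integrableS measurableT (mA n) (@subsetT _ _) intf).
  by apply/funext => a; rewrite epatch_indic.
have inte : rho.-integrable setT (EFin \o (fun a => eps * f a)%R).
  rewrite (_ : EFin \o _ = (fun a => eps%:E * (EFin \o f) a)) //.
  exact: integrableZl.
have intg : rho.-integrable setT (EFin \o g) := integrableB measurableT intA inte.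
have gneg : \int[rho]_a (g a)%:E < 0.
  have eE : \int[rho]_a (eps * f a)%:E = (eps * fine m)%:E.
    by rewrite EFinM fineK// /m -(integralZl measurableT intf).
  have aE : \int[rho]_a (f a * \1_(A n) a)%:E = \int[rho]_(a in A n) (f a)%:E.
    by rewrite [RHS]integral_mkcond; apply: eq_integral => a _; rewrite epatch_indic.
  rewrite (_ : \int[rho]_a _ = \int[rho]_a (f a * \1_(A n) a)%:E - \int[rho]_a (eps * f a)%:E).
    by rewrite eE aE suber_lt0.
  exact: (integralB measurableT intA inte).
apply: filterS2 (good_ae model) (attempts_bounded_sums intg gneg) => xi gxi [K hK].
exists n%:R, K => N.
have [J [_ /(_ g) JS]] := attempts_concat N gxi.
have := hK J; rewrite JS => hS.
have gN i : good (iter i step xi) by exact: good_iter_step.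
have key i : (ideal (iter i step xi) <= eps * actual (iter i step xi) + n%:R +
    \sum_(j < tau (iter i step xi) 0%N) g (Lseq (iter i step xi) 0%N j))%R.
  move: (gN i); set eta := iter i step xi => geta; have [g1 g2 g3 g4] := geta.
  have [t0 tx tl] := first_exceedP (g4 0%N (Dseq eta 0%N)).
  have gs1 := good_sshift 1 geta.
  have gE : (\sum_(j < tau eta 0%N) g (Lseq eta 0%N j) = \sum_(j < tau eta 0%N)
      (Lseq eta 0%N j * \1_(A n) (Lseq eta 0%N j)) - eps * actual eta)%R.
    rewrite actualE// /first_actual mulr_sumr -sumrB; apply: eq_bigr => j _.
    by rewrite /g ff.
  have iL : (ideal eta <= Lseq eta 0%N (tau eta 0%N).-1)%R.
    rewrite idealE// /first_ideal -lerBrDl ltW//.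
    by apply: crosses_lt; [rewrite subr_gt0|exact: good_crosses].
  have lastL : (Lseq eta 0%N (tau eta 0%N).-1 <= n%:R + \sum_(j < tau eta 0%N)
      (Lseq eta 0%N j * \1_(A n) (Lseq eta 0%N j)))%R.
    have tt : ((tau eta 0%N).-1 < tau eta 0%N)%N by rewrite ltn_predL.
    rewrite (bigD1 (Ordinal tt))//=.
    have : (0 <= \sum_(j < tau eta 0%N | j != Ordinal tt)
        (Lseq eta 0%N j * \1_(A n) (Lseq eta 0%N j)))%R.
      by apply: sumr_ge0 => j _; rewrite mulr_ge0.
    have n0 : (0 <= n%:R :> R)%R by [].
    have l0 := g2 0%N (tau eta 0%N).-1.
    rewrite indicE; case: (boolP (_ \in A n)) => [_|/negP h] s0 /=.
      by rewrite mulr1; lra.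
    have : (Lseq eta 0%N (tau eta 0%N).-1 <= n%:R)%R.
      by rewrite leNgt; apply/negP => h'; apply: h; apply: mem_set.
    by rewrite mulr0; lra.
  by rewrite gE; lra.
apply: (@le_trans _ _ (\sum_(i < N) (eps * actual (iter i step xi) + n%:R +
    \sum_(j < tau (iter i step xi) 0%N) g (Lseq (iter i step xi) 0%N j)))%R).
  by apply: ler_sum => i _; exact: key.
rewrite !big_split/= -mulr_sumr sumr_const card_ord -[(n%:R *+ N)%R]mulr_natr.
exact: lerD (lexx _) hS.
Qed.

End attempts_law.

(** * The law of the path under the Palm probability *)

Section palm.
Local Open Scope ereal_scope.

Lemma ge0_le_integral_any d (X : measurableType d) (R : realType)
    (mu : {measure set X -> \bar R}) (f g : X -> \bar R) :
  (forall x, 0 <= f x) -> (forall x, f x <= g x) ->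
  \int[mu]_x f x <= \int[mu]_x g x.
Proof.
move=> f0 fg; have g0 x : 0 <= g x := le_trans (f0 x) (fg x).
rewrite !ge0_integralTE//; apply: le_ereal_sup => _ [h hf <-]; exists h => // x.
exact: le_trans (hf x) (fg x).
Qed.

Lemma ae_eq0_integral_any d (X : measurableType d) (R : realType)
    (mu : {measure set X -> \bar R}) (f : X -> \bar R) :
  (forall x, 0 <= f x) -> {ae mu, forall x, f x = 0} -> \int[mu]_x f x = 0.
Proof.
move=> f0 [N [mN N0 hN]]; apply/eqP; rewrite eq_le integral_ge0// andbT.
have h x : f x <= +oo * (\1_N x)%:E.
  rewrite indicE; case: (boolP (x \in N)) => [_|/negP xN]; first by rewrite mule1 leey.
  rewrite mule0; rewrite leNgt; apply/negP => fx; apply: xN; apply: mem_set; apply: hN => /= fx0.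
  by rewrite fx0 ltxx in fx.
apply: (le_trans (ge0_le_integral_any mu f0 h)).
rewrite ge0_integralZl//; last exact: measurable_indicE.
by rewrite integral_indic// setIT N0 mule0.
Qed.

Context (R : realType) d (Omega : measurableType d) (P : probability Omega R)
  (Phi : {RV P >-> config R}) (P0 : probability (config R) R).
Hypothesis hPhi : stationary_marked_point_process Phi.
Hypothesis hP0 : is_palm Phi P0.

(** The Palm probability does not charge the configurations that are never seen
    from a point of an admissible configuration. *)
Lemma palm_null (A : set (config R)) : measurable A ->
  (forall phi n, admissible phi -> ~ A (theta n phi)) -> P0 A = 0.
Proof.
move=> mA hA; have [aP _ /andP[i0 _]] := hPhi.
have : intensity Phi * P0 A = 0.
  rewrite hP0//; apply: ae_eq0_integral_any => [w|].
    by rewrite /counting; case: ifP.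
  apply: filterS aP => w adm; rewrite (_ : mkset _ = set0).
    by rewrite /counting asboolT// fset_set0.
  by apply/seteqP; split => // n [_ /(hA _ _ adm)].
by move=> /eqP; rewrite mule_eq0 (gt_eqF i0) => /eqP.
Qed.

Lemma measurable_point n : measurable_fun setT (fun phi : config R => Defs.point phi n).
Proof. exact: (measurableT_comp measurable_fst (measurable_coord n)). Qed.

Lemma measurable_mark_seq n : measurable_fun setT (@mark_seq R n).
Proof. exact: (measurableT_comp measurable_snd (measurable_coord n)). Qed.

Lemma measurable_gap n : measurable_fun setT (fun phi : config R => gap phi n).
Proof. by apply: measurable_funB; exact: measurable_point. Qed.

Lemma measurable_config_mark n i : measurable_fun setT (fun phi : config R => Defs.mark phi n i).
Proof. exact: (measurable_coord_comp i (measurable_mark_seq n)). Qed.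

Lemma measurable_path_of : measurable_fun setT (@path_of R).
Proof.
apply: measurable_fun_seqspace => n.
by apply: measurable_fun_pair; [exact: measurable_gap|exact: measurable_mark_seq].
Qed.

Lemma palm_gap_ge0 : P0 [set phi | gap phi 0 < 0]%R = 0.
Proof.
apply: palm_null; first exact: (measurable_ltr (measurable_gap 0) (measurable_cst _)).
move=> phi n [h _ _]; rewrite /= /gap /Defs.point /theta /= add0r addr0 subrr subr0 => /lt_geF.
by rewrite subr_ge0 (ltW (h n)).
Qed.

Lemma palm_mark_ge0 : P0 [set phi | Defs.mark phi 0 0 < 0]%R = 0.
Proof.
apply: palm_null; first exact: (measurable_ltr (measurable_config_mark 0 0) (measurable_cst _)).
by move=> phi n [_ _ h] /lt_geF; rewrite /Defs.mark /theta/= addr0 => /negP; apply; exact: h.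
Qed.

Lemma palm_point0 : {ae P0, forall phi, Defs.point phi 0 = 0%R}.
Proof.
exists [set phi | Defs.point phi 0 != 0%R]; split.
- have m0 := measurable_preimage (measurable_point 0) (measurableC (measurable_set1 (0:R)%R)).
  by rewrite (_ : mkset _ = (fun phi => Defs.point phi 0) @^-1` (~` [set 0%R]))//; apply/seteqP; split => phi /= /eqP.
- apply: palm_null.
    have m0 := measurable_preimage (measurable_point 0) (measurableC (measurable_set1 (0:R)%R)).
    by rewrite (_ : mkset _ = (fun phi => Defs.point phi 0) @^-1` (~` [set 0%R]))//; apply/seteqP; split => phi /= /eqP.
  by move=> phi n _ /=; rewrite /Defs.point /theta /= addr0 subrr eqxx.
- by move=> phi /= /eqP.
Qed.

End palm.

Section finite_independence.
Local Open Scope ereal_scope.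
Context d (Omega : measurableType d) (R : realType) (P : probability Omega R).

Lemma mutually_independent_seq (I : choiceType) d' (T : measurableType d')
    (X : I -> Omega -> T) (h : nat -> I) (k : I -> nat) n (A : nat -> set T) :
  mutually_independent P X -> cancel h k -> (forall i, measurable (A i)) ->
  P [set w | forall i, (i < n)%N -> A i (X (h i) w)] =
  \prod_(i < n) P (X (h i) @^-1` A i).
Proof.
move=> indX hk mA; pose J : {fset I} := [fset h i | i in iota 0 n]%fset.
have := indX J (fun j => A (k j)) (fun j => mA (k j)).
rewrite (_ : \bigcap_(i in _) _ = [set w | forall i, (i < n)%N -> A i (X (h i) w)]); last first.
  apply/seteqP; split => w /= H i.
    move=> ni; have := H (h i); rewrite /= hk; apply.
    by apply/imfsetP; exists i => //=; rewrite mem_iota.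
  by move=> /imfsetP[j /=]; rewrite mem_iota => /andP[_ jn] ->; rewrite hk; exact: H.
move=> ->; have pJ : perm_eq J [seq h i | i <- iota 0 n].
  apply: uniq_perm; first exact: fset_uniq.
    by rewrite map_inj_uniq ?iota_uniq//; exact: can_inj hk.
  move=> j; apply/imfsetP/mapP => -[i iJ ->]; exists i => //.
rewrite (perm_big _ pJ) big_map -{1}[n]subn0 -/(index_iota 0 n) big_mkord.
by apply: eq_bigr => i _; rewrite hk.
Qed.

End finite_independence.

Lemma integral_image_law_any d d' (X : measurableType d) (Y : measurableType d')
    (R : realType) (P : probability X R) (f : X -> Y) (mf : measurable_fun setT f)
    (g : Y -> \bar R) : measurable_fun setT g ->
  (\int[image_law P mf]_y g y = \int[P]_x g (f x))%E.
Proof.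
move=> mg; rewrite integralE [RHS]integralE; congr (_ - _)%E.
  rewrite (integral_image_law P mf (measurable_funepos mg) (funepos_ge0 _)).
  by apply: eq_integral => x _; rewrite !funeposE.
rewrite (integral_image_law P mf (measurable_funeneg mg) (funeneg_ge0 _)).
by apply: eq_integral => x _; rewrite !funenegE.
Qed.

Section palm_path_model.
Local Open Scope ereal_scope.
Context (R : realType) d (Omega : measurableType d) (P : probability Omega R)
  (Phi : {RV P >-> config R}) (P0 : probability (config R) R).
Hypothesis hPhi : stationary_marked_point_process Phi.
Hypothesis hP0 : is_palm Phi P0.
Hypothesis hren : renewal_assumptions P0.

Definition path_law := image_law P0 (@measurable_path_of R).
Definition gap_dist := image_law P0 (@measurable_gap R 0).
Definition mark_seq_dist := image_law P0 (@measurable_mark_seq R 0).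
Definition mark_dist := image_law P0 (@measurable_config_mark R 0 0).

Lemma right_unbounded_tail (V : config R -> R) (mV : measurable_fun setT V) x :
  right_unbounded P0 V -> 0 < image_law P0 mV [set y | (x < y)%R].
Proof.
move=> hV; apply: (lt_le_trans (hV (Num.max x 0%R) _)); first by rewrite le_max lexx orbT.
have mx (y : R) : measurable [set z : R | (y < z)%R] by exact: measurable_ltr.
rewrite /image_law /distribution /pushforward/=; apply: le_measure; rewrite ?inE.
- exact: (measurable_preimage mV (mx _)).
- exact: (measurable_preimage mV (mx _)).
- by move=> w /=; rewrite gt_max => /andP[].
Qed.

Lemma palm_path_model : path_model gap_dist mark_dist mark_seq_dist path_law.
Proof.
have GE : @measurable _ R = <<s measurable>>.
  exact/esym/sigma_algebra_id/sigma_algebra_measurable.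
split.
- apply: (@iid_law_boxes _ _ _ [set A `*` B | A in @measurable _ R & B in @measurable _ (marks R)]).
  + exact: measurable_prod_measurableType.
  + move=> _ _ [A mA [B mB <-]] [A' mA' [B' mB' <-]].
    exists (A `&` A'); first exact: measurableI.
    by exists (B `&` B'); [exact: measurableI|rewrite setXI].
  + by exists setT => //; exists setT => //; rewrite setXTT.
  + move=> n AB hAB.
    have /choice[A' hA'] : forall i, exists p : set R * set (marks R),
        [/\ measurable p.1, measurable p.2 & AB i = p.1 `*` p.2].
      by move=> i; have [A mA [B mB e]] := hAB i; exists (A, B).
    pose A i := (A' i).1; pose B i := (A' i).2.
    have mA i : measurable (A i) by case: (hA' i).
    have mB i : measurable (B i) by case: (hA' i).
    have ABE i : AB i = A i `*` B i by case: (hA' i).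
    have -> : path_law (seq_box n AB) =
        P0 (@mark_seqs R @^-1` seq_box n B `&` @gap_seq R @^-1` seq_box n A).
      rewrite /path_law /image_law /distribution /pushforward/=; congr (P0 _).
      apply/seteqP; split => phi.
        by move=> h; split => i ni; have := h i ni; rewrite ABE => -[].
      by move=> [hB hA] i ni; rewrite ABE; split; [exact: hA|exact: hB].
    rewrite (mark_seqs_indep hren (measurable_seq_box n mB) (measurable_seq_box n mA)).
    have [gi gd] := gaps_iid hren; have [mi md] := mark_seqs_iid hren.
    have kP : cancel Posz absz by [].
    have -> := mutually_independent_seq n gi kP mA.
    have -> := mutually_independent_seq n mi (fun i => erefl : id (id i) = i) mB.
    rewrite -big_split/=; apply: eq_bigr => i _.
    rewrite ABE product_measure1E// muleC; congr (_ * _).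
    + exact: (gd _ 0%R).
    + exact: (md _ 0%N).
- apply: (@iid_law_boxes _ _ _ measurable) => //.
  + by move=> A B; exact: measurableI.
  + move=> n A mA; have [mi md] := marks_iid hren 0.
    have := mutually_independent_seq n mi (fun i => erefl : id (id i) = i) mA.
    move=> e; apply: (etrans e).
    by apply: eq_bigr => i _; exact: (md _ 0%N).
- exact: (palm_gap_ge0 hPhi hP0).
- exact: (palm_mark_ge0 hPhi hP0).
- by move=> x; apply: right_unbounded_tail; exact: (gap0_unbounded hren).
- by move=> x; apply: right_unbounded_tail; exact: (mark01_unbounded hren).
- have mid : measurable_fun setT (fun y : R => y%:E : \bar R) by exact/measurable_EFinP.
  rewrite (integral_image_law_any P0 _ mid).
  by have := gap0_mean hren; rewrite unlock.
- have mid : measurable_fun setT (fun y : R => y%:E : \bar R) by exact/measurable_EFinP.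
  rewrite (integral_image_law_any P0 _ mid).
  by have := mark01_mean hren; rewrite unlock.
Qed.

End palm_path_model.

(** * Continuous functions of the path *)

Lemma ptws_cvg (I : eqType) (V : topologicalType) (s : nat -> I -> V) (l : I -> V) :
  (forall i, s n i @[n --> \oo] --> l i) ->
  (s : nat -> {ptws I -> V}) @ \oo --> (l : {ptws I -> V}).
Proof.
move=> sl; apply/cvg_sup => i U [W [[B oB <-] Bl WU]].
have nB : nbhs (l i) B by exact: open_nbhs_nbhs.
have := sl i _ nB; rewrite !nbhs_simpl => -[N _ hN]. exists N => // k Nk; apply: WU; exact: hN.
Qed.

Lemma hpath_cvg (R : realType) (s : nat -> hpath R) (xi : hpath R) :
  (forall n, (s k n).1 @[k --> \oo] --> (xi n).1) ->
  (forall n i, (s k n).2 i @[k --> \oo] --> (xi n).2 i) ->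
  (s : nat -> hpath_top R) @ \oo --> (xi : hpath_top R).
Proof.
move=> h1 h2; apply: ptws_cvg => n.
rewrite (_ : (fun k => s k n) = fun k => ((s k n).1, (s k n).2 : {ptws nat -> R})); last first.
  by apply/funext => k; case: (s k n).
rewrite [X in _ --> X](_ : _ = ((xi n).1, (xi n).2 : {ptws nat -> R})); last by case: (xi n).
have h2n := ptws_cvg (h2 n).
exact: (cvg_pair (h1 n) h2n).
Qed.

Section discretization.
Context (R : realType) d (X : measurableType d).

(** A function of finitely many integers needs no regularity to be measurable. *)
Lemma measurable_fun_past d' (Y : measurableType d') k (N : nat -> X -> nat)
    (F : (nat -> nat) -> Y) :
  (forall j, nat_measurable (N j)) -> past k F ->
  measurable_fun setT (fun x => F (fun j => N j x)).
Proof.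
move=> + pF; elim: k F pF N => [|k IH] F pF N mN.
  rewrite (_ : (fun x => _) = cst (F (fun=> 0%N))); first exact: measurable_cst.
  by apply/funext => x; exact: pF.
have E x : F (fun j => N j x) = F (scons (N 0%N x) (fun j => N j.+1 x)).
  by congr F; apply/funext => -[|j].
rewrite (_ : (fun x => _) = fun x => F (scons (N 0%N x) (fun j => N j.+1 x))); last first.
  by apply/funext => x; exact: E.
apply: (measurable_nat_index (f := fun n x => F (scons n (fun j => N j.+1 x)))); first exact: mN.
move=> n; apply: (IH (fun e => F (scons n e))); first exact: past_scons.
by move=> j; exact: mN.
Qed.

Lemma nat_measurable_floor (f : X -> R) : measurable_fun setT f ->
  nat_measurable (fun x => choice.pickle (Num.floor (f x))).
Proof.
move=> mf n; case E : (choice.unpickle n : option int) => [z|]; last first.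
  rewrite (_ : mkset _ = set0)//; apply/seteqP; split => // x /= xn.
  by move: E; rewrite -xn choice.pickleK.
have [zn|zn] := eqVneq (choice.pickle z) n; last first.
  rewrite (_ : mkset _ = set0)//; apply/seteqP; split => // x /= xn.
  by move: E zn; rewrite -xn choice.pickleK => -[->]; rewrite eqxx.
rewrite (_ : mkset _ = [set x | z%:~R <= f x] `&` [set x | f x < (z + 1)%:~R]).
  by apply: measurableI; [exact: measurable_ler|exact: measurable_ltr].
apply/seteqP; split => x /=.
  rewrite -zn => /(pcan_inj choice.pickleK) fz.
  by have := floor_itv (f x); rewrite fz => /andP[].
move=> [h1 h2]; rewrite -zn; congr choice.pickle; apply: floor_def.
by rewrite h1 h2.
Qed.

End discretization.

Section continuous_path_functions.
Context (R : realType).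
Implicit Types (xi : hpath R).

(** The coordinates of a path in a single sequence: rank 0 of each term is the
    gap, the next ones are the marks. *)
Definition path_coord xi (p : nat * nat) : R :=
  if p.2 is i.+1 then (xi p.1).2 i else (xi p.1).1.

(** A path whose first [m] coordinates are rounded to multiples of [1 / m.+1],
    the other ones being 0, rebuilt from finitely many integers. *)
Definition rounded_coord (m : nat) (e : nat -> nat) (p : nat * nat) : R :=
  if (choice.pickle p < m)%N then
    (odflt 0%R (choice.unpickle (e (choice.pickle p)) : option int))%:~R / m.+1%:R
  else 0.

Definition rounded_path (m : nat) (e : nat -> nat) : hpath R :=
  fun n => (rounded_coord m e (n, 0%N), fun i => rounded_coord m e (n, i.+1)).

Definition path_codes (m : nat) xi (j : nat) : nat :=
  if (choice.unpickle j : option (nat * nat)) is Some p then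
    choice.pickle (Num.floor (m.+1%:R * path_coord xi p)) else 0%N.

Lemma measurable_path_coord p : measurable_fun setT (fun xi => path_coord xi p).
Proof.
case: p => n [|i]; rewrite /path_coord /=; [exact: measurable_Dseq|exact: measurable_mark].
Qed.

Lemma rounded_cvg xi p :
  rounded_coord m (path_codes m xi) p @[m --> \oo] --> path_coord xi p.
Proof.
apply/cvgrPdist_le => e e0; near=> m.
have pm : (choice.pickle p < m)%N by near: m; exists (choice.pickle p).+1.
rewrite /rounded_coord pm /path_codes choice.pickleK choice.pickleK /=.
set a := path_coord xi p; have /andP[h1 h2] := floor_itv (m.+1%:R * a).
have m0 : 0 < m.+1%:R :> R by rewrite ltr0n.
have em : m.+1%:R^-1 <= e.
  rewrite -[leRHS]invrK lef_pV2 ?posrE ?invr_gt0//.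
  near: m; exists (Num.truncn e^-1) => // k /= ek.
  by rewrite (le_trans (ltW (truncnS_gt _)))// ler_nat.
have aE : a = (m.+1%:R * a) / m.+1%:R by rewrite mulrAC divff ?mul1r// gt_eqF.
rewrite {1}aE -mulrBl ger0_norm; last by rewrite mulr_ge0// ?subr_ge0// invr_ge0 ltW.
apply: le_trans em; rewrite ler_piMl ?invr_ge0 ?(ltW m0)//.
by move: h2; rewrite intrD => h2; lra.
Unshelve. all: by end_near.
Qed.

(** Continuous functions of the path are measurable: they are limits of their
    values at rounded paths. *)
Lemma continuous_path_measurable (f : hpath R -> R) :
  continuous (f : hpath_top R -> R) -> measurable_fun setT f.
Proof.
move=> cf.
apply: (measurable_fun_cvg (h := fun m xi => f (rounded_path m (path_codes m xi)))).
- move=> m; apply: (@measurable_fun_past _ (hpath R) _ R m (fun j xi => path_codes m xi j)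
    (fun e => f (rounded_path m e))).
    move=> j; rewrite /path_codes; case: (choice.unpickle j) => [p|]; last first.
      by move=> n; case: n => [|n]; [rewrite (_ : mkset _ = setT)|rewrite (_ : mkset _ = set0)] => //;
         apply/seteqP; split.
    apply: nat_measurable_floor; apply: measurable_funM => //.
    exact: measurable_path_coord.
  move=> e e' ee'; congr f; apply/funext => n; rewrite /rounded_path.
  have E p : rounded_coord m e p = rounded_coord m e' p.
    by rewrite /rounded_coord; case: ifP => // pm; rewrite ee'.
  by congr (_, _); [exact: E|apply/funext => i; exact: E].
- move=> xi _.
  have /(continuous_cvg _ (cf xi)) // := @hpath_cvg R (fun m => rounded_path m (path_codes m xi)) xi
    (fun n => rounded_cvg (p := (n, 0%N))) (fun n i => rounded_cvg (p := (n, i.+1))).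
Qed.

End continuous_path_functions.

(** * Weak convergence of the laws seen from the checkpoints *)

Section weak_convergence.
Local Open Scope ereal_scope.
Context (R : realType) (F rho : probability R R)
  (Lam : probability (marks R) R) (mu : probability (hpath R) R).
Hypothesis model : path_model F rho Lam mu.
Variable gap_limit : probability R R.
Hypothesis gap_cvg : forall f : R -> R, continuous f ->
  (exists M : R, forall x, (`|f x| <= M)%R) ->
  \int[mu]_xi (f (Dseq (iter n.+1 (@step R) xi) 0))%:E @[n --> \oo] -->
  \int[gap_limit]_x (f x)%:E.

Lemma integral_shift d (X : measurableType d) (P : probability X R) (f : X -> R) (M K : R) :
  measurable_fun setT f -> (forall x, (`|f x| <= K)%R) ->
  \int[P]_x (f x)%:E = \int[P]_x (f x + M)%:E - M%:E.
Proof.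
move=> mf fK.
have if_ : P.-integrable setT (EFin \o f).
  have mfE : measurable_fun setT (EFin \o f) by exact/measurable_EFinP.
  apply: (le_integrable measurableT mfE _ (finite_measure_integrable_cst P K measurableT)).
  by move=> x _; rewrite /= lee_fin (le_trans (fK x))// ler_norm.
have ic := finite_measure_integrable_cst P M measurableT.
have E : \int[P]_x (f x + M)%:E = \int[P]_x (f x)%:E + M%:E.
  have := integralD measurableT if_ ic.
  rewrite [X in _ = _ + X](integral_prob_cst P M%:E) => <-.
  by apply: eq_integral => x _; rewrite EFinD.
by rewrite E addeK.
Qed.

(** The mean of a continuous function is a continuous function of the first
    gap. *)
Lemma continuous_mean (h : hpath R -> R) (K : R) :
  continuous (h : hpath_top R -> R) -> (forall xi, (0 <= h xi <= K)%R) ->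
  exists2 g : R -> R, continuous g & forall x, mean_from mu (EFin \o h) x = (g x)%:E.
Proof.
move=> ch hK; have mh := continuous_path_measurable ch.
have mhE : measurable_fun setT (EFin \o h) by exact/measurable_EFinP.
have mhx x : measurable_fun setT (fun xi => (h (with_gap x xi))%:E : \bar R).
  exact: (measurableT_comp mhE (measurable_with_gap_path x)).
have h0 xi : 0 <= (EFin \o h) xi by rewrite lee_fin; case/andP: (hK xi).
have fin x : mean_from mu (EFin \o h) x \is a fin_num.
  have /andP[a b] : 0%:E <= mean_from mu (EFin \o h) x <= K%:E.
    by apply: integral_bounds => [|xi|xi]; [exact: mhx|exact: h0|rewrite !lee_fin].
  by rewrite ge0_fin_numE// (le_lt_trans b)// ltry.
exists (fun x => fine (mean_from mu (EFin \o h) x)); last by move=> x; rewrite fineK.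
move=> x; apply/(@cvg_nbhsP R R^o) => u ux; apply: fine_cvg; rewrite fineK//.
have cv : {ae mu, forall xi, setT xi ->
    (h (with_gap (u n) xi))%:E @[n --> \oo] --> (h (with_gap x xi))%:E}.
  apply: aeW => xi _.
  have c : (fun n => with_gap (u n) xi : hpath_top R) @ \oo --> (with_gap x xi : hpath_top R).
    by apply: hpath_cvg => [[|n]|[|n] i] /=; [exact: ux|exact: cvg_cst|exact: cvg_cst|exact: cvg_cst].
  have c2 : h (with_gap (u n) xi) @[n --> \oo] --> h (with_gap x xi).
    by have /(continuous_cvg _ (ch _)) := c.
  by apply/fine_cvgP; split; [exact: nearW|exact: c2].
have dom : {ae mu, forall xi n, setT xi -> `|(h (with_gap (u n) xi))%:E| <= cst K%:E xi}.
  apply: aeW => xi n _; rewrite abse_EFin lee_fin ger0_norm; last by case/andP: (hK (with_gap (u n) xi)).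
  by case/andP: (hK (with_gap (u n) xi)).
by have [_ _ H] := dominated_convergence measurableT (fun n => mhx (u n)) (mhx x) cv
  (finite_measure_integrable_cst mu K measurableT) dom.
Qed.

Lemma seen_weak_limit (f : hpath R -> R) :
  continuous (f : hpath_top R -> R) -> (exists M : R, forall xi, (`|f xi| <= M)%R) ->
  \int[seen mu n.+1]_xi (f xi)%:E @[n --> \oo] -->
  \int[stationary_law mu gap_limit]_xi (f xi)%:E.
Proof.
move=> cf [M fM]; have mf := continuous_path_measurable cf.
pose h xi := (f xi + M)%R.
have ch : continuous (h : hpath_top R -> R).
  move=> xi; have c := cf xi; exact: (cvgD c (cvg_cst M)).
have hK xi : (0 <= h xi <= M + M)%R.
  by have := fM xi; rewrite /h ler_norml => /andP[a b]; rewrite -lerBlDr sub0r a lerD2r.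
have mh : measurable_fun setT (EFin \o h).
  by apply/measurable_EFinP; exact: continuous_path_measurable.
have h0 xi : 0 <= (EFin \o h) xi by rewrite lee_fin; case/andP: (hK xi).
have [g cg gE] := continuous_mean ch hK.
have gb : exists K : R, forall x, (`|g x| <= K)%R.
  exists (M + M)%R => x; rewrite -lee_fin -abse_EFin -gE.
  have mhx : measurable_fun setT (fun xi => (h (with_gap x xi))%:E : \bar R).
    exact: (measurableT_comp mh (measurable_with_gap_path x)).
  have /andP[a b] : 0%:E <= mean_from mu (EFin \o h) x <= (M + M)%:E.
    by apply: integral_bounds => [|xi|xi]; [exact: mhx|exact: h0|rewrite !lee_fin].
  by rewrite gee0_abs.
have := gap_cvg cg gb.
rewrite (_ : (fun n => _) = fun n => \int[seen mu n.+1]_xi (h xi)%:E); last first.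
  apply/funext => n; rewrite [RHS](fresh_start_seen model n.+1 mh h0).
  have mg := measurable_mean_gap mu mh h0.
  rewrite (integral_seen mu n.+1 mg (fun xi => mean_from_ge0 _ _ _))//.
  by apply: eq_integral => xi _; rewrite gE.
rewrite (_ : \int[gap_limit]_x _ = \int[stationary_law mu gap_limit]_xi (h xi)%:E); last first.
  rewrite [RHS](integral_stationary _ _ mh h0).
  by apply: eq_integral => x _; rewrite gE.
move=> H; rewrite (integral_shift (stationary_law mu gap_limit) M mf fM).
rewrite (_ : (fun n => _) = fun n => \int[seen mu n.+1]_xi (f xi + M)%:E - M%:E); last first.
  by apply/funext => n; exact: (integral_shift _ M mf fM).
by apply: (cvgeB _ H (cvg_cst _)); rewrite fin_num_adde_defl.
Qed.

End weak_convergence.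

(** * The process seen from the checkpoints *)

Lemma ae_image_law d d' (X : measurableType d) (Y : measurableType d') (R : realType)
    (P : probability X R) (f : X -> Y) (mf : measurable_fun setT f) (Q : Y -> Prop) :
  {ae image_law P mf, forall y, Q y} -> {ae P, forall x, Q (f x)}.
Proof.
move=> [N [mN N0 hN]]; exists (f @^-1` N); split => //.
- exact: (measurable_preimage mf mN).
- by move=> x /= nQ; apply: hN.
Qed.

Section measurable_checkpoints.
Context (R : realType).

Lemma measurable_ckpt n : nat_measurable (fun xi : hpath R => ckpt xi n).
Proof.
elim: n => [|n IH] /=.
  move=> k; case: k => [|k]; [rewrite (_ : mkset _ = setT)|rewrite (_ : mkset _ = set0)] => //;
  by apply/seteqP; split.
apply: nat_sup_measurable => k; apply: measurableI.
  rewrite [X in measurable X](_ : _ = \bigcup_(c in [set c | (c.+1 <= k)%N]) [set xi | ckpt xi n = c]).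
    by apply: bigcup_measurable => c _; exact: IH.
  apply/seteqP; split => [xi h|xi [c ck h]]; first by exists (ckpt xi n).
  by have e : ckpt xi n = c := h; move: ck; rewrite -e.
apply: measurable_ltr.
  apply: measurable_funB; first exact: measurable_Xseq.
  apply: (measurable_nat_index (f := fun c (xi : hpath R) => Xseq xi c.+1) IH) => c.
  exact: measurable_Xseq.
apply: (measurable_nat_index (f := fun c (xi : hpath R) => Zseq xi c) IH) => c.
exact: measurable_Zseq.
Qed.

End measurable_checkpoints.

Section seen_from_checkpoints.
Local Open Scope ereal_scope.
Context (R : realType) d (Omega : measurableType d) (P : probability Omega R)
  (Phi : {RV P >-> config R}) (P0 : probability (config R) R).
Hypothesis hPhi : stationary_marked_point_process Phi.
Hypothesis hP0 : is_palm Phi P0.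
Hypothesis hren : renewal_assumptions P0.

Let model := palm_path_model hPhi hP0 hren.
Local Notation mu := (path_law P0).

Lemma good_path : {ae P0, forall phi, good (path_of phi)}.
Proof. exact: ae_image_law (good_ae model). Qed.

Lemma measurable_path_from_nu n : measurable_fun setT (@path_from_nu R n).
Proof.
apply: (measurable_sshift_index (N := fun phi : config R => ckpt (path_of phi) n.+1)).
  exact: (nat_measurable_comp (@measurable_path_of R) (@measurable_ckpt R n.+1)).
exact: measurable_path_of.
Qed.

Lemma path_from_nuE n : {ae P0, forall phi,
  path_from_nu n phi = iter n.+1 step (path_of phi)}.
Proof. by apply: filterS good_path => phi g; rewrite iter_step. Qed.

Lemma integral_checkpoint_law n (f : hpath R -> \bar R) : measurable_fun setT f ->
  \int[checkpoint_law P0 n]_xi f xi = \int[seen mu n.+1]_xi f xi.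
Proof.
move=> mf; have ms := @measurable_iter_step R n.+1.
rewrite (_ : \int[checkpoint_law P0 n]_xi _ =
  \int[image_law P0 (@measurable_path_from_nu n)]_xi f xi)//.
rewrite (integral_image_law_any P0 _ mf) (integral_image_law_any mu ms mf).
rewrite (integral_image_law_any P0 _ (measurableT_comp mf ms)).
apply: ae_eq_integral => //.
- exact: (measurableT_comp mf (@measurable_path_from_nu n)).
- exact: (measurableT_comp (measurableT_comp mf ms) (@measurable_path_of R)).
- by apply: filterS (path_from_nuE n) => phi -> _.
Qed.

Section limit.
Context d' (Omega' : measurableType d') (Q : probability Omega' R) (Dinf : {RV Q >-> R}).
Hypothesis hconv : gaps_converge_weakly P0 Dinf.

Local Notation gap_limit := (distribution Q Dinf).

Lemma gaps_seen_cvg (f : R -> R) : continuous f ->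
  (exists M : R, forall x, (`|f x| <= M)%R) ->
  \int[mu]_xi (f (Dseq (iter n.+1 (@step R) xi) 0))%:E @[n --> \oo] -->
  \int[gap_limit]_x (f x)%:E.
Proof.
move=> cf bf; have H := hconv cf bf.
rewrite (_ : (fun n => _) = fun n => \int[pushforward P0 (gap_at_nu n)]_x (f x)%:E) //.
have mf : measurable_fun setT (EFin \o f).
  by apply/measurable_EFinP; exact: continuous_measurable_fun.
apply/funext => n; rewrite [RHS]/=; have mD := @measurable_Dseq R 0%N.
have mg : measurable_fun setT (fun xi : hpath R => (f (Dseq xi 0))%:E : \bar R).
  exact: (measurableT_comp mf mD).
have mgap : measurable_fun setT (@gap_at_nu R n).
  rewrite (_ : @gap_at_nu R n = fun phi => Dseq (path_from_nu n phi) 0%N).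
    exact: (measurableT_comp mD (@measurable_path_from_nu n)).
  by apply/funext => phi; rewrite /gap_at_nu /path_from_nu /Dseq addn0.
rewrite [RHS](_ : _ = \int[image_law P0 mgap]_x (f x)%:E)//.
apply/esym; rewrite (integral_image_law_any P0 mgap mf).
rewrite -(integral_image_law_any mu (@measurable_iter_step R n.+1) mg).
rewrite -(integral_checkpoint_law n mg).
rewrite (_ : \int[checkpoint_law P0 n]_xi _ =
  \int[image_law P0 (@measurable_path_from_nu n)]_xi (f (Dseq xi 0))%:E)//.
rewrite (integral_image_law_any P0 _ mg).
by apply: eq_integral => phi _; rewrite /gap_at_nu /path_from_nu /Dseq addn0.
Qed.

Lemma checkpoint_weak_limit_stationary :
  checkpoint_weak_limit P0 (stationary_law mu gap_limit).
Proof.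
split.
  have mge : measurable [set xi : hpath R |
      (forall n, 0 <= Dseq xi n /\ forall i, 0 <= Lseq xi n i)%R].
    rewrite (_ : mkset _ = \bigcap_n ([set xi | (0 <= Dseq xi n)%R] `&`
        \bigcap_i [set xi | (0 <= Lseq xi n i)%R])).
      apply: bigcap_measurable => [|n _]; first by exists 0%N.
      apply: measurableI; first by apply: measurable_ler => //; exact: measurable_Dseq.
      apply: bigcap_measurable => [|i _]; first by exists 0%N.
      by apply: measurable_ler => //; exact: measurable_mark.
    apply/seteqP; split => [xi h n _|xi h n].
      by have [a b] := h n; split => // i _; exact: b.
    by have [a b] := h n Logic.I; split => // i; exact: b.
  apply/eqP; rewrite eq_le probability_le1//=.
  rewrite -(probability_setT (stationary_law mu gap_limit)).
  apply: ae_le_measure => //.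
  apply: filterS (stationary_good model gaps_seen_cvg) => xi [g1 g2 _ _] _ n.
  by split => // i; exact: g2.
move=> f cf bf; rewrite (_ : (fun n => _) = fun n => \int[seen mu n.+1]_xi (f xi)%:E).
  exact: (seen_weak_limit model gaps_seen_cvg cf bf).
apply/funext => n; apply: integral_checkpoint_law.
by apply/measurable_EFinP; exact: continuous_path_measurable.
Qed.

End limit.

End seen_from_checkpoints.

(** * The mean of the number of points skipped at the limit checkpoint *)

Section mean_passage.
Local Open Scope ereal_scope.
Context (R : realType) (F rho : probability R R)
  (Lam : probability (marks R) R) (mu : probability (hpath R) R).
Hypothesis model : path_model F rho Lam mu.
Implicit Types (x : R) (xi : hpath R).

(** The passage over the residual life of a checkpoint with gap [x], made with
    all the gaps of the path instead of the gaps after the first one. *)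
Definition fresh_passage x xi : nat := kappa (residual x (Lseq xi 0)) xi.

Lemma measurable_fresh_passage :
  measurable_fun setT (fun p : R * hpath R => (fresh_passage p.1 p.2)%:R%:E : \bar R).
Proof.
apply/measurable_EFinP; apply: measurable_fun_natr.
apply: (nat_measurable_comp
  (f := fun p : R * hpath R => (Zseq (with_gap p.1 p.2) 0, p.2)) _ (@measurable_kappa R)).
apply: measurable_fun_pair; last exact: measurable_snd.
exact: (measurableT_comp (@measurable_Zseq R 0) (@measurable_with_gap R)).
Qed.

Lemma kappa_with_mark z l xi : kappa z (with_mark l xi) = kappa z xi.
Proof.
have XE k : Xseq (with_mark l xi) k = Xseq xi k.
  by rewrite /Xseq; apply: eq_bigr => -[[|i] ik] _.
rewrite /kappa; congr nat_inf; apply/seteqP.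
by split => k /=; rewrite XE.
Qed.

Lemma mean_passage x : mean_from mu (fun xi => (passage xi)%:R%:E) x =
  \int[mu]_xi (fresh_passage x xi)%:R%:E.
Proof.
have p0 (xi : hpath R) : 0 <= (passage xi)%:R%:E :> \bar R by rewrite lee_fin.
have q0 (xi : hpath R) : 0 <= (fresh_passage x xi)%:R%:E :> \bar R by rewrite lee_fin.
have mq : measurable_fun setT (fun xi => (fresh_passage x xi)%:R%:E : \bar R).
  exact: (measurable_fun_pair2 x measurable_fresh_passage).
rewrite (mean_fromE model x (@measurable_passage R) p0).
rewrite (integral_with_mark model mq q0); apply: eq_integral => l _.
by apply: eq_integral => eta _; rewrite /fresh_passage kappa_with_mark.
Qed.

End mean_passage.

Section skipped_points.
Local Open Scope ereal_scope.

Lemma ae_product1 d1 d2 (X : measurableType d1) (Y : measurableType d2) (R : realType)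
    (P : probability X R) (Q : probability Y R) (A : X -> Prop) :
  {ae P, forall x, A x} -> {ae (P \x Q), forall w, A w.1}.
Proof.
move=> [N [mN N0 hN]]; exists (N `*` setT); split.
- exact: measurableX.
- by apply: (etrans (product_measure1E P Q mN measurableT)); rewrite [X in X * _]N0 mul0e.
- by move=> w /= h; split => //; exact: hN.
Qed.

Lemma ae_product2 d1 d2 (X : measurableType d1) (Y : measurableType d2) (R : realType)
    (P : probability X R) (Q : probability Y R) (A : Y -> Prop) :
  {ae Q, forall y, A y} -> {ae (P \x Q), forall w, A w.2}.
Proof.
move=> [N [mN N0 hN]]; exists (setT `*` N); split.
- exact: measurableX.
- by apply: (etrans (product_measure1E P Q measurableT mN)); rewrite [X in _ * X]N0 mule0.
- by move=> w /= h; split => //; exact: hN.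
Qed.

Lemma ae_le_integral_any d (X : measurableType d) (R : realType)
    (mu : {measure set X -> \bar R}) (f g : X -> \bar R) :
  measurable_fun setT f -> (forall x, 0 <= f x) -> (forall x, 0 <= g x) ->
  {ae mu, forall x, f x <= g x} -> \int[mu]_x f x <= \int[mu]_x g x.
Proof.
move=> mf f0 g0 [N [mN N0 hN]].
have mf' : measurable_fun setT (fun x => f x * (\1_(~` N) x)%:E).
  by apply: emeasurable_funM => //; apply: measurable_indicE; exact: measurableC.
rewrite (ae_eq_integral (fun x => f x * (\1_(~` N) x)%:E))//.
  apply: ge0_le_integral_any => x; first by rewrite mule_ge0// lee_fin.
  rewrite indicE; case: (boolP (x \in _)) => [/set_mem xN|_]; last by rewrite mule0.
  by rewrite mule1; apply: contrapT => h; apply: xN; exact: hN.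
exists N; split => // x /= h; apply: contrapT => xN; apply: h => _.
by rewrite indicE mem_set// mule1.
Qed.

Context (R : realType) d (Omega : measurableType d) (P : probability Omega R)
  (Phi : {RV P >-> config R}) (P0 : probability (config R) R).
Hypothesis hPhi : stationary_marked_point_process Phi.
Hypothesis hP0 : is_palm Phi P0.
Hypothesis hren : renewal_assumptions P0.
Context d' (Omega' : measurableType d') (Q : probability Omega' R) (Dinf : {RV Q >-> R}).
Hypothesis hconv : gaps_converge_weakly P0 Dinf.

Let model := palm_path_model hPhi hP0 hren.
Let gap_cvg := gaps_seen_cvg hPhi hP0 hren hconv.
Local Notation mu := (path_law P0).
Local Notation gap_limit := (distribution Q Dinf).

Lemma point_Xseq (phi : config R) : Defs.point phi 0 = 0%R ->
  forall k : nat, Defs.point phi k%:Z = Xseq (path_of phi) k.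
Proof.
move=> h; elim=> [|k IH]; first by rewrite Xseq0.
by rewrite XseqS -IH /Dseq /path_of /= /gap addrC subrK -addn1 PoszD.
Qed.

Lemma fresh_passage_le_nu_inf (phi : config R) x : good (path_of phi) ->
  Defs.point phi 0 = 0%R -> (0 <= x)%R ->
  (fresh_passage x (path_of phi) <= nu_inf phi x)%N.
Proof.
move=> g h0 x0; set xi := path_of phi in g *.
have [_ _ gX gL] := g.
have z0 : (0 < residual x (Lseq xi 0%N))%R by exact/residual_gt0/gL.
rewrite /fresh_passage; have cr := good_crosses (residual x (Lseq xi 0%N)) g.
have Xk := crosses_lt z0 cr; set k := kappa _ _ in Xk *.
case: (posnP k) => [->//|k0].
pose L := Defs.mark phi 0 (first_exceed x (mark_seq 0 phi)).-1.
have XL : (Xseq xi k <= L)%R.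
  by rewrite ltW// (lt_le_trans Xk)// /residual lerBlDr lerDl.
pose E := [set j : nat | (1 <= j)%N /\ (Defs.point phi j%:Z <= L)%R].
have [K KL] := gX (L + 1)%R.
have EK j : E j -> (j <= K)%N.
  move=> [_]; rewrite point_Xseq// => jL; rewrite leqNgt; apply/negP => /ltnW/(Xseq_nondecreasing g).
  by move=> /(le_trans KL)/le_trans/(_ jL); rewrite gerDl ler10.
have Ek : E k by split => //; rewrite point_Xseq.
have Eex : exists j, `[< E j >] by exists k; apply/asboolP.
have Ebd j : `[< E j >] -> (j <= K)%N by move=> /asboolP; exact: EK.
have -> : nu_inf phi x = ex_maxn Eex Ebd.
  rewrite /nu_inf; case: ex_maxnP => m /asboolP Em hm; apply: nat_supE => // j Ej.
  by apply: hm; apply/asboolP.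
by case: ex_maxnP => m _ hm; apply: hm; apply/asboolP.
Qed.

Lemma gap_limit_ge0 : {ae Q, forall w, (0 <= Dinf w)%R}.
Proof.
have mA : measurable [set y : R | (y < 0)%R] by exact: measurable_ltr.
have mAi : measurable_fun setT (fun y : R => (\1_[set y | (y < 0)%R] y)%:E : \bar R).
  exact: measurable_indicE.
have i0 (y : R) : 0 <= (\1_[set y | (y < 0)%R] y)%:E :> \bar R by rewrite lee_fin.
have h0 : Q (Dinf @^-1` [set y : R | (y < 0)%R]) = 0.
  have := integral_stationary_gap mu gap_limit mAi i0.
  rewrite [X in _ = X -> _]integral_indic// setIT => e; apply: (etrans (esym e)).
  have sg := stationary_good model gap_cvg.
  rewrite (ae_eq_integral (cst 0)) ?integral0//.
  - exact: (measurableT_comp mAi (@measurable_Dseq R 0)).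
  - apply: filterS sg => xi [g0 _ _ _] _; rewrite indicE memNset//= => h.
    by have := g0 0%N; rewrite leNgt h.
apply: filterS (measure0_aeN (measurable_preimage (measurable_funPT Dinf) mA) h0) => w h.
by rewrite leNgt; apply/negP.
Qed.

(** The number of points between the limit checkpoint and the next one has a
    finite mean. *)
Lemma mean_passage_fin : mean_nu_inf P0 Dinf < +oo ->
  \int[gap_limit]_x mean_from mu (fun xi => (passage xi)%:R%:E) x < +oo.
Proof.
apply: le_lt_trans.
have mq := @measurable_fresh_passage R.
have p0 (xi : hpath R) : 0 <= (passage xi)%:R%:E :> \bar R by rewrite lee_fin.
have mD : measurable_fun setT Dinf by exact: measurable_funPT.
have mpath := @measurable_path_of R.
rewrite (integral_image_law_any Q mD); last first.
  exact: (measurable_mean_from mu (@measurable_passage R) p0).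
pose q (w : config R * Omega') : \bar R := (fresh_passage (Dinf w.2) (path_of w.1))%:R%:E.
have mqw : measurable_fun setT q.
  apply: (measurableT_comp mq
    (g := fun w : config R * Omega' => (Dinf w.2, path_of w.1 : hpath R))).
  apply: measurable_fun_pair.
    exact: (measurableT_comp mD measurable_snd).
  exact: (measurableT_comp mpath measurable_fst).
have q0 w : 0 <= q w by rewrite lee_fin.
rewrite (eq_integral (fun w' => \int[P0]_phi q (phi, w'))); last first.
  move=> w' _; rewrite (mean_passage model).
  by rewrite (integral_image_law_any P0 _ (measurable_fun_pair2 (Dinf w') mq)).
rewrite -(fubini_tonelli2 q mqw q0).
apply: ae_le_integral_any => //.
have h1 := ae_product1 Q (good_path hPhi hP0 hren).
have h2 := ae_product1 Q (palm_point0 hPhi hP0).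
have h3 := ae_product2 P0 gap_limit_ge0.
apply: filterS3 h1 h2 h3 => w g p0' x0.
by rewrite lee_fin ler_nat; exact: fresh_passage_le_nu_inf.
Qed.

End skipped_points.

(** * The efficiency *)

Section ratios.
Context (R : realType).
Implicit Types (a b : nat -> R).

Lemma ratio_cvg0 a b : (forall N, 0 <= a N) -> (forall N, 0 <= b N) ->
  (forall j : nat, exists M K, forall N, a N <= j.+1%:R^-1 * b N + M * N%:R + K) ->
  (forall j : nat, exists K, forall N, j%:R * N%:R - K <= b N) ->
  a N / b N @[N --> \oo] --> 0.
Proof.
move=> a0 b0 hab hb; apply/cvgrPdist_le => e e0.
have [M [K hMK]] := hab (Num.truncn (2 / e)).
have je : (Num.truncn (2 / e)).+1%:R^-1 <= e / 2.
  by rewrite -[leRHS]invf_div lef_pV2 ?posrE ?ltr0n ?divr_gt0// ltW// truncnS_gt.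
have [K' hK'] := hb (Num.truncn ((`|M| + 1) / (e / 2))).+1.
exists (Num.truncn (`|K| + e / 2 * `|K'|)).+1 => // N /= NN.
rewrite sub0r normrN ger0_norm ?divr_ge0//.
have [bN|bN] := ltP 0 (b N); last first.
  have -> : b N = 0 by apply/eqP; rewrite eq_le bN b0.
  by rewrite invr0 mulr0 ltW.
rewrite ler_pdivrMr//; apply: (le_trans (hMK N)).
have N0 : 0 <= N%:R :> R by [].
have h1 : (Num.truncn (2 / e)).+1%:R^-1 * b N <= e / 2 * b N by rewrite ler_wpM2r// ltW.
have h2 : `|K| + e / 2 * `|K'| <= N%:R.
  by rewrite (le_trans (ltW (truncnS_gt _)))// ler_nat.
have h3 : (`|M| + 1) * N%:R <= e / 2 * ((Num.truncn ((`|M| + 1) / (e / 2))).+1%:R * N%:R).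
  rewrite mulrA ler_wpM2r// -ler_pdivrMl ?divr_gt0// mulrC ltW//; exact: truncnS_gt.
have h4 : e / 2 * ((Num.truncn ((`|M| + 1) / (e / 2))).+1%:R * N%:R - K') <= e / 2 * b N.
  by rewrite ler_wpM2l// ltW// divr_gt0.
have h5 : M * N%:R <= `|M| * N%:R by rewrite ler_wpM2r// ler_norm.
have h6 : e / 2 * K' <= e / 2 * `|K'| by rewrite ler_wpM2l ?ler_norm// ltW// divr_gt0.
have h7 := ler_norm K.
rewrite mulrBr in h4; rewrite mulrDl mul1r in h3.
have -> : e * b N = e / 2 * b N + e / 2 * b N by rewrite -mulrDl -splitr.
move: h1 h2 h3 h4 h5 h6 h7.
set t1 := _ * b N; set t2 := e / 2 * b N; set t3 := e / 2 * (_ * _).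
set t4 := e / 2 * K'; set t5 := e / 2 * `|K'|; set t6 := M * _; set t7 := `|M| * _.
clear; lra.
Qed.

Lemma average_cvg a (al : R) :
  (forall j : nat, exists K, forall N, a N <= (al + j.+1%:R^-1) * N%:R + K) ->
  (forall j : nat, exists K, forall N, (al - j.+1%:R^-1) * N%:R - K <= a N) ->
  a N / N%:R @[N --> \oo] --> al.
Proof.
move=> hu hl; apply/cvgrPdist_le => e e0.
have je : (Num.truncn (2 / e)).+1%:R^-1 <= e / 2.
  by rewrite -[leRHS]invf_div lef_pV2 ?posrE ?ltr0n ?divr_gt0// ltW// truncnS_gt.
have [K hK] := hu (Num.truncn (2 / e)).
have [K' hK'] := hl (Num.truncn (2 / e)).
exists (Num.truncn ((`|K| + `|K'|) / (e / 2))).+1 => // N /= NN.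
have e20 : 0 < e / 2 by rewrite divr_gt0.
have N0 : 0 < N%:R :> R by rewrite ltr0n (leq_trans _ NN).
have h2 : `|K| + `|K'| <= e / 2 * N%:R.
  by rewrite -ler_pdivrMl// mulrC (le_trans (ltW (truncnS_gt _)))// ler_nat.
have h1 : (Num.truncn (2 / e)).+1%:R^-1 * N%:R <= e / 2 * N%:R by rewrite ler_pM2r.
have e2 : e * N%:R = e / 2 * N%:R + e / 2 * N%:R by rewrite -mulrDl -splitr.
have -> : al - a N / N%:R = (al * N%:R - a N) / N%:R by rewrite mulrBl mulfK// gt_eqF.
rewrite normrM normfV [X in _ / X]gtr0_norm// ler_pdivrMr// ler_norml.
have a1 := hK N; have a2 := hK' N.
rewrite [((_ + _) * _)%R]mulrDl in a1; rewrite [((_ - _) * _)%R]mulrBl in a2.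
have k1 := ler_norm K; have k2 := ler_norm K'.
have k3 := normr_ge0 K; have k4 := normr_ge0 K'.
move: h1 h2 e2 a1 a2 k1 k2 k3 k4; set t1 := _ * N%:R; set t2 := e / 2 * _.
set t3 := e * _; set t4 := al * _; clear => *.
apply/andP; split; lra.
Qed.

Lemma ratio_cvg a b (al be : R) : be != 0 ->
  a N / N%:R @[N --> \oo] --> al -> b N / N%:R @[N --> \oo] --> be ->
  a N / b N @[N --> \oo] --> al / be.
Proof.
move=> be0 ha hb; have H := cvgM ha (cvgV be0 hb).
apply: (cvg_trans _ (H _ _)); apply: near_eq_cvg; near=> N.
have N0 : N%:R != 0 :> R by rewrite pnatr_eq0 -lt0n; near: N; exists 1%N.
by rewrite /= invf_div mulrA mulfVK.
Unshelve. all: by end_near.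
Qed.

End ratios.

Section efficiency.
Local Open Scope ereal_scope.
Context (R : realType) d (Omega : measurableType d) (P : probability Omega R)
  (Phi : {RV P >-> config R}) (P0 : probability (config R) R).
Hypothesis hPhi : stationary_marked_point_process Phi.
Hypothesis hP0 : is_palm Phi P0.
Hypothesis hren : renewal_assumptions P0.
Context d' (Omega' : measurableType d') (Q : probability Omega' R) (Dinf : {RV Q >-> R}).
Hypothesis hconv : gaps_converge_weakly P0 Dinf.

Let model := palm_path_model hPhi hP0 hren.
Let gap_cvg := gaps_seen_cvg hPhi hP0 hren hconv.
Local Notation mu := (path_law P0).
Local Notation gap_limit := (distribution Q Dinf).
Local Notation limit_law := (stationary_law mu gap_limit).

Let limit_fresh : fresh_start mu limit_law := @fresh_start_stationary R mu gap_limit.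
Let limit_step := stationary_step model gap_cvg.

Lemma efficiency_ratioE (xi : hpath R) N : good xi -> efficiency_ratio xi N =
  ((\sum_(n < N) ideal (iter n step xi)) / (\sum_(n < N) actual (iter n step xi)))%R.
Proof.
move=> g; rewrite /efficiency_ratio; congr (_ / _)%R; apply: eq_bigr => n _.
  by rewrite ideal_timeE// idealE//; exact: good_iter_step.
by rewrite actual_timeE// actualE//; exact: good_iter_step.
Qed.

Lemma mean_ideal_time : 'E_limit_law[fun xi => ideal_time xi 0] =
  \int[limit_law]_xi (ideal xi)%:E.
Proof.
rewrite unlock; apply: ae_eq_integral => //.
- apply/measurable_EFinP; apply: measurable_funB.
    apply: (measurable_nat_index (f := fun c (xi : hpath R) => Xseq xi c) (@measurable_ckpt R 1)) => c.
    exact: measurable_Xseq.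
  exact: measurable_Xseq.
- by apply/measurable_EFinP; exact: measurable_ideal.
- apply: filterS (stationary_good model gap_cvg) => xi g _ /=.
  by rewrite ideal_timeE// idealE.
Qed.

Lemma mean_actual_time : 'E_limit_law[fun xi => actual_time xi 0] =
  \int[limit_law]_xi (actual xi)%:E.
Proof.
rewrite unlock; apply: ae_eq_integral => //.
- by apply/measurable_EFinP; exact: measurable_first_actual.
- by apply/measurable_EFinP; exact: measurable_actual.
- apply: filterS (stationary_good model gap_cvg) => xi g _ /=.
  by rewrite actual_timeE// actualE.
Qed.

(** If the mean actual time is infinite, then the actual times grow faster than
    linearly, and they dominate the ideal times. *)
Lemma efficiency_zero :
  \int[limit_law]_xi (actual xi)%:E = +oo -> efficiency_is P0 0%R.
Proof.
move=> EA.
have h1 : {ae mu, forall xi, forall j : nat, exists M K : R, forall N : nat,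
    (\sum_(n < N) ideal (iter n step xi) <=
     j.+1%:R^-1 * (\sum_(n < N) actual (iter n step xi)) + M * N%:R + K)%R}.
  by apply/ae_foralln => j; apply: (ideal_le_actual model); rewrite invr_gt0.
have h2 : {ae mu, forall xi, forall j : nat, exists K : R, forall N : nat,
    (j%:R * N%:R - K <= \sum_(n < N) actual (iter n step xi))%R}.
  apply/ae_foralln => j; apply: (averages_ge model limit_fresh limit_step).
  - exact: adapted_actual.
  - exact: measurable_actual.
  - exact: actual_ge0.
  - by rewrite EA ltry.
have h3 := good_ae model.
apply: filterS3 (ae_image_law h1) (ae_image_law h2) (ae_image_law h3) => phi k1 k2 g.
rewrite (_ : (fun N => _) = fun N => ((\sum_(n < N) ideal (iter n step (path_of phi))) /
    (\sum_(n < N) actual (iter n step (path_of phi))))%R); last first.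
  by apply/funext => N; exact: efficiency_ratioE.
apply: ratio_cvg0 => //.
- by move=> N; apply: sumr_ge0 => n _; exact: ideal_ge0.
- by move=> N; apply: sumr_ge0 => n _; exact: actual_ge0.
Qed.

Lemma limit_average (f : hpath R -> R) : adapted f -> measurable_fun setT f ->
  (forall xi, 0 <= f xi)%R -> \int[limit_law]_xi (f xi)%:E < +oo ->
  {ae mu, forall xi, (\sum_(n < N) f (iter n step xi)) / N%:R @[N --> \oo] -->
     fine (\int[limit_law]_xi (f xi)%:E)}%R.
Proof.
move=> af mf f0 fin; set I := \int[limit_law]_xi _ in fin *.
have I0 : 0 <= I by apply: integral_ge0 => xi _; rewrite lee_fin.
have IE : I = (fine I)%:E by rewrite fineK// ge0_fin_numE.
have j0 (j : nat) : (0 < j.+1%:R^-1 :> R)%R by rewrite invr_gt0.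
have h1 : {ae mu, forall xi, forall j : nat, exists K : R, forall N : nat,
    (\sum_(n < N) f (iter n step xi) <= (fine I + j.+1%:R^-1) * N%:R + K)%R}.
  apply/ae_foralln => j; apply: (averages_le model limit_fresh limit_step) => //.
  by rewrite -/I IE lte_fin ltrDl.
have h2 : {ae mu, forall xi, forall j : nat, exists K : R, forall N : nat,
    ((fine I - j.+1%:R^-1) * N%:R - K <= \sum_(n < N) f (iter n step xi))%R}.
  apply/ae_foralln => j; apply: (averages_ge model limit_fresh limit_step) => //.
  by rewrite -/I IE lte_fin gtrBl.
by apply: filterS2 h1 h2 => xi; exact: average_cvg.
Qed.

Lemma mean_actual_limit : \int[limit_law]_xi (actual xi)%:E =
  \int[gap_limit]_x mean_from mu (EFin \o @actual R) x.
Proof.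
apply: integral_stationary.
- by apply/measurable_EFinP; exact: measurable_actual.
- by move=> xi; rewrite lee_fin actual_ge0.
Qed.

Lemma efficiency_limit : 'E_Q[Dinf] < +oo -> mean_nu_inf P0 Dinf < +oo ->
  exists e : R, efficiency_is P0 e /\
    e%:E = 'E_limit_law[fun xi => ideal_time xi 0] /
           'E_limit_law[fun xi => actual_time xi 0].
Proof.
move=> hD hnu; rewrite mean_ideal_time mean_actual_time.
have pix : \int[gap_limit]_x (Num.max x 0)%:E < +oo.
  have mm : measurable_fun setT (fun x : R => (Num.max x 0)%:E : \bar R).
    by apply/measurable_EFinP; exact: measurable_maxr.
  have mD : measurable_fun setT Dinf by exact: measurable_funPT.
  rewrite (integral_image_law_any Q mD mm); move: hD; rewrite unlock.
  rewrite (ae_eq_integral (fun w => (Num.max (Dinf w) 0)%:E))//.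
  - exact/measurable_EFinP.
  - exact: (measurableT_comp mm mD).
  - apply: filterS (gap_limit_ge0 hPhi hP0 hren hconv) => w w0 _.
    by rewrite max_l.
have mi : measurable_fun setT (EFin \o @ideal R) by apply/measurable_EFinP; exact: measurable_ideal.
have EI : \int[limit_law]_xi (ideal xi)%:E < +oo.
  rewrite [X in X < _](integral_stationary mu gap_limit mi); last first.
    by move=> xi; rewrite lee_fin ideal_ge0.
  exact: (ideal_mean_fin model pix (mean_passage_fin hPhi hP0 hren hconv hnu)).
have EI0 : 0 <= \int[limit_law]_xi (ideal xi)%:E.
  by apply: integral_ge0 => xi _; rewrite lee_fin ideal_ge0.
have EA0 : 0 < \int[limit_law]_xi (actual xi)%:E.
  by rewrite mean_actual_limit; exact: (mean_actual_gt0 model).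
have [EA|EA] := eqVneq (\int[limit_law]_xi (actual xi)%:E) +oo.
  by exists 0%R; split; [exact: efficiency_zero|rewrite EA invey mule0].
have EAfin : \int[limit_law]_xi (actual xi)%:E < +oo by rewrite ltey.
have h1 := limit_average (@adapted_ideal R) (@measurable_ideal R) (@ideal_ge0 R) EI.
have h2 := limit_average (@adapted_actual R) (@measurable_actual R) (@actual_ge0 R) EAfin.
set I := \int[limit_law]_xi (ideal xi)%:E in EI EI0 h1 *.
set A := \int[limit_law]_xi (actual xi)%:E in EA EA0 EAfin h2 *.
have IE : I = (fine I)%:E by rewrite fineK// ge0_fin_numE.
have AE : A = (fine A)%:E by rewrite fineK// ge0_fin_numE// ltW.
have A0 : fine A != 0%R by rewrite gt_eqF// -lte_fin -AE.
exists (fine I / fine A)%R; split; last first.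
  by rewrite IE AE /= inver (negbTE A0).
have h3 := good_ae model.
apply: filterS3 (ae_image_law h1) (ae_image_law h2) (ae_image_law h3) => phi k1 k2 g.
rewrite (_ : (fun N => _) = fun N => ((\sum_(n < N) ideal (iter n step (path_of phi))) /
    (\sum_(n < N) actual (iter n step (path_of phi))))%R); last first.
  by apply/funext => N; exact: efficiency_ratioE.
exact: ratio_cvg A0 k1 k2.
Qed.

Lemma efficiency_zero_heavier_tail :
  heavier_tail (P0 \x Q) (Dinf_on_product Dinf) (@mark_on_product R d' Omega') ->
  efficiency_is P0 0%R.
Proof.
move=> [z0 hz]; apply: efficiency_zero; rewrite mean_actual_limit.
apply: (@mean_actual_infinite _ _ _ _ _ model _ z0) => z z0z.
have mz : measurable [set y : R | (z < y)%R] by exact: measurable_ltr.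
have mV := measurable_preimage (@measurable_config_mark R 0 0) mz.
have mD := measurable_preimage (measurable_funPT Dinf) mz.
have := hz z z0z.
rewrite (_ : [set w | (mark_on_product w > z)%R] =
  ((fun phi => Defs.mark phi 0 0) @^-1` [set y : R | (z < y)%R]) `*` setT); last first.
  by apply/seteqP; split => w //= [].
rewrite (_ : [set w | (Dinf_on_product Dinf w > z)%R] =
  setT `*` (Dinf @^-1` [set y : R | (z < y)%R])); last first.
  by apply/seteqP; split => w //= [].
have e1 := product_measure1E P0 Q mV measurableT.
have e2 := product_measure1E P0 Q measurableT mD.
rewrite [X in X <= _]e1 [X in _ <= X]e2.
by rewrite [X in _ * X <= _]probability_setT [X in _ <= X * _]probability_setT mule1 mul1e.
Qed.

End efficiency.

Theorem theorem10 (R : realType)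
  (d : measure_display) (Omega : measurableType d) (P : probability Omega R)
  (Phi : {RV P >-> config R}) (P0 : probability (config R) R)
  (hPhi : stationary_marked_point_process Phi)
  (hP0 : is_palm Phi P0)
  (hren : renewal_assumptions P0)
  (d' : measure_display) (Omega' : measurableType d') (Q : probability Omega' R)
  (Dinf : {RV Q >-> R})
  (hconv : gaps_converge_weakly P0 Dinf)
  (hnondeg : nondegenerate_rv Dinf) :
  exists Pinf : probability (hpath R) R,
    [/\ checkpoint_weak_limit P0 Pinf,
        ('E_Q[Dinf] < +oo)%E ->
        (mean_nu_inf P0 Dinf < +oo)%E ->
        strictly_heavier_tail (P0 \x Q)%E
          (@mark_on_product R d' Omega') (Dinf_on_product Dinf) ->
        exists e : R, efficiency_is P0 e /\
          (e%:E = 'E_Pinf[fun xi => ideal_time xi 0] /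
                  'E_Pinf[fun xi => actual_time xi 0])%E &
        heavier_tail (P0 \x Q)%E
          (Dinf_on_product Dinf) (@mark_on_product R d' Omega') ->
        efficiency_is P0 0].
Proof.
exists (stationary_law (path_law P0) (distribution Q Dinf)); split.
- exact: (checkpoint_weak_limit_stationary hPhi hP0 hren hconv).
- move=> hD hnu _; exact: (efficiency_limit hPhi hP0 hren hconv hD hnu).
- exact: (efficiency_zero_heavier_tail hPhi hP0 hren hconv).
Qed.
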